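(* Let $V$ be a bounded linear operator on $L^2[0,1]$. Then $V\in\mathcal{L}_T$ for a generic transformation $T\in\mathcal{T}$ (that is, the set $\{T\in\mathcal{T}: V\in\mathcal{L}_T\}$ is comeager in $\mathcal{T}$) if and only if $V=\lambda I+(1-\lambda)P_{\mathrm{const}}$ for some $\lambda\in[0,1]$.
   Context: $\mathcal{T}$ is the set of all invertible measure-preserving transformations of $[0,1]$ with Lebesgue measure $m$ (modulo null sets). Each $T\in\mathcal{T}$ is identified with its Koopman operator on $L^2[0,1]$, $(Tf)(x)=f(Tx)$, and $\mathcal{T}$ carries the strong$^*$ operator topology of the Koopman operators (on $\mathcal{T}$ it equals the weak and the strong operator topology), which makes it a Polish space. A subset is comeager if it contains a dense $G_\delta$ set. The weak limit semigroup $\mathcal{L}_T$ is the set of operators $S$ on $L^2[0,1]$ such that $T^{n_k}\to S$ in the weak operator topology for some strictly increasing sequence $(n_k)$ in $\mathbb{N}$. $P_{\mathrm{const}}$ is the orthogonal projection of $L^2[0,1]$ onto the constant functions. *)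

(* Defs.v *)
Set Warnings "-notation-overridden,-ambiguous-paths,-notation-incompatible-prefix".
From HB Require Import structures.
From mathcomp Require Import all_boot all_order all_algebra.
From mathcomp Require Import complex ring_quotient.
From mathcomp Require Import all_classical all_reals all_analysis.
From mathcomp Require Import measurable_realfun borel_hierarchy.
Set Implicit Arguments.
Unset Strict Implicit.
Unset Printing Implicit Defensive.
Import Order.TTheory GRing.Theory Num.Theory.
Import numFieldNormedType.Exports.
Local Open Scope classical_set_scope.
Local Open Scope ring_scope.

Definition unit_itv (R : realType) : Type := set_type (`[0, 1]%classic : set R).

Section UnitInterval.
Variable R : realType.

HB.instance Definition _ := Choice.copy (unit_itv R) (set_type (`[0, 1]%classic : set R)).

Lemma unit_itv_0_subproof : (0 : R) \in (`[0, 1]%classic : set R).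
Proof. by rewrite inE /= in_itv /= lexx ler01. Qed.

HB.instance Definition _ :=
  isPointed.Build (unit_itv R) (exist _ (0 : R) unit_itv_0_subproof).

Definition unit_itv_val (x : unit_itv R) : R := val x.

HB.instance Definition _ := Measurable.copy (unit_itv R)
  (g_sigma_algebra_preimageType unit_itv_val).

(* Lebesgue measure on the Borel sets of [0, 1]. *)
Definition unit_itv_measure (A : set (unit_itv R)) : \bar R :=
  lebesgue_measure (unit_itv_val @` A).

Lemma unit_itv_measurable_image (A : set (unit_itv R)) : measurable A ->
  measurable (unit_itv_val @` A).
Proof.
move=> [B mB <-]; rewrite setTI.
rewrite (_ : _ @` _ = B `&` `[0, 1]); first exact: measurableI.
apply/seteqP; split=> [_ [x Bx <-]|x [Bx x01]] /=.
  by split => //; exact: (set_mem (valP x)).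
by exists (exist _ x (mem_set x01)).
Qed.

Let unit_itv_measure0 : unit_itv_measure set0 = 0%E.
Proof. by rewrite /unit_itv_measure image_set0 measure0. Qed.

Let unit_itv_measure_ge0 A : (0 <= unit_itv_measure A)%E.
Proof. exact: measure_ge0. Qed.

Let unit_itv_measure_sigma_additive : semi_sigma_additive unit_itv_measure.
Proof.
move=> F mF tF mUF; rewrite /unit_itv_measure image_bigcup.
have /= := @measure_semi_sigma_additive _ _ _ (@lebesgue_measure R)
  (fun n => unit_itv_val @` F n).
apply.
- by move=> i; exact: unit_itv_measurable_image.
- move/trivIsetP : tF => tF; apply/trivIsetP => i j _ _ ij.
  rewrite -subset0 => _ [[x Fx <-] [y Fy /val_inj yx]].
  have := tF i j Logic.I Logic.I ij; rewrite -subset0 => /(_ x); apply.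
  by split; [exact: Fx|rewrite -yx].
- by rewrite -image_bigcup; exact: unit_itv_measurable_image.
Qed.

HB.instance Definition _ := isMeasure.Build _ _ _ unit_itv_measure
  unit_itv_measure0 unit_itv_measure_ge0 unit_itv_measure_sigma_additive.

Let unit_itv_measure_setT : unit_itv_measure setT = 1%E.
Proof.
rewrite /unit_itv_measure (_ : _ @` _ = `[0, 1]%classic).
  by rewrite lebesgue_measure_itv /= lte_fin ltr01 oppr0 adde0.
apply/seteqP; split=> [_ [x _ <-]|x x01] /=; first exact: (set_mem (valP x)).
by exists (exist _ x (mem_set x01)).
Qed.

HB.instance Definition _ :=
  Measure_isProbability.Build _ _ _ unit_itv_measure unit_itv_measure_setT.

End UnitInterval.

Section SquareIntegrable.
Context d (X : measurableType d) (R : realType).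
Variable mu : {measure set X -> \bar R}.

Definition sqint : {pred X -> R[i]} := [pred f : X -> R[i] |
  ((fun x => complex.Re (f x)) \in Lfun mu 2%:E) &&
  ((fun x => complex.Im (f x)) \in Lfun mu 2%:E)].

Lemma sqint_submod_closed : submod_closed sqint.
Proof.
have [L0 LD] := Lfun_submod_closed mu (lee1n 2 : (1 <= 2%:E :> \bar R)%E).
split; first by rewrite inE; apply/andP.
move=> a f g; rewrite !inE => /andP[fr fi] /andP[gr gi].
have comb (b c : R) (u v w : X -> R) : u \in Lfun mu 2%:E ->
    v \in Lfun mu 2%:E -> w \in Lfun mu 2%:E ->
    (fun x => b * u x + c * v x + w x) \in Lfun mu 2%:E.
  by move=> Lu Lv Lw; rewrite (_ : (fun _ => _) = b *: u + (c *: v + w));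
    [exact/LD/LD | apply/funext => x; rewrite !fctE addrA].
apply/andP; split.
- rewrite (_ : (fun _ => _) = fun x => complex.Re a * complex.Re (f x) +
    - complex.Im a * complex.Im (f x) + complex.Re (g x)); first exact: comb.
  apply/funext => x; rewrite !fctE /=.
  by case: a (f x) (g x) => [a1 a2] [f1 f2] [g1 g2] /=; rewrite mulNr.
- rewrite (_ : (fun _ => _) = fun x => complex.Re a * complex.Im (f x) +
    complex.Im a * complex.Re (f x) + complex.Im (g x)); first exact: comb.
  apply/funext => x; rewrite !fctE /=.
  by case: a (f x) (g x) => [a1 a2] [f1 f2] [g1 g2].
Qed.

HB.instance Definition _ :=
  GRing.isSubmodClosed.Build R[i] (X -> R[i]) sqint sqint_submod_closed.

Record L2fun := MkL2fun { L2fun_val :> X -> R[i]; L2funP : L2fun_val \in sqint }.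

HB.instance Definition _ := [isSub for L2fun_val].
HB.instance Definition _ := [Choice of L2fun by <:].
HB.instance Definition _ := [SubChoice_isSubLmodule of L2fun by <:].

Definition L2null : {pred L2fun} :=
  [pred f : L2fun | `[< {ae mu, forall x, f x = 0} >]].

Lemma L2null_zmod_closed : zmod_closed L2null.
Proof.
split; first by apply/asboolP/aeW.
move=> f g /asboolP f0 /asboolP g0; apply/asboolP.
apply: filterS2 f0 g0 => x fx gx.
by rewrite -[LHS]/(L2fun_val f x - L2fun_val g x) fx gx subr0.
Qed.

HB.instance Definition _ :=
  GRing.isZmodClosed.Build L2fun L2null L2null_zmod_closed.

(* L^2(mu) with complex scalars: classes of square-integrable functions modulo
   equality almost everywhere. *)
Definition L2 : Type := Quotient.quot L2null.

HB.instance Definition _ := Choice.on L2.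
HB.instance Definition _ := EqQuotient.on L2.
HB.instance Definition _ := GRing.Zmodule.on L2.

End SquareIntegrable.

Section L2Space.
Context d (X : measurableType d) (R : realType).
Variable mu : {measure set X -> \bar R}.

Notation L2fun := (L2fun mu).
Notation L2 := (L2 mu).
Definition L2class (f : L2fun) : L2 := (\pi_(L2) f)%qT.

Lemma L2classP (f g : L2fun) : L2class f = L2class g <-> f = g %[ae mu].
Proof.
have -> : (L2class f = L2class g) <-> (f - g \in @L2null _ _ _ mu).
  rewrite Quotient.idealrBE; split=> [|/eqP//]; by move=> /eqP.
split=> [/asboolP|] fg; last apply/asboolP.
- apply: filterS fg => x fgx _.
  by apply/eqP; rewrite -subr_eq0; apply/eqP; exact: fgx.
- apply: filterS fg => x /(_ Logic.I) fgx.
  by rewrite -[LHS]/(L2fun_val f x - L2fun_val g x) fgx subrr.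
Qed.

Lemma L2repr_ae (f : L2fun) : repr (L2class f) = f %[ae mu].
Proof. by apply/L2classP; rewrite /L2class reprK. Qed.

Definition L2scale (a : R[i]) (f : L2) : L2 := L2class (a *: repr f).

Lemma L2scaleE a (f : L2fun) : L2scale a (L2class f) = L2class (a *: f).
Proof.
apply/L2classP; apply: filterS (L2repr_ae f) => x /(_ Logic.I) fx _.
by have E (h : L2fun) : (a *: h) x = a * h x := erefl; rewrite !E fx.
Qed.

Let L2class_repr f : L2class (repr f) = f. Proof. exact: reprK. Qed.

Let L2classD f g : L2class (f + g) = L2class f + L2class g.
Proof. exact: raddfD. Qed.

Let scaleA a b f : L2scale a (L2scale b f) = L2scale (a * b) f.
Proof. by rewrite -[f]L2class_repr !L2scaleE scalerA. Qed.

Let scale1 : left_id 1 L2scale.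
Proof. by move=> f; rewrite -[f]L2class_repr L2scaleE scale1r. Qed.

Let scaleDr : right_distributive L2scale +%R.
Proof.
move=> a f g; rewrite -[f]L2class_repr -[g]L2class_repr.
by rewrite -L2classD !L2scaleE -L2classD scalerDr.
Qed.

Let scaleDl f : {morph L2scale^~ f : a b / a + b}.
Proof.
by move=> a b; rewrite -[f]L2class_repr !L2scaleE -L2classD scalerDl.
Qed.

HB.instance Definition _ :=
  GRing.Zmodule_isLmodule.Build R[i] L2 scaleA scale1 scaleDr scaleDl.

Lemma modulusE (z : R[i]) :
  Normc.normc z = (complex.Re z ^+ 2 + complex.Im z ^+ 2) `^ 2^-1.
Proof. by case: z => a b /=; rewrite powR12_sqrt// addr_ge0// sqr_ge0. Qed.

Lemma measurable_modulus (f : L2fun) :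
  measurable_fun setT (fun x => Normc.normc (f x)).
Proof.
case: f => f /= /andP[/andP[+ _] /andP[+ _]]; rewrite !inE /= => mr mi.
under eq_fun do rewrite modulusE.
apply: (@measurableT_comp _ _ _ _ _ _ (@powR R ^~ 2^-1)) => //.
by apply: measurable_funD; exact: measurable_funX.
Qed.

Lemma le_Lnorm2 (u v : X -> R) : measurable_fun setT u -> measurable_fun setT v ->
  (forall x, 0 <= u x <= v x) ->
  ('N[mu]_2%:E[EFin \o u] <= 'N[mu]_2%:E[EFin \o v])%E.
Proof.
move=> mu_ mv uv; rewrite unlock /Lnorm gt0_ler_poweR//.
- by rewrite in_itv/= leey integral_ge0.
- by rewrite in_itv/= leey integral_ge0.
have mpow (w : X -> R) : measurable_fun setT w ->
    measurable_fun setT (fun x => (`|(EFin \o w) x| `^ 2)%E).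
  move=> mw; under eq_fun do rewrite /=.
  apply/measurable_EFinP.
  apply/(@measurableT_comp _ _ _ _ _ _ (fun x : R => x `^ 2)%R) => //.
  exact/measurableT_comp.
apply: ge0_le_integral => //;
  [by move=> x _; exact: poweR_ge0|exact: mpow|exact: mpow|move=> x _ /=].
have /andP[u0 uv_] := uv x.
by rewrite lee_fin ge0_ler_powR// ?nnegrE// !ger0_norm// (le_trans u0).
Qed.

Lemma modulus_Lfun (f : L2fun) : (fun x => Normc.normc (f x)) \in Lfun mu 2%:E.
Proof.
apply/andP; split; first by rewrite inE; exact: measurable_modulus.
rewrite inE /= /finite_norm.
have /andP[Lr Li] := L2funP f.
have := Lfun2_integrable_sqr Lr; have := Lfun2_integrable_sqr Li.
move=> /integrableD H /H - /(_ measurableT) /integrableP[_ fin].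
rewrite unlock /Lnorm poweR_lty//; move: fin; congr (_ < _)%E.
apply: eq_integral => x _ /=.
rewrite !ger0_norm ?addr_ge0 ?sqr_ge0// ?powR_ge0// modulusE.
  by rewrite -powRrM mulVf// powRr1 ?addr_ge0 ?sqr_ge0// addrC.
exact: powR_ge0.
Qed.

Definition L2norm (f : L2) : R :=
  fine 'N[mu]_2%:E[EFin \o (fun x => Normc.normc (repr f x))].

Let L2fun_norm (f : L2fun) : R :=
  fine 'N[mu]_2%:E[EFin \o (fun x => Normc.normc (f x))].

Let L2fun_norm_fin (f : L2fun) :
  ((L2fun_norm f)%:E = 'N[mu]_2%:E[EFin \o (fun x => Normc.normc (f x))])%E.
Proof.
rewrite fineK// ge0_fin_numE ?Lnorm_ge0//.
by have /andP[_] := modulus_Lfun f; rewrite inE.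
Qed.

Let L2fun_norm_ge0 (f : L2fun) : 0 <= L2fun_norm f.
Proof. by rewrite -lee_fin L2fun_norm_fin Lnorm_ge0. Qed.

Let L2normE (f : L2fun) : L2norm (L2class f) = L2fun_norm f.
Proof.
congr fine; rewrite unlock /Lnorm; congr (_ `^ _)%E.
have mpow (g : L2fun) :
    measurable_fun setT (fun x => `|(EFin \o (fun x => Normc.normc (g x))) x| `^ 2)%E.
  apply/measurable_EFinP.
  apply/(@measurableT_comp _ _ _ _ _ _ (fun x : R => x `^ 2)%R) => //.
  exact/measurableT_comp/measurable_modulus.
apply: ae_eq_integral; [by []|exact: mpow|exact: mpow|].
by apply: filterS (L2repr_ae f) => x /= fx /fx ->.
Qed.

Let L2fun_normD (f g : L2fun) : L2fun_norm (f + g) <= L2fun_norm f + L2fun_norm g.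
Proof.
rewrite -lee_fin EFinD !L2fun_norm_fin.
have mM := measurable_modulus.
apply: le_trans (eminkowski mu (mM f) (mM g) (lee1n 2)).
apply: le_Lnorm2; [exact: mM|exact: measurable_funD (mM f) (mM g)|move=> x].
have E : (f + g) x = f x + g x := erefl.
rewrite E le_normcD andbT.
by case: (f x + g x) => a b /=.
Qed.

Let L2fun_normZ (a : R[i]) (f : L2fun) :
  L2fun_norm (a *: f) = Normc.normc a * L2fun_norm f.
Proof.
apply: EFin_inj; rewrite EFinM !L2fun_norm_fin.
pose F : LfunType mu (lee1n 2) := Lfun_Sub (lee1n 2) (modulus_Lfun f).
have := LnormZ F (Normc.normc a).
have -> : `|Normc.normc a| = Normc.normc a.
  by rewrite ger0_norm//; case: a => b c /=.
move=> <-; apply: eq_Lnorm => x /=; congr EFin.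
exact: (Normc.normcM a (f x)).
Qed.

Let L2fun_norm0_eq0 (f : L2fun) : L2fun_norm f = 0 -> f = 0 %[ae mu].
Proof.
pose F : LfunType mu (lee1n 2) := Lfun_Sub (lee1n 2) (modulus_Lfun f).
move=> /(@fine_Lnormr_eq0 _ _ _ _ _ _ F); apply: filterS => x /= h /h.
by move=> /Normc.eq0_normc.
Qed.

Let cnorm (f : L2) : R[i] := (L2norm f)%:C%C.

Let cnormD f g : cnorm (f + g) <= cnorm f + cnorm g.
Proof.
rewrite -[f]L2class_repr -[g]L2class_repr -L2classD /cnorm !L2normE.
by rewrite -rmorphD /= lecR; exact: L2fun_normD.
Qed.

Let cnormZ (a : R[i]) f : cnorm (a *: f) = `|a| * cnorm f.
Proof.
rewrite -[f]L2class_repr.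
have -> : a *: L2class (repr f) = L2class (a *: repr f) := L2scaleE _ _.
by rewrite /cnorm !L2normE L2fun_normZ rmorphM.
Qed.

Let cnorm0_eq0 f : cnorm f = 0 -> f = 0.
Proof.
rewrite -[f]L2class_repr /cnorm L2normE => -[] /L2fun_norm0_eq0 f0.
have -> : (0 : L2) = L2class 0 by rewrite [RHS]raddf0.
exact/L2classP.
Qed.

HB.instance Definition _ :=
  Lmodule_isNormed.Build R[i] L2 cnormD cnormZ cnorm0_eq0.

Lemma L2_normE (f : L2) : `|f| = (L2norm f)%:C%C.
Proof. by []. Qed.

End L2Space.

Section Operators.
Context d (X : measurableType d) (R : realType).
Variable mu : {measure set X -> \bar R}.
Notation L2 := (L2 mu).

(* Linear in the first argument, conjugate-linear in the second. *)
Definition inner (f g : L2) : R[i] :=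
  Complex (\int[mu]_x complex.Re (repr f x * conjc (repr g x)))%R
          (\int[mu]_x complex.Im (repr f x * conjc (repr g x)))%R.

Definition bounded_operator (V : {linear L2 -> L2}) : Prop :=
  exists M : R, forall f, `|V f| <= M%:C%C * `|f|.

(* The value chosen by xget is unique when it exists; the default is used only
   for maps that have no adjoint. The same holds for orth_proj below. *)
Definition adjoint (A : L2 -> L2) : L2 -> L2 :=
  xget (fun=> 0) [set B | forall f g, inner (A f) g = inner f (B g)].

(* Sequential convergence in the weak operator topology. *)
Definition wot_cvg (A : nat -> L2 -> L2) (S : L2 -> L2) : Prop :=
  forall f g : L2,
    (fun k => inner (A k f) g : R[i]^o) @ \oo --> (inner (S f) g : R[i]^o).

Definition constant_functions : set L2 :=
  [set f : L2 | exists c : R[i], (repr f : X -> R[i]) = cst c %[ae mu]].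

Definition orth_proj (M : set L2) (f : L2) : L2 :=
  xget 0 [set g | M g /\ forall h, M h -> inner (f - g) h = 0].

Definition Pconst : L2 -> L2 := orth_proj constant_functions.

End Operators.

Section Transformations.
Context d (X : measurableType d) (R : realType).
Variable mu : {measure set X -> \bar R}.
Notation L2 := (L2 mu).

Definition measure_preserving (T : X -> X) : Prop :=
  forall A, measurable A -> mu (T @^-1` A) = mu A.

(* {mfun_ mu, X >-> X} is the type of measurable self-maps of X modulo equality
   almost everywhere, so the inverse is an almost everywhere inverse. On a
   standard Borel space such as [0, 1] these are exactly the classes of the
   bijective, bi-measurable, measure-preserving self-maps. *)
Definition invertible_mp : set {mfun_ mu, X >-> X} :=
  [set T | measure_preserving T /\
    exists S : {mfun_ mu, X >-> X}, [/\ measure_preserving S,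
      S \o T = id %[ae mu] & T \o S = id %[ae mu]]].

Record autom := MkAutom {
  autom_fun :> {mfun_ mu, X >-> X}; automP : autom_fun \in invertible_mp }.

HB.instance Definition _ := [isSub for autom_fun].
HB.instance Definition _ := [Choice of autom by <:].

Lemma autom_measurable (T : autom) : measurable_fun setT T.
Proof. exact: (@measurable_funPT _ _ _ _ (repr (autom_fun T))). Qed.

Lemma autom_preserving (T : autom) : measure_preserving T.
Proof. by have /set_mem[] := automP T. Qed.

Lemma Lfun_comp_autom (T : autom) (u : X -> R) :
  u \in Lfun mu 2%:E -> (fun x => u (T x)) \in Lfun mu 2%:E.
Proof.
move=> /andP[]; rewrite !inE /= => mu_ fu.
have mT := autom_measurable T.
apply/andP; split; first by rewrite inE; exact: (measurableT_comp mu_ mT).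
rewrite inE /= /finite_norm; move: fu; rewrite /finite_norm.
congr (_ < _)%E; rewrite unlock /Lnorm; congr (_ `^ _)%E.
have mf : measurable_fun setT (fun x => (`|(EFin \o u) x| `^ 2)%E).
  apply/measurable_EFinP.
  apply/(@measurableT_comp _ _ _ _ _ _ (fun x : R => x `^ 2)%R) => //.
  exact/measurableT_comp.
rewrite -[RHS](@ge0_integral_pushforward _ _ _ _ _ T mT mu setT
  (fun x => (`|(EFin \o u) x| `^ 2)%E))//.
  by apply: eq_measure_integral => A mA _; rewrite [RHS]autom_preserving.
by move=> x _; exact: poweR_ge0.
Qed.

Lemma koopman_subproof (T : autom) (f : L2) :
  (fun x => repr f (T x)) \in sqint mu.
Proof.
have /andP[Lr Li] := L2funP (repr f).
by apply/andP; split; [exact: (Lfun_comp_autom T Lr)|exact: (Lfun_comp_autom T Li)].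
Qed.

Definition koopman (T : autom) (f : L2) : L2 :=
  L2class (MkL2fun (koopman_subproof T f)).

(* The strong* operator topology is the initial topology for the maps
   T |-> U_T f and T |-> U_T^* f, with f in L^2 and U_T the Koopman operator. *)
Definition strong_star (T : autom) : {ptws L2 -> (L2 * L2)%type} :=
  fun f => (koopman T f, adjoint (koopman T) f).

HB.instance Definition _ := Topological.copy autom (initial_topology strong_star).

Definition weak_limit_semigroup (T : autom) : set {linear L2 -> L2} :=
  [set S | exists2 n : nat -> nat, {homo n : i j / (i < j)%N} &
    wot_cvg (fun k => iter (n k) (koopman T)) S].

End Transformations.

Definition comeager (T : topologicalType) (A : set T) : Prop :=
  exists G : set T, [/\ Gdelta G, dense G & G `<=` A].

(* Main.v *)
(* Suppose V is a weak limit of powers of T for generic T. Then V commutes with a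
   dense set of Koopman operators, hence with all of them, in particular with every
   permutation of the 2 ^ r dyadic cells. So the matrix of V on these cells has one
   value x_r on the diagonal and one value y_r off it; these are nonnegative, and
   refinement together with V 1 = 1 leaves a single parameter lambda, which
   nonnegativity for all r forces into [0, 1].

   Conversely, fix lambda. The transformations having, for some large n and l, a
   power T ^ n whose matrix on the cells of rank l is 8 ^ - l close to that of the
   mixture form an open set. It is dense: the transition frequencies of T are
   approximated by those of a periodic word of period Q, and the word is written on
   towers of height Q q - a. After n = Q q steps a tower of height Q q - a acts as
   the shift by a. Taking a = 0 on a proportion lambda of the towers and a uniform
   in [0, Q) on the others, T ^ n is close to the identity on the former and, up to
   the labels of the word, independent of the starting point on the latter. The
   intersection of these open sets is dense by a Baire argument: a sequence T_k such
   that T_k and its inverse are L2-Cauchy fast enough converges almost everywhere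
   to an invertible measure-preserving map. *)
Require Import Defs.
From mathcomp Require Import finmap all_fingroup all_boot all_order all_algebra.
From mathcomp Require Import complex.
From mathcomp Require Import all_classical all_reals all_analysis.
From mathcomp Require Import measurable_realfun ring lra zify.
Set Implicit Arguments.
Unset Strict Implicit.
Unset Printing Implicit Defensive.
Import Order.TTheory GRing.Theory Num.Theory.
Import numFieldNormedType.Exports.
Local Open Scope classical_set_scope.
Local Open Scope ring_scope.

(** * The Hilbert space and the Koopman operators *)

(** On isometries weak convergence is strong, so convergence to [T] is tested on the numbers
    [m(T^-1 C_j & C_i)] for dyadic cells. Density therefore asks for permutations of small cells
    with prescribed one-step frequencies; their frequencies after n steps can still be chosen
    freely. The word exists because the frequencies of [T] have equal row and column sums. Rounded
    down, they are dominated by the transition counts of a permutation of labelled points, and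
    concatenating long orbit segments of it leaves only the seams uncontrolled. Averaging the shift
    over a full period turns pair counts into products of letter counts, which produces [Pconst].
    Counts are bounded from below only: both families of frequencies add up to 1, so upper bounds
    follow. For the Baire argument, completeness rests on a single vector, the coordinate function,
    whose images under the Koopman operators of [T] and its inverse are these maps themselves. The
    limit of the maps and the limit of their inverses must then be shown inverse to each other.
    Regularity of the pointwise topology replaces closed balls. *)

Section InnerProduct.
Context d (X : measurableType d) (R : realType).
Variable mu : {measure set X -> \bar R}.
Notation L2fun := (L2fun mu).
Notation L2 := (L2 mu).

Lemma L2class_repr (f : L2) : L2class (repr f) = f.
Proof. exact: reprK. Qed.

Lemma L2class_ind (P : L2 -> Prop) : (forall f, P (L2class f)) -> forall f, P f.
Proof. by move=> H f; rewrite -(L2class_repr f). Qed.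

Lemma L2classD (f g : L2fun) : L2class (f + g) = L2class f + L2class g.
Proof. exact: raddfD. Qed.

Lemma L2classZ a (f : L2fun) : L2class (a *: f) = a *: L2class f.
Proof. by rewrite -L2scaleE. Qed.

Lemma ReL2 (f : L2fun) : (fun x => complex.Re (f x)) \in Lfun mu 2%:E.
Proof. by have /andP[] := L2funP f. Qed.

Lemma ImL2 (f : L2fun) : (fun x => complex.Im (f x)) \in Lfun mu 2%:E.
Proof. by have /andP[] := L2funP f. Qed.

Lemma Lfun_measurable (u : X -> R) : u \in Lfun mu 2%:E -> measurable_fun setT u.
Proof. by move=> /andP[]; rewrite inE. Qed.

Lemma integrableM2 (u v : X -> R) : u \in Lfun mu 2%:E -> v \in Lfun mu 2%:E ->
  mu.-integrable setT (EFin \o (fun x => u x * v x)).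
Proof. by move=> Lu Lv; apply/Lfun1_integrable; exact: Lfun2_mul_Lfun1. Qed.

Lemma ReM_conj (a b : R[i]) : complex.Re (a * conjc b) =
  complex.Re a * complex.Re b + complex.Im a * complex.Im b.
Proof. by case: a b => [a1 a2] [b1 b2] /=; rewrite mulrN opprK. Qed.

Lemma ImM_conj (a b : R[i]) : complex.Im (a * conjc b) =
  complex.Im a * complex.Re b - complex.Re a * complex.Im b.
Proof. by case: a b => [a1 a2] [b1 b2] /=; ring. Qed.

Lemma ReM (a b : R[i]) : complex.Re (a * b) =
  complex.Re a * complex.Re b - complex.Im a * complex.Im b.
Proof. by case: a b => [a1 a2] [b1 b2]. Qed.

Lemma ImM (a b : R[i]) : complex.Im (a * b) =
  complex.Re a * complex.Im b + complex.Im a * complex.Re b.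
Proof. by case: a b => [a1 a2] [b1 b2]. Qed.

Lemma integrable_ReM (f g : L2fun) :
  mu.-integrable setT (EFin \o (fun x => complex.Re (f x * conjc (g x)))).
Proof.
rewrite (_ : _ \o _ = (EFin \o (fun x => complex.Re (f x) * complex.Re (g x))) \+
  (EFin \o (fun x => complex.Im (f x) * complex.Im (g x)))).
  by apply: integrableD => //; apply: integrableM2; (exact: ReL2 || exact: ImL2).
by apply/funext => x /=; rewrite ReM_conj.
Qed.

Lemma integrable_ImM (f g : L2fun) :
  mu.-integrable setT (EFin \o (fun x => complex.Im (f x * conjc (g x)))).
Proof.
rewrite (_ : _ \o _ = ((EFin \o (fun x => (complex.Im (f x) * complex.Re (g x))%R)) \-
  (EFin \o (fun x => (complex.Re (f x) * complex.Im (g x))%R)))%E).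
  by apply: integrableB => //; apply: integrableM2; (exact: ReL2 || exact: ImL2).
by apply/funext => x /=; rewrite ImM_conj.
Qed.

Lemma ae_eq_Rintegral (u v : X -> R) : measurable_fun setT u ->
  measurable_fun setT v -> u = v %[ae mu] ->
  \int[mu]_x (u x) = \int[mu]_x (v x).
Proof.
move=> mu_ mv uv; rewrite /Rintegral; congr fine.
apply: ae_eq_integral => //; [exact/measurable_EFinP|exact/measurable_EFinP|].
by apply: filterS uv => x /[apply] ->.
Qed.

Lemma inner_class (f g : L2fun) : inner (L2class f) (L2class g) =
  Complex (\int[mu]_x complex.Re (f x * conjc (g x)))%R
          (\int[mu]_x complex.Im (f x * conjc (g x)))%R.
Proof.
have H (f0 g0 : L2fun) : measurable_fun setT (fun x => complex.Re (f0 x * conjc (g0 x))).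
  by apply/measurable_EFinP; exact: measurable_int (integrable_ReM f0 g0).
have H' (f0 g0 : L2fun) : measurable_fun setT (fun x => complex.Im (f0 x * conjc (g0 x))).
  by apply/measurable_EFinP; exact: measurable_int (integrable_ImM f0 g0).
rewrite /inner; congr Complex; apply: ae_eq_Rintegral => //;
  by apply: filterS2 (L2repr_ae f) (L2repr_ae g) => x /(_ Logic.I) -> /(_ Logic.I) ->.
Qed.

Lemma innerDl (f g h : L2) : inner (f + g) h = inner f h + inner g h.
Proof.
elim/L2class_ind: f => f; elim/L2class_ind: g => g; elim/L2class_ind: h => h.
rewrite -L2classD !inner_class.
apply/eqP; rewrite eq_complex /=; apply/andP; split; apply/eqP.
  rewrite -RintegralD//; [|exact: integrable_ReM..].
  by apply: eq_Rintegral => x _; rewrite -raddfD -mulrDl.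
rewrite -RintegralD//; [|exact: integrable_ImM..].
by apply: eq_Rintegral => x _; rewrite -raddfD -mulrDl.
Qed.

Lemma innerZl a (f g : L2) : inner (a *: f) g = a * inner f g.
Proof.
elim/L2class_ind: f => f; elim/L2class_ind: g => g.
rewrite -L2classZ !inner_class.
have i1 := integrable_ReM f g; have i2 := integrable_ImM f g.
have cI (c : R) (u : X -> R) : mu.-integrable setT (EFin \o u) ->
    mu.-integrable setT (EFin \o (fun x => c * u x)).
  by move=> iu; exact: (integrableZl measurableT c iu).
case: a => a b; apply/eqP; rewrite eq_complex /=; apply/andP; split; apply/eqP.
  rewrite -!RintegralZl// -RintegralB//; [|exact: cI..].
  by apply: eq_Rintegral => x _; rewrite -mulrA ReM.
rewrite -!RintegralZl// -RintegralD//; [|exact: cI..].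
by apply: eq_Rintegral => x _; rewrite -mulrA ImM.
Qed.

Lemma inner_sym (f g : L2) : inner g f = conjc (inner f g).
Proof.
rewrite /inner /=; congr Complex.
  by apply: eq_Rintegral => x _; rewrite !ReM_conj; ring.
rewrite -mulN1r -RintegralZl//; last exact: integrable_ImM.
by apply: eq_Rintegral => x _; rewrite !ImM_conj; ring.
Qed.

Lemma inner_norm (f : L2) : inner f f = (L2norm f ^+ 2)%:C%C.
Proof.
rewrite /inner; congr Complex; last first.
  by under eq_Rintegral do rewrite ImM_conj mulrC subrr; rewrite /Rintegral integral0.
rewrite /L2norm Lnorm.unlock.
set I := (\int[mu]_x _)%E.
have IE : I = (\int[mu]_x (complex.Re (repr f x * conjc (repr f x)))%:E)%E.
  apply: eq_integral => x _.
  rewrite -[LHS]/((`|Normc.normc (repr f x)| `^ 2)%:E) ger0_norm; last first.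
    by rewrite modulusE powR_ge0.
  rewrite ReM_conj modulusE -powRrM mulVf// powRr1 ?addr_ge0 ?sqr_ge0//.
have I0 : (0 <= I)%E by apply: integral_ge0 => x _; rewrite lee_fin powR_ge0.
rewrite /Rintegral -IE.
have : I \is a fin_num by rewrite IE; exact: integrable_fin_num (integrable_ReM _ _).
by case: I I0 {IE} => // r; rewrite lee_fin => r0 _ /=; rewrite -powR_mulrn ?powR_ge0// -powRrM mulVf// powRr1.
Qed.

End InnerProduct.

#[global] Opaque inner.

Section HilbertFacts.
Context d (X : measurableType d) (R : realType).
Variable mu : {measure set X -> \bar R}.
Notation L2fun := (L2fun mu).
Notation L2 := (L2 mu).
Implicit Types f g h : L2.

Lemma innerDr f g h : inner h (f + g) = inner h f + inner h g.
Proof. by rewrite !(inner_sym _ h) innerDl rmorphD. Qed.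

Lemma innerZr a f g : inner f (a *: g) = conjc a * inner f g.
Proof. by rewrite !(inner_sym _ f) innerZl rmorphM. Qed.

Lemma innerNl f g : inner (- f) g = - inner f g.
Proof. by rewrite -scaleN1r innerZl mulN1r. Qed.

Lemma innerNr f g : inner f (- g) = - inner f g.
Proof. by rewrite !(inner_sym _ f) innerNl rmorphN. Qed.

Lemma innerBl f g h : inner (f - g) h = inner f h - inner g h.
Proof. by rewrite innerDl innerNl. Qed.

Lemma innerBr f g h : inner h (f - g) = inner h f - inner h g.
Proof. by rewrite innerDr innerNr. Qed.

Lemma inner0l f : inner 0 f = 0.
Proof. by rewrite -(scale0r 0) innerZl mul0r. Qed.

Lemma inner0r f : inner f 0 = 0.
Proof. by rewrite inner_sym inner0l rmorph0. Qed.

Lemma inner_suml I (r : seq I) (P : pred I) (F : I -> L2) g :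
  inner (\sum_(i <- r | P i) F i) g = \sum_(i <- r | P i) inner (F i) g.
Proof.
by apply: (big_morph (fun f => inner f g)) => [f h|]; rewrite ?innerDl ?inner0l.
Qed.

Lemma inner_sumr I (r : seq I) (P : pred I) (F : I -> L2) g :
  inner g (\sum_(i <- r | P i) F i) = \sum_(i <- r | P i) inner g (F i).
Proof.
by apply: (big_morph (fun f => inner g f)) => [f h|]; rewrite ?innerDr ?inner0r.
Qed.

Lemma normRC (x : R) : Normc.normc x%:C%C = `|x|.
Proof. by rewrite /= expr0n addr0 sqrtr_sqr. Qed.

Lemma ltCR (z : R[i]) (e : R) : (`|z| < e%:C%C) = (Normc.normc z < e).
Proof. by rewrite -ltcR. Qed.

Lemma gt0C (e : R[i]) : 0 < e -> exists2 r : R, 0 < r & e = r%:C%C.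
Proof.
case: e => a b; rewrite ltcE /= => /andP[/eqP b0 a0].
by exists a => //; rewrite b0.
Qed.

Lemma normc_le (z : R[i]) : Normc.normc z <= `|complex.Re z| + `|complex.Im z|.
Proof.
case: z => a b /=; rewrite -[leRHS]ger0_norm ?addr_ge0// -sqrtr_sqr.
rewrite ler_wsqrtr// sqrrD !real_normK ?num_real// lerD2r lerDl.
by rewrite mulrn_wge0 ?mulr_ge0.
Qed.

Lemma Re_normc (z : R[i]) : `|complex.Re z| <= Normc.normc z.
Proof. by case: z => a b /=; rewrite -sqrtr_sqr ler_wsqrtr// lerDl sqr_ge0. Qed.

Lemma L2norm_ge0 f : 0 <= L2norm f.
Proof. by have := normr_ge0 f; rewrite L2_normE lecR. Qed.

Lemma L2normD f g : L2norm (f + g) <= L2norm f + L2norm g.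
Proof. by have := ler_normD f g; rewrite !L2_normE -rmorphD lecR. Qed.

Lemma L2normN f : L2norm (- f) = L2norm f.
Proof. by have := normrN f; rewrite !L2_normE => -[]. Qed.

Lemma L2normBC f g : L2norm (f - g) = L2norm (g - f).
Proof. by rewrite -L2normN opprB. Qed.

Lemma L2normZ a f : L2norm (a *: f) = Normc.normc a * L2norm f.
Proof. by have := normrZ a f; rewrite !L2_normE -rmorphM => -[]. Qed.

Lemma L2norm_eq0 f : L2norm f = 0 -> f = 0.
Proof. by move=> f0; apply/eqP; rewrite -normr_eq0 L2_normE f0. Qed.

Lemma L2normsq_Re f : L2norm f ^+ 2 = complex.Re (inner f f).
Proof. by rewrite inner_norm. Qed.

Lemma L2normBsq f g : L2norm (f - g) ^+ 2 =
  L2norm f ^+ 2 - 2 * complex.Re (inner f g) + L2norm g ^+ 2.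
Proof.
rewrite !L2normsq_Re innerBl !innerBr (inner_sym f g).
by case: (inner f f) (inner f g) (inner g g) => [a ?] [b ?] [c ?] /=; ring.
Qed.

(** Cauchy-Schwarz: with norms a and b of [f] and [g], the squared norm of [b f - a g] is 2ab(ab -
    Re<f, g>). *)
Lemma Re_inner_le f g : complex.Re (inner f g) <= L2norm f * L2norm g.
Proof.
have [f0|f0] := eqVneq (L2norm f) 0.
  by rewrite f0 mul0r (L2norm_eq0 f0) inner0l.
have [g0|g0] := eqVneq (L2norm g) 0.
  by rewrite g0 mulr0 (L2norm_eq0 g0) inner0r.
have a0 : 0 < L2norm f by rewrite lt_def f0 L2norm_ge0.
have b0 : 0 < L2norm g by rewrite lt_def g0 L2norm_ge0.
have := sqr_ge0 (L2norm ((L2norm g)%:C%C *: f - (L2norm f)%:C%C *: g)).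
rewrite L2normBsq !L2normZ !normRC !ger0_norm ?L2norm_ge0// innerZl innerZr.
rewrite conjc_real mulrA -rmorphM ReM /= mul0r subr0 => H.
have : 0 <= (L2norm g * L2norm f) * (L2norm f * L2norm g - complex.Re (inner f g)). by nra.
by rewrite pmulr_rge0 ?mulr_gt0// subr_ge0.
Qed.

(** Real and imaginary parts are bounded separately, the latter as the real part for [- i f]; hence
    the constant 2 instead of 1. *)
Lemma inner_bound f g : Normc.normc (inner f g) <= 2 * (L2norm f * L2norm g).
Proof.
apply: le_trans (normc_le _) _; rewrite mulrDl mul1r; apply: lerD.
  rewrite ler_norml Re_inner_le andbT lerNl.
  by rewrite -raddfN /= -innerNl (le_trans (Re_inner_le _ _))// L2normN.
have E : complex.Im (inner f g) = complex.Re (inner ((- 'i%C) *: f) g).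
  by rewrite innerZl ReM /=; ring.
have E' : Normc.normc (- 'i%C : R[i]) = 1.
  by rewrite /= oppr0 expr0n /= add0r sqrrN expr1n sqrtr1.
rewrite E ler_norml; apply/andP; split; last first.
  by rewrite (le_trans (Re_inner_le _ _))// L2normZ E' mul1r.
rewrite lerNl -raddfN /= -innerNl (le_trans (Re_inner_le _ _))//.
by rewrite L2normN L2normZ E' mul1r.
Qed.

Lemma inner_inj f : (forall g, inner f g = 0) -> f = 0.
Proof.
move=> /(_ f); rewrite inner_norm => -[] /eqP; rewrite sqrf_eq0 => /eqP.
exact: L2norm_eq0.
Qed.

End HilbertFacts.

(** * Koopman operators as isometries, their inverses and adjoints *)

Section Koopman.
Context d (X : measurableType d) (R : realType).
Variable mu : {measure set X -> \bar R}.
Notation L2fun := (L2fun mu).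
Notation L2 := (L2 mu).
Implicit Types (f g : L2) (T : autom mu).

(** Preimages of null sets are null; this makes the Koopman operator independent of the
    representative of a class. *)
Lemma ae_comp (T : X -> X) (P : set X) : measurable_fun setT T ->
  measure_preserving mu T ->
  {ae mu, forall x, P x} -> {ae mu, forall x, P (T x)}.
Proof.
move=> mT pT [N [mN N0 PN]]; exists (T @^-1` N); split.
- by rewrite -[_ @^-1` _]setTI; exact: mT.
- by rewrite pT.
- by move=> x nPx; apply: PN.
Qed.

Lemma koopman_class T (f g : L2fun) : {ae mu, forall x, g x = f (T x)} ->
  koopman T (L2class f) = L2class g.
Proof.
move=> gT; apply/L2classP; apply: filterS2 gT
  (ae_comp (autom_measurable T) (autom_preserving T) (L2repr_ae f)).
by move=> x gx /(_ Logic.I) fx _; rewrite gx -fx.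
Qed.

Lemma koopmanE T (f : L2) : koopman T f = L2class (MkL2fun (koopman_subproof T f)).
Proof. by []. Qed.

Lemma koopmanD T f g : koopman T (f + g) = koopman T f + koopman T g.
Proof.
elim/L2class_ind: f => f; elim/L2class_ind: g => g.
rewrite -L2classD [koopman T (L2class f)]koopmanE [koopman T (L2class g)]koopmanE.
rewrite -L2classD; apply: koopman_class.
apply: filterS2 (ae_comp (autom_measurable T) (autom_preserving T) (L2repr_ae f))
  (ae_comp (autom_measurable T) (autom_preserving T) (L2repr_ae g)).
by move=> x /(_ Logic.I) fx /(_ Logic.I) gx; rewrite -[LHS]/(_ + _) /= fx gx.
Qed.

Lemma koopmanZ T a f : koopman T (a *: f) = a *: koopman T f.
Proof.
elim/L2class_ind: f => f; rewrite -L2classZ [koopman T (L2class f)]koopmanE.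
rewrite -L2classZ; apply: koopman_class.
apply: filterS (ae_comp (autom_measurable T) (autom_preserving T) (L2repr_ae f)).
by move=> x /(_ Logic.I) fx; rewrite -[LHS]/(_ * _) /= fx.
Qed.

Lemma koopmanB T f g : koopman T (f - g) = koopman T f - koopman T g.
Proof. by rewrite koopmanD -scaleN1r koopmanZ scaleN1r. Qed.

Lemma Rintegral_comp T (u : X -> R) : mu.-integrable setT (EFin \o u) ->
  \int[mu]_x u (T x) = \int[mu]_x u x.
Proof.
move=> iu; have mT := autom_measurable T; rewrite /Rintegral; congr fine.
have mu_ := measurable_int _ iu.
have E : (\int[mu]_x `|(u (T x))%:E| = \int[mu]_x `|(u x)%:E|)%E.
  rewrite -[LHS](@ge0_integral_pushforward _ _ _ _ _ T mT mu setT
    (fun x => `|(u x)%:E|%E))//; last first.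
    exact: measurableT_comp.
  apply: eq_measure_integral => A mA _; exact: (autom_preserving T mA).
have iuT : mu.-integrable setT (EFin \o (u \o T)).
  apply/integrableP; split; first exact: (measurableT_comp mu_).
  by move: iu => /integrableP[_]; rewrite -E.
rewrite -[LHS](@integral_pushforward _ _ _ _ _ T mT mu setT (EFin \o u))//.
apply: eq_measure_integral => A mA _; exact: (autom_preserving T mA).
Qed.

Lemma inner_koopman T f g : inner (koopman T f) (koopman T g) = inner f g.
Proof.
rewrite !koopmanE inner_class /= -[in RHS](L2class_repr f) -[in RHS](L2class_repr g).
rewrite inner_class; congr Complex.
  exact: Rintegral_comp (integrable_ReM (repr f) (repr g)).
exact: Rintegral_comp (integrable_ImM (repr f) (repr g)).
Qed.

Lemma L2norm_koopman T f : L2norm (koopman T f) = L2norm f.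
Proof.
apply/eqP; rewrite -(@eqrXn2 _ 2) ?L2norm_ge0//.
by rewrite !L2normsq_Re inner_koopman.
Qed.

Definition mfun_class (T : X -> X) (mT : measurable_fun setT T) : {mfun_ mu, X >-> X} :=
  (\pi_({mfun_ mu, X >-> X}) (mfun_Sub (mem_set mT)))%qT.

Lemma mfun_classE (T : X -> X) (mT : measurable_fun setT T) :
  mfun_class mT = T %[ae mu].
Proof.
have : repr (mfun_class mT) = mfun_Sub (mem_set mT) %[mod {mfun_ mu, X >-> X}]%qT.
  by rewrite reprK.
by move=> /eqP; rewrite eqmodE => /asboolP.
Qed.

Lemma ae_eq_measure (A B : set X) : measurable A -> measurable B ->
  {ae mu, forall x, A x <-> B x} -> mu A = mu B.
Proof.
move=> mA mB AB; rewrite -(setIT A) -(setIT B) -!integral_indic//.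
apply: ae_eq_integral => //.
- by apply/measurable_EFinP; exact: measurable_indic.
- by apply/measurable_EFinP; exact: measurable_indic.
apply: filterS AB => x AB _; rewrite !indicE; congr (_%:R)%:E.
by congr nat_of_bool; apply/idP/idP => /set_mem /AB /mem_set.
Qed.

Lemma measurable_preim (T : X -> X) A : measurable_fun setT T -> measurable A ->
  measurable (T @^-1` A).
Proof. by move=> mT mA; rewrite -[_ @^-1` _]setTI; exact: mT. Qed.

Lemma mp_ae (S T : X -> X) : measurable_fun setT S -> measurable_fun setT T ->
  S = T %[ae mu] -> measure_preserving mu T -> measure_preserving mu S.
Proof.
move=> mS mT ST pT A mA; rewrite -(pT A mA).
apply: ae_eq_measure; [exact: measurable_preim..|].
by apply: filterS ST => x /(_ Logic.I) /= ->.
Qed.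

(** The entry point for concrete maps. The inverse relations pass to the chosen representatives
    because almost everywhere identities survive composition with measure-preserving maps. *)
Lemma mk_autom (S T : X -> X) : measurable_fun setT S -> measurable_fun setT T ->
  measure_preserving mu S -> measure_preserving mu T ->
  S \o T = id %[ae mu] -> T \o S = id %[ae mu] ->
  {U : autom mu | U = T %[ae mu]}.
Proof.
move=> mS mT pS pT ST TS.
have mf (f : {mfun_ mu, X >-> X}) : measurable_fun setT f.
  exact: (@measurable_funPT _ _ _ _ (repr f)).
have aeS := mfun_classE mS; have aeT := mfun_classE mT.
have pS' : measure_preserving mu (mfun_class mS) by exact: mp_ae pS.
have pT' : measure_preserving mu (mfun_class mT) by exact: mp_ae pT.
suff H : mfun_class mT \in @invertible_mp _ _ _ mu by exists (MkAutom H).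
apply/mem_set; split; first exact: mp_ae pT.
exists (mfun_class mS); split; first exact: mp_ae pS.
- apply: filterS3 (ae_comp (mf _) pT' aeS) aeT ST.
  by move=> x /(_ Logic.I) /= -> /(_ Logic.I) ->.
- apply: filterS3 (ae_comp (mf _) pS' aeT) aeS TS.
  by move=> x /(_ Logic.I) /= -> /(_ Logic.I) ->.
Qed.

Lemma autom_inv_ex (T : autom mu) :
  exists S : autom mu, [/\ S \o T = id %[ae mu] & T \o S = id %[ae mu]].
Proof.
have /set_mem[pT [S [pS ST TS]]] := automP T.
have H : S \in @invertible_mp _ _ _ mu by apply/mem_set; split => //; exists T.
by exists (MkAutom H).
Qed.

Definition autom_inv (T : autom mu) : autom mu := sval (cid (autom_inv_ex T)).

Lemma autom_invK (T : autom mu) : autom_inv T \o T = id %[ae mu].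
Proof. by rewrite /autom_inv; case: cid => S []. Qed.

Lemma autom_Kinv (T : autom mu) : T \o autom_inv T = id %[ae mu].
Proof. by rewrite /autom_inv; case: cid => S []. Qed.

(** Koopman operators reverse composition: applying first that of [S], then that of [T], gives
    [f \o S \o T]. *)
Lemma koopman_cancel (S T : autom mu) : S \o T = id %[ae mu] ->
  cancel (koopman S) (koopman T).
Proof.
move=> ST f; rewrite [koopman S f]koopmanE -[RHS]L2class_repr.
by apply: koopman_class; apply: filterS ST => x /(_ Logic.I) /= ->.
Qed.

Lemma koopmanVK T : cancel (koopman (autom_inv T)) (koopman T).
Proof. exact/koopman_cancel/autom_invK. Qed.

Lemma inner_koopmanV T f g : inner (koopman T f) g = inner f (koopman (autom_inv T) g).
Proof. by rewrite -{1}(koopmanVK T g) inner_koopman. Qed.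

(** The default of [xget] is ruled out by exhibiting an adjoint; any other adjoint agrees with it
    because the inner product separates points. *)
Lemma adjoint_koopman T : adjoint (koopman T) = koopman (autom_inv T).
Proof.
rewrite /adjoint; case: xgetP => [B _ /= BE|/(_ (koopman (autom_inv T)))].
  apply/funext => g; apply/eqP; rewrite -subr_eq0; apply/eqP/inner_inj => f.
  by rewrite inner_sym innerBr -BE inner_koopmanV subrr rmorph0.
by case=> f g; exact: inner_koopmanV.
Qed.

End Koopman.

Notation lebI R := [the {measure set (unit_itv R) -> \bar R} of @unit_itv_measure R].

(** * Cells of the unit interval *)

Section UnitIntervalGeometry.
Variable R : realType.
Notation I := (unit_itv R).
Notation m := (lebI R).
Notation val := (@unit_itv_val R).
Implicit Types (a b : R) (x : I) (A B : set I).

Lemma unit_itv_val_itv x : 0 <= val x <= 1.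
Proof. by have := set_mem (valP x); rewrite /= in_itv. Qed.

Lemma unit_itv_val_ge0 x : 0 <= val x.
Proof. by have /andP[] := unit_itv_val_itv x. Qed.

Lemma measurable_unit_itv_val : measurable_fun setT val.
Proof. by move=> _ B mB; rewrite setTI; exists B => //; rewrite setTI. Qed.

Lemma measurable_to_unit_itv d (Y : measurableType d) (f : Y -> I) :
  measurable_fun setT (val \o f) -> measurable_fun setT f.
Proof.
by move=> mf _ A [B mB <-]; rewrite !setTI; have := mf measurableT B mB; rewrite setTI.
Qed.

Lemma unit_itv_measure_fin A : measurable A -> m A \is a fin_num.
Proof. by move=> mA; exact: fin_num_measure. Qed.

Lemma unit_itv_measureT : m setT = 1%E.
Proof. exact: (@probability_setT _ _ _ (@unit_itv_measure R)). Qed.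

Definition seg a b : set I := [set x | a <= val x < b].

Lemma measurable_seg a b : measurable (seg a b).
Proof.
have -> : seg a b = val @^-1` `[a, b[ by apply/seteqP; split => x /=; rewrite in_itv.
by rewrite -[_ @^-1` _]setTI; apply: measurable_unit_itv_val.
Qed.

Lemma measure_seg a b : 0 <= a -> a <= b -> b <= 1 -> m (seg a b) = (b - a)%:E.
Proof.
move=> a0 ab b1; rewrite -[LHS]/(@lebesgue_measure R (val @` seg a b)).
have -> : val @` seg a b = `[a, b[%classic.
  rewrite eqEsubset; split=> [_ [x xab <-]|y]; rewrite /= in_itv//= => /andP[ay yb].
  have y01 : y \in `[0, 1]%classic.
    by rewrite inE /= in_itv /= (le_trans a0)// (le_trans (ltW yb)).
  by exists (exist _ y y01) => //; rewrite /seg /= ay yb.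
rewrite lebesgue_measure_itv /= lte_fin; case: ltP => [_|ba]; first by rewrite EFinB.
by rewrite (@le_anti _ _ a b) ?ab ?ba// subrr.
Qed.

Definition ray a : set I := [set x | val x < a].

Lemma rayE a : ray a = seg 0 a.
Proof. by apply/seteqP; split => x /=; rewrite /ray /seg /= unit_itv_val_ge0. Qed.

Lemma measurable_ray a : measurable (ray a).
Proof. by rewrite rayE; exact: measurable_seg. Qed.

Lemma measure_ray a : 0 <= a <= 1 -> m (ray a) = a%:E.
Proof. by move=> /andP[a0 a1]; rewrite rayE measure_seg// subr0. Qed.

Lemma unit_itv_measurableE : @measurable _ I = <<s range ray >>.
Proof.
rewrite eqEsubset; split=> [A [B mB <-]|]; last first.
  apply: smallest_sub; first exact: sigma_algebra_measurable.
  by move=> _ [a _ <-]; exact: measurable_ray.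
pose I' := g_sigma_algebraType (range ray).
have : measurable_fun setT (val : I' -> R).
  apply: (measurability _ (RGenInftyO.measurableE R)) => _ [_ [a ->] <-].
  rewrite setTI; apply: sub_sigma_algebra; by exists a; rewrite // eqEsubset; split => x /=; rewrite in_itv.
by move=> /(_ measurableT B mB).
Qed.

Lemma setI_closed_ray : setI_closed (range ray).
Proof.
move=> _ _ [a _ <-] [b _ <-]; exists (Num.min a b) => //.
apply/seteqP; split => x; rewrite /ray /= lt_min; first by move=> /andP[].
by move=> [-> ->].
Qed.

(** The threshold exceeds 1 because [ray 1] misses the end point. Thus the whole space is itself a
    ray, as uniqueness of measures on a generating class requires. *)
Lemma ray2 : ray 2 = setT.
Proof.
apply/seteqP; split => // x _; have /andP[_ x1] := unit_itv_val_itv x.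
by rewrite /ray /= (le_lt_trans x1)// ltr1n.
Qed.

Lemma ray_clip a : ray a = if a < 0 then set0 else if 1 < a then setT else ray a.
Proof.
case: ltP => [a0|a0].
  apply/seteqP; split => x //=; rewrite /ray /= => xa.
  by have := lt_trans xa a0; rewrite ltNge unit_itv_val_ge0.
case: ltP => // a1; apply/seteqP; split => x // _.
by have /andP[_ x1] := unit_itv_val_itv x; rewrite /ray /= (le_lt_trans x1).
Qed.

Lemma eq_measure_ray (m1 m2 : {measure set I -> \bar R}) :
  (forall a, m1 (ray a) = m2 (ray a)) -> (m1 setT < +oo)%E ->
  forall A, measurable A -> m1 A = m2 A.
Proof.
move=> m12 m1oo A mA.
apply: (measure_unique (range ray) (fun=> setT) unit_itv_measurableE) => //.
- exact: setI_closed_ray.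
- by move=> _; exists 2 => //; exact: ray2.
- by rewrite bigcup_const.
- by move=> _ [a _ <-].
Qed.

(** The pushforward of [m] and [m] itself agree on the rays, which generate the Borel sets and are
    stable under intersection; thresholds outside [0, 1] give trivial sets. *)
Lemma mp_ray (T : I -> I) : measurable_fun setT T ->
  (forall a, 0 <= a <= 1 -> m (T @^-1` ray a) = a%:E) -> measure_preserving m T.
Proof.
move=> mT Ta A mA.
pose m1 := measure_function_pushforward__canonical__measure_function_Measure m mT.
have m1E B : m1 B = m (T @^-1` B) by [].
rewrite -[LHS]/(m1 A); apply: eq_measure_ray => //; last first.
  by rewrite m1E preimage_setT -ge0_fin_numE// unit_itv_measure_fin.
move=> a; rewrite m1E ray_clip; case: ltP => [_|a0].
  by rewrite preimage_set0 !measure0.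
case: ltP => [_|a1]; first by rewrite preimage_setT.
by rewrite Ta ?a0// measure_ray ?a0.
Qed.

(** Multiplying by [K] instead of dividing makes the cells the fibres of [truncn (K x)]. The cells
    with [i < K] cover [0, 1) only; the point 1 is handled as a null set. *)
Definition cell (K i : nat) : set I := [set x | i%:R <= K%:R * val x < i.+1%:R].

Lemma cellE K i : (0 < K)%N -> cell K i = seg (i%:R / K%:R) (i.+1%:R / K%:R).
Proof.
move=> K0; have K0' : 0 < K%:R :> R by rewrite ltr0n.
apply/seteqP; split => x; rewrite /cell /seg /=.
  by rewrite ler_pdivrMr// ltr_pdivlMr// [_ * K%:R]mulrC.
by rewrite ler_pdivrMr// ltr_pdivlMr// [_ * K%:R]mulrC.
Qed.

Lemma measurable_cell K i : measurable (cell K i).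
Proof.
case: K => [|K]; last by rewrite cellE//; exact: measurable_seg.
have [i0|i0] := eqVneq i 0%N.
  rewrite (_ : cell _ _ = setT)//; apply/seteqP; split => // x _.
  by rewrite /cell /= mul0r i0 lexx ltr01.
rewrite (_ : cell _ _ = set0)//; apply/seteqP; split => // x.
by rewrite /cell /= mul0r lern0 (negbTE i0).
Qed.

Lemma measure_cell K i : (i < K)%N -> m (cell K i) = (K%:R^-1)%:E.
Proof.
move=> iK; have K0 := leq_ltn_trans (leq0n _) iK.
have K0' : 0 < K%:R :> R by rewrite ltr0n.
rewrite cellE// measure_seg.
- by rewrite -mulrBl -natrB// subSnn mul1r.
- by rewrite divr_ge0.
- by rewrite ler_pM2r ?invr_gt0// ler_nat.
- by rewrite ler_pdivrMr// mul1r ler_nat.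
Qed.

Lemma cell_truncn K i x : cell K i x <-> Num.truncn (K%:R * val x) = i.
Proof.
by rewrite /cell /=; split=> [/truncn_def|<-]//;
  apply: truncn_itv; rewrite mulr_ge0// unit_itv_val_ge0.
Qed.

Lemma cell_inj K i j x : cell K i x -> cell K j x -> i = j.
Proof. by rewrite !cell_truncn => <-. Qed.

Lemma measureC_unit_itv A : measurable A -> m (~` A) = (1 - m A)%E.
Proof. exact: (@probability_setC _ _ _ (@unit_itv_measure R)). Qed.

Lemma ae_lt1 : {ae m, forall x, val x < 1}.
Proof.
exists (~` ray 1); split => //; first exact/measurableC/measurable_ray.
by rewrite measureC_unit_itv ?measure_ray ?lexx ?ler01 ?subee//; exact: measurable_ray.
Qed.

Lemma cell_lt K i x : (0 < K)%N -> val x < 1 -> cell K i x -> (i < K)%N.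
Proof.
move=> K0 x1 /andP[iK _]; rewrite -(ltr_nat R) (le_lt_trans iK)//.
by rewrite -[ltRHS]mulr1 ltr_pM2l// ltr0n.
Qed.

Lemma cell_cover K x : (0 < K)%N -> val x < 1 -> exists2 i, (i < K)%N & cell K i x.
Proof.
move=> K0 x1; have /cell_truncn Cx := erefl (Num.truncn (K%:R * val x)).
by exists (Num.truncn (K%:R * val x)) => //; exact: cell_lt Cx.
Qed.

Lemma cell_refine K M c x : (0 < M)%N -> cell (K * M) c x -> cell K (c %/ M) x.
Proof.
move=> M0; have M0' : 0 < M%:R :> R by rewrite ltr0n.
rewrite /cell /= natrM => /andP[cx xc]; apply/andP; split.
  rewrite -(ler_pM2r M0') -natrM; apply: le_trans (_ : c%:R <= _).
    by rewrite ler_nat leq_trunc_div.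
  by rewrite (le_trans cx)// mulrAC.
rewrite -(ltr_pM2r M0') -natrM mulrAC; apply: lt_le_trans xc _.
by rewrite ler_nat ltn_ceil.
Qed.

End UnitIntervalGeometry.

Section Indicators.
Variable R : realType.
Notation I := (unit_itv R).
Notation m := (lebI R).
Notation val := (@unit_itv_val R).
Notation L2fun := (L2fun m).
Notation L2 := (L2 m).
Implicit Types (A B : set I) (T : autom m).

Lemma bounded_Lfun2 (u : I -> R) (M : R) : measurable_fun setT u ->
  (forall x, `|u x| <= M) -> u \in Lfun m 2%:E.
Proof.
move=> mu_ uM; apply/andP; split; first by rewrite inE.
have M0 : 0 <= M by apply: le_trans (uM (exist _ 0 (unit_itv_0_subproof R))).
have /andP[_] : cst M \in Lfun m 2%:E by exact: (@Lfun_cst _ _ _ (@unit_itv_measure R)).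
rewrite !inE /= /finite_norm; apply: le_lt_trans.
have mnu : measurable_fun setT (fun x => `|u x|) by exact: measurableT_comp.
have <- : ('N[m]_2%:E [EFin \o (fun x => `|u x|)%R] = 'N[m]_2%:E [EFin \o u])%E.
  by rewrite -[RHS]Lnorm_abse; apply: eq_Lnorm.
by apply: le_Lnorm2 => // x; rewrite normr_ge0 uM.
Qed.

Lemma real_L2fun_subproof (u : I -> R) : u \in Lfun m 2%:E ->
  (fun x => (u x)%:C%C) \in sqint m.
Proof.
move=> Lu; apply/andP; split => //=.
by apply: (@bounded_Lfun2 _ 0) => // x; rewrite normr0.
Qed.

Definition real_L2fun (u : I -> R) (Lu : u \in Lfun m 2%:E) : L2fun :=
  MkL2fun (real_L2fun_subproof Lu).

Lemma inner_real (u v : I -> R) (Lu : u \in Lfun m 2%:E) (Lv : v \in Lfun m 2%:E) :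
  inner (L2class (real_L2fun Lu)) (L2class (real_L2fun Lv)) =
  (\int[m]_x (u x * v x))%:C%C.
Proof.
rewrite inner_class; congr Complex.
  by apply: eq_Rintegral => x _; rewrite ReM_conj /= mul0r addr0.
rewrite /Rintegral integral0_eq// => x _.
by rewrite ImM_conj /= mulr0 mul0r subr0.
Qed.

Lemma mindic_Lfun2 A : measurable A -> (\1_A : I -> R) \in Lfun m 2%:E.
Proof.
move=> mA; apply: (@bounded_Lfun2 _ 1); first exact: measurable_indic.
by move=> x; rewrite indicE ger0_norm//; case: (_ \in _).
Qed.

(* Junk value 0 on non-measurable sets. *)
Definition ind A : L2 :=
  if pselect (measurable A) is left mA then L2class (real_L2fun (mindic_Lfun2 mA))
  else 0.

Lemma indE A (mA : measurable A) : ind A = L2class (real_L2fun (mindic_Lfun2 mA)).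
Proof.
by rewrite /ind; case: pselect => // mA'; congr (L2class (real_L2fun _));
  exact: bool_irrelevance.
Qed.

Definition mr A : R := fine (m A).

Lemma EFin_mr A : measurable A -> (mr A)%:E = m A.
Proof. by move=> mA; rewrite /mr fineK// unit_itv_measure_fin. Qed.

Lemma mr_ge0 A : 0 <= mr A.
Proof. by rewrite /mr fine_ge0// measure_ge0. Qed.

Lemma le_mr A B : measurable A -> measurable B -> A `<=` B -> mr A <= mr B.
Proof.
move=> mA mB AB; rewrite -lee_fin !EFin_mr//.
by apply: le_measure => //; rewrite inE.
Qed.

Lemma mrT : mr setT = 1.
Proof. by rewrite /mr unit_itv_measureT. Qed.

Lemma inner_ind A B : measurable A -> measurable B ->
  inner (ind A) (ind B) = (mr (A `&` B))%:C%C.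
Proof.
move=> mA mB; rewrite !indE inner_real; congr (_%:C%C).
rewrite -[RHS]/(fine (m (A `&` B))) /Rintegral; congr fine.
rewrite -[in RHS](setIT (A `&` B)) -integral_indic//; last exact: measurableI.
by apply: eq_integral => x _; rewrite indicI.
Qed.

Lemma L2norm_ind A : measurable A -> L2norm (ind A) ^+ 2 = mr A.
Proof. by move=> mA; rewrite L2normsq_Re inner_ind// setIid. Qed.

Lemma ind_ae A B : measurable A -> measurable B -> {ae m, forall x, A x <-> B x} ->
  ind A = ind B.
Proof.
move=> mA mB AB; rewrite !indE; apply/L2classP.
apply: filterS AB => x AB _ /=; congr (_%:C%C); rewrite !indicE; congr (_%:R).
by congr nat_of_bool; apply/idP/idP => /set_mem /AB /mem_set.
Qed.

Lemma indU A B : measurable A -> measurable B -> A `&` B = set0 ->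
  ind (A `|` B) = ind A + ind B.
Proof.
move=> mA mB AB; rewrite !indE; first exact: measurableU.
move=> mAB; rewrite -L2classD; congr L2class; apply: val_inj; apply/funext => x.
rewrite -[RHS]/((\1_A x)%:C%C + (\1_B x)%:C%C) /= -rmorphD /=; congr (_%:C%C).
rewrite !indicE in_setU; case: (boolP (x \in A)) => xA /=; last by rewrite add0r.
rewrite memNset ?addr0// => xB.
have : (A `&` B) x by split => //; exact: set_mem.
by rewrite AB.
Qed.

Lemma ind0 : ind set0 = 0.
Proof.
by apply: L2norm_eq0; apply/eqP; rewrite -sqrf_eq0 L2norm_ind// /mr measure0.
Qed.

Lemma ind_bigsetU (F : nat -> set I) n : (forall i, measurable (F i)) ->
  trivIset setT F -> ind (\big[setU/set0]_(i < n) F i) = \sum_(i < n) ind (F i).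
Proof.
move=> mF tF; elim: n => [|n IH]; first by rewrite !big_ord0 ind0.
rewrite !big_ord_recr /= indU ?IH//; first exact: bigsetU_measurable.
rewrite big_distrl /=; apply: big1 => i _.
by move/trivIsetP: tF; apply => //; rewrite neq_ltn ltn_ord.
Qed.

Lemma indC A : measurable A -> ind (~` A) = ind setT - ind A.
Proof.
move=> mA; rewrite -(setvU A) indU ?setICl//; last exact: measurableC.
by rewrite addrK.
Qed.

Lemma koopman_ind T A : measurable A -> koopman T (ind A) = ind (T @^-1` A).
Proof.
move=> mA; have mTA := measurable_preim (autom_measurable T) mA.
by rewrite (indE mA) (indE mTA); apply: koopman_class; exact: aeW.
Qed.

Lemma koopman_ind_ae T (f : I -> I) A : measurable_fun setT f -> T = f %[ae m] ->
  measurable A -> koopman T (ind A) = ind (f @^-1` A).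
Proof.
move=> mf Tf mA; rewrite koopman_ind//; apply: ind_ae.
- exact: measurable_preim (autom_measurable T) mA.
- exact: measurable_preim.
- by apply: filterS Tf => x /(_ Logic.I) /= ->.
Qed.

End Indicators.

(** * Density of dyadic step functions in the Hilbert space *)

Section Density.
Import HBNNSimple.
Variable R : realType.
Notation I := (unit_itv R).
Notation m := (lebI R).
Notation L2fun := (L2fun m).
Notation L2 := (L2 m).
Variable P : L2 -> Prop.
Hypothesis Pcell : forall r i, (i < 2 ^ r)%N -> P (ind (@cell R (2 ^ r) i)).
Hypothesis PD : forall f g, P f -> P g -> P (f + g).
Hypothesis PZ : forall a f, P f -> P (a *: f).
Hypothesis Plim : forall f,
  (forall e, 0 < e -> exists2 g, P g & L2norm (f - g) < e) -> P f.

Let P0 : P 0.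
Proof. by rewrite -(scale0r (ind (@cell R (2 ^ 0) 0))); exact/PZ/Pcell. Qed.

Let PB f g : P f -> P g -> P (f - g).
Proof. by move=> Pf Pg; apply: PD => //; rewrite -scaleN1r; exact: PZ. Qed.

Let Psum J (r : seq J) (F : J -> L2) : (forall j, P (F j)) -> P (\sum_(j <- r) F j).
Proof. by move=> PF; elim/big_ind : _. Qed.

Let Plim2 f :
  (forall e, 0 < e -> exists2 g, P g & L2norm (f - g) ^+ 2 < e) -> P f.
Proof.
move=> H; apply: Plim => e e0; have [g Pg fg] := H _ (exprn_gt0 2 e0).
by exists g => //; rewrite -(@ltr_pXn2r _ 2)// ?nnegrE ?L2norm_ge0// ltW.
Qed.

Let Pcvg f (g : nat -> L2) : (forall n, P (g n)) ->
  (L2norm (f - g n) ^+ 2 @[n --> \oo] --> (0 : R)) -> P f.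
Proof.
move=> Pg /cvgrPdist_lt fg; apply: Plim2 => e /fg[n _ /(_ n (leqnn n))].
by rewrite sub0r normrN ger0_norm ?sqr_ge0//; exists (g n).
Qed.

Let P_dyadic_ray r k : (k <= 2 ^ r)%N -> P (ind (ray (k%:R / (2 ^ r)%:R : R))).
Proof.
elim: k => [_|k IH kr].
  rewrite mul0r rayE (_ : seg _ _ = set0) ?ind0//.
  by apply/seteqP; split => x //= /andP[/le_lt_trans H /H]; rewrite ltxx.
have r0 : (0 < 2 ^ r)%N by rewrite expn_gt0.
have -> : ray (k.+1%:R / (2 ^ r)%:R : R) = ray (k%:R / (2 ^ r)%:R) `|` @cell R (2 ^ r) k.
  rewrite cellE//; apply/seteqP; split => x /=; rewrite /ray /seg /=.
    by move=> xk; case: (ltP (unit_itv_val x) (k%:R / (2 ^ r)%:R)) => kx; [left|right].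
  case=> [xk|/andP[]//]; apply: lt_trans xk _.
  by rewrite ltr_pM2r ?ltr_nat// invr_gt0 ltr0n.
rewrite indU; [|exact: measurable_ray|exact: measurable_cell|].
  by apply: PD; [apply: IH; exact: ltnW|exact: Pcell].
rewrite cellE//; apply/seteqP; split => x //=; rewrite /ray /seg /=.
by case=> xk /andP[/(lt_le_trans xk)]; rewrite ltxx.
Qed.

Let P_setT : P (ind setT).
Proof.
rewrite (@ind_ae _ setT (@cell R (2 ^ 0) 0))//; [exact: Pcell|exact: measurable_cell|].
apply: filterS (@ae_lt1 R) => x x1; split => // _.
by rewrite /cell /= mul1r unit_itv_val_ge0.
Qed.

(** Rounding [a] down to a multiple of [2^-r] leaves a segment whose length, below [2^-r], is its
    squared norm; so [2^-r < e] suffices for [Plim2]. *)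
Let P_ray a : P (ind (ray a)).
Proof.
rewrite ray_clip; case: ltP => [_|a0]; first by rewrite ind0.
case: ltP => [_|a1]; first exact: P_setT.
apply: Plim2 => e e0.
have [r re] : exists r, (2 ^ r)%:R^-1 < e.
  have [r re] : exists r : nat, e^-1 < r%:R.
    by exists (Num.truncn e^-1).+1; exact: truncnS_gt.
  exists r; rewrite invf_plt ?posrE ?ltr0n ?expn_gt0// (lt_trans re)// ltr_nat.
  exact: ltn_expl.
have r0 : 0 < (2 ^ r)%:R :> R by rewrite ltr0n expn_gt0.
set k := Num.truncn ((2 ^ r)%:R * a).
have /andP[ka ak] : k%:R <= (2 ^ r)%:R * a < k.+1%:R.
  by apply: truncn_itv; rewrite mulr_ge0// ltW.
have kr : (k <= 2 ^ r)%N.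
  by rewrite -(ler_nat R) (le_trans ka)// -[leRHS]mulr1 ler_pM2l.
have ba : k%:R / (2 ^ r)%:R <= a by rewrite ler_pdivrMr// mulrC.
exists (ind (ray (k%:R / (2 ^ r)%:R : R))); first exact: P_dyadic_ray.
have -> : ray a = ray (k%:R / (2 ^ r)%:R) `|` seg (k%:R / (2 ^ r)%:R) a.
  apply/seteqP; split => x /=; rewrite /ray /seg /=.
    by move=> xk; case: (ltP (unit_itv_val x) (k%:R / (2 ^ r)%:R)) => kx; [left|right].
  by case=> [xk|/andP[]//]; apply: lt_le_trans xk _.
rewrite indU; [|exact: measurable_ray|exact: measurable_seg|]; last first.
  apply/seteqP; split => x //=; rewrite /ray /seg /=.
  by case=> xk /andP[/(lt_le_trans xk)]; rewrite ltxx.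
rewrite addrAC subrr add0r L2norm_ind; last exact: measurable_seg.
rewrite /mr measure_seg ?divr_ge0//=.
apply: lt_trans re; have : a < k.+1%:R / (2 ^ r)%:R by rewrite ltr_pdivlMr// mulrC.
by rewrite -addn1 natrD mulrDl mul1r ltrBlDl.
Qed.

(** For a disjoint union the squared distance to the partial unions is the missing measure, which
    tends to 0 by continuity from below. *)
Let P_dynkin : dynkin [set A | measurable A /\ P (ind A)].
Proof.
split; [by split|move=> A [mA PA]; split; [exact: measurableC|]|].
  by rewrite indC//; exact: PB.
move=> F tF HF; have mF n : measurable (F n) by case: (HF n).
have PF n : P (ind (F n)) by case: (HF n).
have mUF : measurable (\bigcup_k F k) by exact: bigcup_measurable.
split => //; pose G n := \big[setU/set0]_(i < n) F i.
have mG n : measurable (G n) by exact: bigsetU_measurable.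
apply: (@Pcvg _ (fun n => ind (G n))) => [n|].
  by rewrite ind_bigsetU//; exact: Psum.
have GU n : G n `<=` \bigcup_k F k by exact: bigsetU_bigcup.
have E n : L2norm (ind (\bigcup_k F k) - ind (G n)) ^+ 2 =
    mr (\bigcup_k F k) - mr (G n).
  rewrite L2normBsq !L2norm_ind// inner_ind// (setIidr (GU n)) /=.
  by ring.
under eq_fun do rewrite E.
have : mr (G n) @[n --> \oo] --> mr (\bigcup_k F k).
  apply: fine_cvg; rewrite EFin_mr//.
  have -> : \bigcup_k F k = \bigcup_k G k.
    apply/seteqP; split=> x [k _ kx]; last exact: GU kx.
    by exists k.+1 => //; rewrite /G -bigcup_mkord; exists k => /=.
  apply: nondecreasing_cvg_mu => //; first exact: bigcup_measurable.
  by move=> a b ab; apply/subsetPset; exact: subset_bigsetU.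
by move=> /(cvgB (cvg_cst (mr (\bigcup_k F k)))); rewrite subrr.
Qed.

Let P_ind A : measurable A -> P (ind A).
Proof.
rewrite unit_itv_measurableE => mA.
have /lambda_system_subset : lambda_system setT [set A | measurable A /\ P (ind A)].
  exact/dynkin_lambda_system/P_dynkin.
move=> /(_ _ (@setI_closed_ray R)) H; apply: (proj2 (H _ _ A mA)) => //.
by move=> _ [a _ <-]; split; [exact: measurable_ray|exact: P_ray].
Qed.

Let P_nonneg (u : I -> R) (Lu : u \in Lfun m 2%:E) : (forall x, 0 <= u x) ->
  P (L2class (real_L2fun Lu)).
Proof.
move=> u0; have mu_ := Lfun_measurable Lu.
have mEu : measurable_fun setT (EFin \o u) by exact/measurable_EFinP.
pose s := nnsfun_approx measurableT mEu.
have sE n x : s n x <= u x.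
  by have := @le_approx _ _ _ setT (EFin \o u) n x (fun x _ => u0 x) Logic.I; rewrite -nnsfun_approxE lee_fin.
pose c n i : R := (fset_set (range (s n)))`_i.
pose A n i : set I := s n @^-1` [set c n i].
have mA n i : measurable (A n i) by rewrite /A -[_ @^-1` _]setTI; exact: (measurable_funPT (s n)).
pose F n : L2fun := \sum_(i < #|` fset_set (range (s n))|)
  (c n i)%:C%C *: real_L2fun (mindic_Lfun2 (mA n i)).
have FE n x : F n x = (s n x)%:C%C.
  rewrite fimfunEord rmorph_sum /= /F.
  have -> : (\sum_(i < #|` fset_set (range (s n))|)
      (c n i)%:C%C *: real_L2fun (mindic_Lfun2 (mA n i)) : L2fun) x =
      \sum_(i < #|` fset_set (range (s n))|)
      ((c n i)%:C%C *: real_L2fun (mindic_Lfun2 (mA n i)) : L2fun) x.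
    by apply: (big_morph (fun f : L2fun => f x)).
  by apply: eq_bigr => i _; rewrite rmorphM.
apply: (@Pcvg _ (fun n => L2class (F n))) => [n|].
  rewrite /F; elim/big_rec : _ => [|i f _ Pf]; first by rewrite -(scale0r (0 : L2fun)) L2classZ scale0r.
  by rewrite L2classD L2classZ -indE; apply: PD => //; exact/PZ/P_ind.
have E n : L2norm (L2class (real_L2fun Lu) - L2class (F n)) ^+ 2 =
    fine (\int[m]_x ((u x - s n x) ^+ 2)%:E)%E.
  pose G : L2fun := real_L2fun Lu + (-1) *: F n.
  have GE x : G x = (u x - s n x)%:C%C.
    by rewrite -[LHS]/((u x)%:C%C + (-1) * F n x) FE mulN1r -rmorphB.
  have -> : L2class (real_L2fun Lu) - L2class (F n) = L2class G.
    by rewrite L2classD L2classZ scaleN1r.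
  clearbody G; rewrite L2normsq_Re inner_class /= /Rintegral; congr fine.
  apply: eq_integral => x _; rewrite GE.
  by rewrite ReM_conj /= mul0r addr0.
under eq_fun do rewrite E.
have iu2 := Lfun2_integrable_sqr Lu.
have mus n : measurable_fun setT (fun x => ((u x - s n x) ^+ 2)%:E).
  by apply/measurable_EFinP; apply: measurable_funX; exact: measurable_funB.
have cvg0 x : ((u x - s n x) ^+ 2)%:E @[n --> \oo] --> (0 : R)%:E.
  apply/fine_cvgP; split => /=; first exact: nearW.
  have : s n x @[n --> \oo] --> u x.
    by have /fine_cvg := cvg_nnsfun_approx measurableT mEu (fun x _ => u0 x) (x := x) Logic.I.
  move=> /(cvgB (cvg_cst (u x))) H; have := cvgM H H.
  by rewrite subrr mulr0; exact.
have dom x n : (`|((u x - s n x) ^+ 2)%:E| <= (u x ^+ 2)%:E)%E.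
  rewrite /= lee_fin ger0_norm ?sqr_ge0//.
  by rewrite lerXn2r ?nnegrE ?subr_ge0// lerBlDr lerDl.
have [_ _] := @dominated_convergence _ _ _ m setT measurableT
  (fun n x => ((u x - s n x) ^+ 2)%:E) (cst 0%E) (fun x => (u x ^+ 2)%:E)
  mus (measurable_cst _) (aeW m (fun x _ => cvg0 x)) iu2 (aeW m (fun x n _ => dom x n)).
by rewrite integral0 => H; exact: (fine_cvg H).
Qed.

(** An induction principle expressing density: dyadic cells give rays, the pi-lambda theorem gives
    Borel sets, simple functions give nonnegative functions by dominated convergence, and linearity
    gives the rest. *)
Lemma L2_ind f : P f.
Proof.
have P_real (u : I -> R) (Lu : u \in Lfun m 2%:E) : P (L2class (real_L2fun Lu)).
  have mu_ := Lfun_measurable Lu.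
  have Labs : (fun x => `|u x|) \in Lfun m 2%:E.
    have := @modulus_Lfun _ _ _ m (real_L2fun Lu).
    by under eq_fun do rewrite normRC.
  have Lpart (s : R) : (fun x => `|u x| + s * u x) \in Lfun m 2%:E.
    have [L0 LD] := Lfun_submod_closed m (lee1n 2 : (1 <= 2%:E :> \bar R)%E).
    rewrite (_ : (fun _ => _) = s *: u + (fun x => `|u x|)); first exact: LD.
    by apply/funext => x; rewrite addrC.
  (* Twice the positive part minus twice the negative part of [u], written with [|u|] so that square
     integrability is immediate. *)
  have -> : L2class (real_L2fun Lu) = (2^-1)%:C%C *:
      (L2class (real_L2fun (Lpart 1)) - L2class (real_L2fun (Lpart (-1)))).
    rewrite -scaleN1r -L2classZ -L2classD -L2classZ.
    apply/L2classP; apply: aeW => x _.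
    transitivity ((2^-1)%:C%C * ((`|u x| + 1 * u x)%:C%C +
      (-1) * (`|u x| + -1 * u x)%:C%C) : R[i]); last by [].
    rewrite /= mulN1r -rmorphB -rmorphM /=; congr (_%:C%C); by field.
  apply: PZ; apply: PB; apply: P_nonneg => x.
    by rewrite mul1r -lerBlDr sub0r -normrN ler_norm.
  by rewrite mulN1r subr_ge0 ler_norm.
elim/L2class_ind: f => f.
have -> : L2class f = L2class (real_L2fun (ReL2 f)) + 'i%C *: L2class (real_L2fun (ImL2 f)).
  rewrite -L2classZ -L2classD; apply/L2classP; apply: aeW => x _.
  rewrite -[RHS]/((complex.Re (f x))%:C%C + 'i%C * (complex.Im (f x))%:C%C).
  exact: complexE.
by apply: PD => //; exact: PZ.
Qed.

End Density.

(** * Convergence tested on dyadic cells *)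

Section WeakConvergence.
Variable R : realType.
Notation I := (unit_itv R).
Notation m := (lebI R).
Notation L2 := (L2 m).

(** Convergence in the complex numbers with a real epsilon, which avoids the partial order on [R[i]]
    in estimates. *)
Definition cvgC (u : nat -> R[i]) (z : R[i]) := forall e : R, 0 < e ->
  exists N, forall n, (N <= n)%N -> Normc.normc (u n - z) < e.

Lemma cvgCP (u : nat -> R[i]) (z : R[i]) :
  cvgC u z <-> ((u : nat -> R[i]^o) @ \oo --> (z : R[i]^o)).
Proof.
split=> [uz|/cvgrPdist_lt uz e e0].
  apply/cvgrPdist_lt => _ /gt0C[e e0 ->]; have [N uN] := uz e e0.
  by exists N => // n /= /uN; rewrite distrC ltCR.
have [|N _ uN] := uz e%:C%C; first by rewrite ltcR.
by exists N => n /uN; rewrite /= distrC ltCR.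
Qed.

Lemma normcN (z : R[i]) : Normc.normc (- z) = Normc.normc z.
Proof. by case: z => a b /=; rewrite !sqrrN. Qed.

Lemma cvgCD (u v : nat -> R[i]) (y z : R[i]) : cvgC u y -> cvgC v z ->
  cvgC (fun n => u n + v n) (y + z).
Proof.
move=> uy vz e e0; have e2 : 0 < e / 2 by rewrite divr_gt0.
have [N1 H1] := uy _ e2; have [N2 H2] := vz _ e2; exists (maxn N1 N2) => n.
rewrite geq_max => /andP[/H1 h1 /H2 h2]; rewrite opprD addrACA.
by rewrite (le_lt_trans (le_normcD _ _))// (splitr e) ltrD.
Qed.

Lemma cvgCZ (a : R[i]) (u : nat -> R[i]) (z : R[i]) : cvgC u z ->
  cvgC (fun n => a * u n) (a * z).
Proof.
move=> uz e e0; have a0 : 0 < Normc.normc a + 1.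
  by rewrite ltr_pwDr// (le_trans _ (Re_normc a)).
have [N H] := uz _ (divr_gt0 e0 a0); exists N => n /H h.
rewrite -mulrBr Normc.normcM; move: h; rewrite ltr_pdivlMr// mulrC; apply: le_lt_trans.
by rewrite ler_wpM2r ?(le_trans _ (Re_normc _))// lerDl.
Qed.

Lemma cvgC_conj (u : nat -> R[i]) (z : R[i]) : cvgC u z ->
  cvgC (fun n => conjc (u n)) (conjc z).
Proof.
move=> uz e /uz[N H]; exists N => n /H; rewrite -rmorphB.
by case: (u n - z) => a b /=; rewrite sqrrN.
Qed.

Lemma cvgC_Re (u : nat -> R[i]) (z : R[i]) : cvgC u z ->
  complex.Re (u n) @[n --> \oo] --> complex.Re z.
Proof.
move=> uz; apply/cvgrPdist_lt => e /uz[N H]; exists N => // n /= /H.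
by apply: le_lt_trans; rewrite distrC (le_trans _ (Re_normc _))// raddfB.
Qed.

Lemma cvgC_real (u : nat -> R) (z : R) : (u n @[n --> \oo] --> z) ->
  cvgC (fun n => (u n)%:C%C) z%:C%C.
Proof.
move=> /cvgrPdist_lt uz e /uz[N _ H]; exists N => n /H.
by rewrite -rmorphB normRC distrC.
Qed.

(** A predicate on bare functions, so that it applies alike to [V], to mixtures and to iterates of
    [koopman T]. *)
Definition linop (A : L2 -> L2) :=
  (forall f g, A (f + g) = A f + A g) /\ (forall a f, A (a *: f) = a *: A f).

Lemma linopB A f g : linop A -> A (f - g) = A f - A g.
Proof. by move=> [AD AZ]; rewrite AD -scaleN1r AZ scaleN1r. Qed.

Lemma linop_sum A J (r : seq J) (P : pred J) (F : J -> L2) : linop A ->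
  A (\sum_(j <- r | P j) F j) = \sum_(j <- r | P j) A (F j).
Proof.
move=> [AD AZ]; elim/big_ind2 : _ => //; last by move=> ? ? ? ? <- <-.
by rewrite -(scale0r (0 : L2)) AZ !scale0r.
Qed.

Section WotConvergence.
Variables (A : nat -> L2 -> L2) (V : L2 -> L2) (C : R).
Hypothesis linA : forall n, linop (A n).
Hypothesis linV : linop V.
Hypothesis AC : forall n f, L2norm (A n f) <= C * L2norm f.
Hypothesis VC : forall f, L2norm (V f) <= C * L2norm f.

(** Density is used twice, in the first argument against a fixed cell and then in the second. The
    common bound [C] makes the approximation error uniform in n. *)
Lemma wot_cvg_ind :
  (forall r i r' j, (i < 2 ^ r)%N -> (j < 2 ^ r')%N ->
    cvgC (fun n => inner (A n (ind (@cell R (2 ^ r) i))) (ind (@cell R (2 ^ r') j)))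
      (inner (V (ind (@cell R (2 ^ r) i))) (ind (@cell R (2 ^ r') j)))) ->
  wot_cvg A V.
Proof.
move=> H f g; apply/cvgCP.
have H1 h r j : (j < 2 ^ r)%N ->
    cvgC (fun n => inner (A n h) (ind (@cell R (2 ^ r) j)))
      (inner (V h) (ind (@cell R (2 ^ r) j))).
  move=> jr; set c := ind _; elim/L2_ind: h => [r' i ir|h1 h2 P1 P2|a h P1|h P1 e e0].
  - exact: H.
  - rewrite (proj1 linV) innerDl.
    rewrite (_ : (fun _ => _) = fun n => inner (A n h1) c + inner (A n h2) c); last first.
      by apply/funext => n; rewrite (proj1 (linA n)) innerDl.
    exact: cvgCD.
  - rewrite (proj2 linV) innerZl.
    rewrite (_ : (fun _ => _) = fun n => a * inner (A n h) c); last first.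
      by apply/funext => n; rewrite (proj2 (linA n)) innerZl.
    exact: cvgCZ.
  have C0 : 0 <= `|C| * L2norm c by rewrite mulr_ge0 ?L2norm_ge0.
  set D := `|C| * L2norm c in C0.
  (* Replacing [h] by [k] costs at most [2 * D * L2norm (h - k)] for each of the two operators;
     together this must stay below [e / 2]. The summand 1 keeps the divisor positive when [D] is
     0. *)
  have D0 : 0 < 4 * D + 1 by lra.
  have e2 : 0 < e / 2 by rewrite divr_gt0.
  have [k Pk hk] := P1 _ (divr_gt0 e2 D0).
  have [N HN] := Pk _ e2; exists N => n /HN Hn.
  have small (B : L2 -> L2) : linop B -> (forall f, L2norm (B f) <= C * L2norm f) ->
      Normc.normc (inner (B h) c - inner (B k) c) <= 2 * D * L2norm (h - k).
    move=> linB BC; rewrite -innerBl -linopB//.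
    apply: le_trans (inner_bound _ _) _; rewrite /D -!mulrA ler_pM2l//.
    apply: le_trans (ler_wpM2r (L2norm_ge0 c) (BC _)) _.
    rewrite -mulrA [X in _ * X <= _]mulrC.
    by rewrite ler_wpM2r ?mulr_ge0 ?L2norm_ge0// ler_norm.
  have s1 := small _ (linA n) (AC n); have s2 := small _ linV VC.
  have -> : inner (A n h) c - inner (V h) c = (inner (A n h) c - inner (A n k) c) +
     (inner (A n k) c - inner (V k) c) - (inner (V h) c - inner (V k) c) by ring.
  apply: le_lt_trans (le_normcD _ _) _; rewrite normcN.
  have := le_normcD (inner (A n h) c - inner (A n k) c) (inner (A n k) c - inner (V k) c).
  have : L2norm (h - k) * (4 * D + 1) < e / 2 by rewrite -ltr_pdivlMr.
  have := L2norm_ge0 (h - k).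
  nra.
elim/L2_ind: g => [r j jr|h1 h2 P1 P2|a h P1|h P1 e e0].
- exact: H1.
- rewrite innerDr.
  rewrite (_ : (fun _ => _) = fun n => inner (A n f) h1 + inner (A n f) h2); last first.
      by apply/funext => n; rewrite innerDr.
  exact: cvgCD.
- rewrite innerZr.
  rewrite (_ : (fun _ => _) = fun n => conjc a * inner (A n f) h); last first.
      by apply/funext => n; rewrite innerZr.
  exact: cvgCZ.
have C0 : 0 <= `|C| * L2norm f by rewrite mulr_ge0 ?L2norm_ge0.
set D := `|C| * L2norm f in C0.
have D0 : 0 < 4 * D + 1 by lra.
have e2 : 0 < e / 2 by rewrite divr_gt0.
have [k Pk hk] := P1 _ (divr_gt0 e2 D0).
have [N HN] := Pk _ e2; exists N => n /HN Hn.
have small (B : L2 -> L2) : (forall f, L2norm (B f) <= C * L2norm f) ->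
    Normc.normc (inner (B f) h - inner (B f) k) <= 2 * D * L2norm (h - k).
  move=> BC; rewrite -innerBr.
  apply: le_trans (inner_bound _ _) _; rewrite /D -!mulrA ler_pM2l// mulrA.
  rewrite ler_wpM2r ?L2norm_ge0// (le_trans (BC _))//.
  by rewrite ler_wpM2r ?L2norm_ge0// ler_norm.
have s1 := small _ (AC n); have s2 := small _ VC.
have -> : inner (A n f) h - inner (V f) h = (inner (A n f) h - inner (A n f) k) +
   (inner (A n f) k - inner (V f) k) - (inner (V f) h - inner (V f) k) by ring.
apply: le_lt_trans (le_normcD _ _) _; rewrite normcN.
have := le_normcD (inner (A n f) h - inner (A n f) k) (inner (A n f) k - inner (V f) k).
have : L2norm (h - k) * (4 * D + 1) < e / 2 by rewrite -ltr_pdivlMr.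
have := L2norm_ge0 (h - k).
nra.
Qed.

Lemma ind_cell_refine K M i : (0 < K)%N -> (0 < M)%N ->
  ind (@cell R K i) = \sum_(u < M) ind (@cell R (K * M) (i * M + u)).
Proof.
move=> K0 M0; rewrite -(@ind_bigsetU _ (fun u => @cell R (K * M) (i * M + u))); last 2 first.
- by move=> u; exact: measurable_cell.
- apply/trivIsetP => u v _ _ uv; apply/seteqP; split => // x [xu xv].
  by move: uv; rewrite -(eqn_add2l (i * M)) (cell_inj xu xv) eqxx.
congr ind; rewrite -(bigcup_mkord M (fun u => @cell R (K * M) (i * M + u))); apply/seteqP; split=> [x xi|x [u /= uM xu]].
  have /cell_truncn Cx := erefl (Num.truncn ((K * M)%:R * unit_itv_val x)).
  move: Cx; set c := Num.truncn _ => cx.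
  have E := cell_inj (cell_refine M0 cx) xi.
  exists (c %% M)%N; first exact: ltn_pmod.
  by rewrite /= -E -divn_eq.
by have := cell_refine M0 xu; rewrite divnMDl// divn_small// addn0.
Qed.

Lemma normc_sum J (r : seq J) (F : J -> R[i]) :
  Normc.normc (\sum_(j <- r) F j) <= \sum_(j <- r) Normc.normc (F j).
Proof.
elim/big_ind2 : _ => //; first by rewrite normRC normr0.
by move=> x1 x2 y1 y2 h1 h2; rewrite (le_trans (le_normcD _ _))// lerD.
Qed.

(* A pair of fixed dyadic cells splits into at most 4 ^ l pairs of cells of rank l,
   so entrywise errors 8 ^ - l add up to at most 2 ^ - l. *)
Lemma wot_cvg_cells (rk : nat -> nat) : (forall n, (n <= rk n)%N) ->
  (forall n c d, (c < 2 ^ rk n)%N -> (d < 2 ^ rk n)%N ->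
    Normc.normc (inner (A n (ind (@cell R (2 ^ rk n) c))) (ind (@cell R (2 ^ rk n) d)) -
      inner (V (ind (@cell R (2 ^ rk n) c))) (ind (@cell R (2 ^ rk n) d))) <=
    (8 ^+ rk n)^-1) ->
  wot_cvg A V.
Proof.
move=> rk_ge H; apply: wot_cvg_ind => r i r' j ir jr e e0.
have [N Ne] : exists N : nat, e^-1 < N%:R.
  by exists (Num.truncn e^-1).+1; exact: truncnS_gt.
exists (maxn N (maxn r r')) => n; rewrite !geq_max => /and3P[Nn0 rn0 rn0'].
have Hn := H n; have Nn := leq_trans Nn0 (rk_ge n).
have rn := leq_trans rn0 (rk_ge n); have rn' := leq_trans rn0' (rk_ge n).
move: {Nn0 rn0 rn0'} (rk n) Nn rn rn' Hn => l Nn rn rn' Hn.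
have refine s k : (s <= l)%N -> ind (@cell R (2 ^ s) k) =
    \sum_(u < 2 ^ (l - s)) ind (@cell R (2 ^ l) (k * 2 ^ (l - s) + u)).
  move=> sn; rewrite (@ind_cell_refine _ (2 ^ (l - s))) ?expn_gt0//.
  by rewrite -expnD subnKC.
have bnd s k u : (s <= l)%N -> (k < 2 ^ s)%N -> (u < 2 ^ (l - s))%N ->
    (k * 2 ^ (l - s) + u < 2 ^ l)%N.
  move=> sn ks us; rewrite -[X in (_ < 2 ^ X)%N](subnKC sn) expnD.
  apply: leq_trans (_ : k.+1 * 2 ^ (l - s) <= _)%N; last by rewrite leq_mul2r ks orbT.
  by rewrite mulSn addnC ltn_add2r.
rewrite (refine r) // (refine r')// linop_sum// linop_sum//.
rewrite inner_suml inner_suml -sumrB.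
apply: le_lt_trans (_ : 2 ^+ (l - r) * (2 ^+ (l - r') * (8 ^+ l)^-1) < e).
  apply: le_trans (normc_sum _ _) _.
  rewrite -[leRHS](_ : \sum_(u < 2 ^ (l - r)) (2 ^+ (l - r') * (8 ^+ l)^-1) = _); last first.
    by rewrite sumr_const card_ord -[2 ^+ (l - r)]natrX mulr_natl.
  apply: ler_sum => u _; rewrite !inner_sumr -sumrB.
  apply: le_trans (normc_sum _ _) _.
  rewrite -[leRHS](_ : \sum_(v < 2 ^ (l - r')) ((8 ^+ l)^-1) = _); last first.
    by rewrite sumr_const card_ord -[2 ^+ (l - r')]natrX mulr_natl.
  by apply: ler_sum => v _; apply: Hn; apply: bnd.
have p2 s : 2 ^+ (l - s) <= 2 ^+ l :> R by rewrite ler_weXn2l ?ler1n// leq_subr.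
apply: le_lt_trans (_ : (2 ^+ l)^-1 < e).
  have -> : (2 ^+ l)^-1 = 2 ^+ l * (2 ^+ l * (8 ^+ l)^-1) :> R.
    have -> : 8 = 2 ^+ 3 :> R by rewrite -natrX.
    by rewrite -exprM mulnC exprM; field; rewrite expf_neq0.
  rewrite ler_pM ?mulr_ge0 ?invr_ge0 ?exprn_ge0//.
  by rewrite ler_wpM2r// invr_ge0 exprn_ge0.
rewrite invf_plt ?posrE ?exprn_gt0// (lt_le_trans Ne)//.
by rewrite (le_trans (_ : _ <= l%:R)) ?ler_nat// -natrX ler_nat ltnW// ltn_expl.
Qed.

End WotConvergence.

End WeakConvergence.

(** * The topology of the transformations in terms of cells *)

Section AutomTopology.
Variable R : realType.
Notation I := (unit_itv R).
Notation m := (lebI R).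
Notation L2 := (L2 m).
Implicit Types (T S : autom m) (f g h : L2).

Lemma koopman_linop T : linop (koopman T).
Proof. by split=> *; [exact: koopmanD|exact: koopmanZ]. Qed.

Lemma iter_linop (A : L2 -> L2) n : linop A -> linop (iter n A).
Proof.
move=> [AD AZ]; split.
  by elim: n => //= n IH f g; rewrite IH AD.
by elim: n => //= n IH a f; rewrite IH AZ.
Qed.

Lemma L2norm_iter_koopman T n f : L2norm (iter n (koopman T) f) = L2norm f.
Proof. by elim: n => //= n IH; rewrite L2norm_koopman. Qed.

Lemma L2_cvgP (u : nat -> L2) f :
  (forall e : R, 0 < e -> exists N, forall n, (N <= n)%N -> L2norm (u n - f) < e) <->
  (u @ \oo --> f).
Proof.
split=> [uf|/cvgrPdist_lt uf e e0].
  apply/cvgrPdist_lt => _ /gt0C[e e0 ->]; have [N uN] := uf e e0.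
  by exists N => // n /= /uN; rewrite distrC L2_normE ltcR.
have [|N _ uN] := uf e%:C%C; first by rewrite ltcR.
by exists N => n /uN; rewrite /= distrC L2_normE ltcR.
Qed.

(** With equal norms, the squared distance of [A n f] to [V f] is twice the squared norm minus twice
    Re<A n f, V f>, and the weak limit sends this to 0. *)
Lemma wot_strong (A : nat -> L2 -> L2) (V : L2 -> L2) f :
  (forall n, L2norm (A n f) = L2norm f) -> L2norm (V f) = L2norm f ->
  cvgC (fun n => inner (A n f) (V f)) (inner (V f) (V f)) ->
  (A ^~ f) @ \oo --> V f.
Proof.
move=> An Vf H; apply/L2_cvgP => e e0.
have [N HN] := H (e ^+ 2 / 2) (divr_gt0 (exprn_gt0 2 e0) (ltr0Sn R 1)); exists N => n /HN Hn.
rewrite -(@ltr_pXn2r _ 2)// ?nnegrE ?L2norm_ge0 ?ltW//.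
rewrite L2normBsq An Vf.
have := le_lt_trans (Re_normc _) Hn; rewrite raddfB /= inner_norm Vf /=.
by rewrite ltr_norml => /andP[h _]; lra.
Qed.

(** Cell entries give weak convergence, and isometry makes it strong. The inverses are the adjoints,
    so their entries are conjugates of entries already known to converge, and the same upgrade
    applies. *)
Lemma autom_cvg (T_ : nat -> autom m) T :
  (forall r i r' j, (i < 2 ^ r)%N -> (j < 2 ^ r')%N ->
    cvgC (fun n => inner (koopman (T_ n) (ind (@cell R (2 ^ r) i))) (ind (@cell R (2 ^ r') j)))
      (inner (koopman T (ind (@cell R (2 ^ r) i))) (ind (@cell R (2 ^ r') j)))) ->
  T_ @ \oo --> T.
Proof.
move=> H.
have W : wot_cvg (fun n => koopman (T_ n)) (koopman T).
  apply: (@wot_cvg_ind _ _ _ 1) => //.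
  - by move=> n; exact: koopman_linop.
  - exact: koopman_linop.
  - by move=> n f; rewrite L2norm_koopman mul1r.
  - by move=> f; rewrite L2norm_koopman mul1r.
have H1 f : (fun n => koopman (T_ n) f) @ \oo --> koopman T f.
  apply: (@wot_strong (fun n => koopman (T_ n)) (koopman T)).
  - by move=> n; rewrite L2norm_koopman.
  - by rewrite L2norm_koopman.
  - by apply/cvgCP; exact: W.
have H2 f : (fun n => koopman (autom_inv (T_ n)) f) @ \oo --> koopman (autom_inv T) f.
  apply: (@wot_strong (fun n => koopman (autom_inv (T_ n))) (koopman (autom_inv T))).
  - by move=> n; rewrite L2norm_koopman.
  - by rewrite L2norm_koopman.
  - rewrite (_ : (fun _ => _) = fun n =>
        conjc (inner (koopman (T_ n) (koopman (autom_inv T) f)) f)); last first.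
      by apply/funext => n; rewrite inner_koopmanV -inner_sym.
    rewrite [X in cvgC _ X](_ : _ =
        conjc (inner (koopman T (koopman (autom_inv T) f)) f)); last first.
      by rewrite inner_koopmanV -inner_sym.
    by apply/cvgC_conj/cvgCP; exact: W.
have SS : (fun n => strong_star (T_ n)) @ \oo --> strong_star T.
  apply/pointwise_cvgP => f; rewrite /strong_star adjoint_koopman.
  have H2' : (fun n => adjoint (koopman (T_ n)) f) @ \oo --> koopman (autom_inv T) f.
    rewrite (_ : (fun n => _) = fun n => koopman (autom_inv (T_ n)) f); first exact: H2.
    by apply/funext => n; rewrite adjoint_koopman.
  exact: (cvg_pair (H1 f) H2').
move=> B; case=> U [] [] O oO <- OT OB.
have /SS : nbhs (strong_star T) O by exact: open_nbhs_nbhs.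
by move=> [N _ HN]; exists N => // n /HN On; apply: OB.
Qed.

Lemma nbhs_strong_star T (B : set {ptws L2 -> (L2 * L2)%type}) :
  nbhs (strong_star T) B -> nbhs T (@strong_star _ _ _ m @^-1` B).
Proof.
rewrite nbhsE => -[W [oW WT] WB]; exists (@strong_star _ _ _ m @^-1` W).
by split=> // [|S /WB //]; exists W.
Qed.

Lemma continuous_strong_star_at f :
  continuous (fun T : autom m => (koopman T f, koopman (autom_inv T) f)).
Proof.
move=> T A nA.
have nA' : nbhs (strong_star T) [set h | A (h f)].
  have H : nbhs (strong_star T) --> strong_star T by exact: cvg_id.
  have FF : Filter (nbhs (strong_star T)) := nbhs_filter _.
  apply: ((@pointwise_cvgP _ _ _ (strong_star T) FF).1 H f).
  by rewrite /strong_star adjoint_koopman.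
have := nbhs_strong_star nA'; apply: filterS => S /=.
by rewrite /strong_star adjoint_koopman.
Qed.

Lemma continuous_koopman f : continuous (fun T : autom m => koopman T f).
Proof.
move=> T; apply: (@cvg_comp _ _ _ (fun T => (koopman T f, koopman (autom_inv T) f)) fst).
  exact: continuous_strong_star_at.
exact: cvg_fst.
Qed.

Lemma continuous_koopmanV f : continuous (fun T : autom m => koopman (autom_inv T) f).
Proof.
move=> T; apply: (@cvg_comp _ _ _ (fun T => (koopman T f, koopman (autom_inv T) f)) snd).
  exact: continuous_strong_star_at.
exact: cvg_snd.
Qed.

(** One factor is changed at a time; the error inherited from [n] steps does not grow because
    [koopman S] is an isometry. *)
Lemma continuous_iter_koopman n f : continuous (fun T : autom m => iter n (koopman T) f).
Proof.
elim: n => [|n IH] T; first exact: (@cst_continuous (autom m) L2 f T).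
have FT : Filter (nbhs T) := nbhs_filter T.
apply/cvgrPdist_lt => _ /gt0C[e e0 ->].
have e2 : 0 < (e / 2)%:C%C :> R[i] by rewrite ltcR divr_gt0.
have /cvgrPdist_lt /(_ _ e2) H1 := IH T.
have /cvgrPdist_lt /(_ _ e2) H2 := @continuous_koopman (iter n (koopman T) f) T.
apply: filterS2 H1 H2 => S h1 h2.
rewrite (splitr e) rmorphD.
have -> : koopman T (iter n (koopman T) f) - koopman S (iter n (koopman S) f) =
  (koopman T (iter n (koopman T) f) - koopman S (iter n (koopman T) f)) +
  koopman S (iter n (koopman T) f - iter n (koopman S) f).
  by rewrite koopmanB addrA subrK.
rewrite (le_lt_trans (ler_normD _ _))// ltrD//.
by rewrite L2_normE L2norm_koopman -L2_normE.
Qed.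

Lemma continuous_inner_iter n f g :
  continuous (fun T : autom m => inner (iter n (koopman T) f) g : R[i]^o).
Proof.
move=> T; have FT : Filter (nbhs T) := nbhs_filter T.
apply/cvgrPdist_lt => _ /gt0C[e e0 ->].
have G0 : 0 < 2 * L2norm g + 1 by have := L2norm_ge0 g; lra.
have E0 : 0 < (e / (2 * L2norm g + 1))%:C%C :> R[i] by rewrite ltcR divr_gt0.
have /cvgrPdist_lt /(_ _ E0) H1 := @continuous_iter_koopman n f T.
apply: filterS H1 => S; rewrite L2_normE ltcR => h1.
rewrite -innerBl ltCR (le_lt_trans (inner_bound _ _))//.
move: h1; rewrite ltr_pdivlMr//; have := L2norm_ge0 (iter n (koopman T) f - iter n (koopman S) f).
lra.
Qed.

End AutomTopology.

(** * Exchanges of cells *)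

Section IntervalExchange.
Variable R : realType.
Notation I := (unit_itv R).
Notation m := (lebI R).
Notation L2 := (L2 m).
Notation val := (@unit_itv_val R).

Lemma clip_subproof (r : R) : Num.max 0 (Num.min r 1) \in (`[0, 1]%classic : set R).
Proof. by rewrite inE /= in_itv /= le_max lexx /= ge_max ler01 ge_min lexx orbT. Qed.

(** A measurable retraction of the line onto [0, 1]; it lets maps of the interval be given by real
    formulas. *)
Definition clip (r : R) : I := exist _ (Num.max 0 (Num.min r 1)) (clip_subproof r).

Lemma val_clip r : 0 <= r <= 1 -> val (clip r) = r.
Proof.
move=> /andP[r0 r1]; rewrite -[LHS]/(Num.max 0 (Num.min r 1)).
by rewrite (min_idPl r1) (max_idPr r0).
Qed.

Lemma clip_val x : clip (val x) = x.
Proof. by apply: val_inj; exact: (val_clip (unit_itv_val_itv x)). Qed.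

Lemma measurable_clip d (Y : measurableType d) (f : Y -> R) :
  measurable_fun setT f -> measurable_fun setT (fun y => clip (f y)).
Proof.
move=> mf; apply: measurable_to_unit_itv.
rewrite (_ : _ \o _ = fun y => Num.max 0 (Num.min (f y) 1)) //.
by apply: measurable_maxr => //; exact: measurable_minr.
Qed.

Lemma mr_partition K (A : set I) : (0 < K)%N -> measurable A ->
  mr A = \sum_(i < K) mr (A `&` @cell R K i).
Proof.
move=> K0 mA.
have -> : mr A = complex.Re (inner (ind A) (ind (@setT I))).
  by rewrite inner_ind// setIT.
have -> : ind (@setT I) = \sum_(u < K) ind (@cell R K u).
  rewrite (@ind_ae _ setT (@cell R 1 0))//; last 2 first.
  - exact: measurable_cell.
  - apply: filterS (@ae_lt1 R) => x x1; split => // _.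
    by rewrite /cell /= mul1r unit_itv_val_ge0.
  by rewrite (@ind_cell_refine _ 1 K)// mul0n; apply: eq_bigr => u _; rewrite mul1n add0n.
rewrite inner_sumr raddf_sum; apply: eq_bigr => i _.
by rewrite inner_ind//; exact: measurable_cell.
Qed.

Lemma measure_seg_max (a b : R) : 0 <= a -> b <= 1 ->
  m (seg a b) = (Num.max 0 (b - a))%:E.
Proof.
move=> a0 b1; have [ab|ba] := leP a b.
  by rewrite measure_seg// (max_idPr _)// subr_ge0.
rewrite (_ : seg a b = set0) ?measure0 ?(max_idPl _)// ?subr_le0 ?(ltW ba)//.
by apply/seteqP; split => x //= /andP[ax xb]; have := lt_trans (le_lt_trans ax xb) ba; rewrite ltxx.
Qed.

Variable K : nat.
Hypothesis K0 : (0 < K)%N.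

Let K0' : 0 < K%:R :> R. Proof. by rewrite ltr0n. Qed.

Implicit Types (s t : {perm 'I_K}) (x : I).

(** Cell [i] is translated onto cell [s i]. A sum of indicators makes measurability immediate and
    fixes the end point 1, which lies in none of these cells. *)
Definition iet (s : {perm 'I_K}) (x : I) : I :=
  clip (val x + \sum_(i < K) ((s i)%:R - i%:R) / K%:R * \1_(cell K i) x).

Lemma measurable_iet s : measurable_fun setT (iet s).
Proof.
apply: measurable_clip; apply: measurable_funD; first exact: measurable_unit_itv_val.
apply: measurable_sum => i; apply: measurable_funM => //.
by apply: measurable_indic; exact: measurable_cell.
Qed.

Lemma val_iet s (i : 'I_K) x : cell K i x ->
  val (iet s x) = val x + ((s i)%:R - i%:R) / K%:R.
Proof.
move=> xi; have E : \sum_(j < K) ((s j)%:R - j%:R) / K%:R * \1_(cell K j) x =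
    ((s i)%:R - i%:R) / K%:R :> R.
  rewrite (bigD1 i)//= big1 ?addr0; first by rewrite indicE mem_set// mulr1.
  move=> j ji; rewrite indicE memNset ?mulr0// => xj.
  by move/eqP: ji; apply; apply/val_inj; exact: cell_inj xj xi.
rewrite /iet E val_clip//.
move: xi; rewrite cellE// => /andP[ix xi].
have -> : val x + ((s i)%:R - i%:R) / K%:R = (val x - i%:R / K%:R) + (s i)%:R / K%:R.
  by rewrite mulrBl; ring.
rewrite addr_ge0 ?subr_ge0 ?divr_ge0//=.
apply: le_trans (_ : K%:R^-1 + (s i)%:R / K%:R <= _).
  by rewrite lerD2r lerBlDr -[X in X + _]mul1r -mulrDl nat1r ltW.
by rewrite -[X in X + _]mul1r -mulrDl nat1r ler_pdivrMr// mul1r ler_nat.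
Qed.

Lemma iet_cell s (i : 'I_K) x : cell K i x -> cell K (s i) (iet s x).
Proof.
move=> xi; rewrite /cell /= (val_iet s xi); move: xi; rewrite /cell /=.
rewrite mulrDr [K%:R * (_ / _)]mulrCA mulfV ?gt_eqF// mulr1.
by rewrite -!natr1; lra.
Qed.

Lemma iet_1 s x : ~ (val x < 1) -> iet s x = x.
Proof.
move=> /negP; rewrite -leNgt => x1.
rewrite /iet big1 ?addr0 ?clip_val// => i _.
rewrite indicE memNset ?mulr0// => /andP[_]; apply/negP; rewrite -leNgt.
apply: le_trans (_ : K%:R <= _); first by rewrite ler_nat.
by rewrite -[leLHS]mulr1 ler_pM2l.
Qed.

Lemma iet_comp s t x : iet s (iet t x) = iet (t * s)%g x.
Proof.
have [x1|x1] := pselect (val x < 1); last by rewrite !iet_1.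
have [i iK xi] := cell_cover K0 x1; pose o := Ordinal iK.
have xo : cell K o x by [].
apply: val_inj; rewrite -[LHS]/(val (iet s (iet t x))) -[RHS]/(val (iet _ x)).
rewrite (val_iet _ (iet_cell t xo)) (val_iet t xo) (val_iet _ xo) permM.
by rewrite -addrA -mulrDl [_ - o%:R + _]addrC subrKA.
Qed.

Lemma iet_id x : iet 1%g x = x.
Proof.
by rewrite /iet big1 ?addr0 ?clip_val// => i _; rewrite perm1 subrr mul0r mul0r.
Qed.

Lemma preimage_iet_cell s (i : 'I_K) : iet s @^-1` (cell K i) = cell K ((s^-1)%g i).
Proof.
apply/seteqP; split => x /=.
  move=> sx; have := iet_cell s^-1%g sx.
  by rewrite iet_comp mulgV iet_id.
by move=> /(iet_cell s); rewrite permKV.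
Qed.

(** On cell [i] the preimage of a ray is a translate of the ray cut to cell [s i], hence equally
    long; summing over [i] and reindexing by [s] restores the ray. *)
Lemma iet_mp s : measure_preserving m (iet s).
Proof.
apply: mp_ray; first exact: measurable_iet.
move=> a /andP[a0 a1].
have mTa := measurable_preim (measurable_iet s) (measurable_ray a).
rewrite -EFin_mr// (mr_partition K0)//.
have E (i : 'I_K) : mr (iet s @^-1` ray a `&` @cell R K i) = mr (ray a `&` cell K (s i)).
  have -> : iet s @^-1` ray a `&` @cell R K i =
      seg (i%:R / K%:R) (Num.min (i.+1%:R / K%:R) (a - ((s i)%:R - i%:R) / K%:R)).
    apply/seteqP; split => x /=; rewrite cellE// /seg /= lt_min.
      case=> + /andP[ix xi]; rewrite /ray /= (@val_iet _ i); last first.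
        by rewrite cellE// /seg /= ix.
      by rewrite -ltrBrDr ix xi => ->.
    move=> /and3P[ix xi xa]; split; last by rewrite ix.
    rewrite /ray /= (@val_iet _ i) -?ltrBrDr//.
    by rewrite cellE// /seg /= ix.
  have -> : ray a `&` @cell R K (s i) =
      seg ((s i)%:R / K%:R) (Num.min ((s i).+1%:R / K%:R) a).
    apply/seteqP; split => x /=; rewrite cellE// /seg /ray /= lt_min.
      by case=> -> /andP[-> ->].
    by move=> /and3P[-> -> ->].
  have iK (j : 'I_K) : j.+1%:R / K%:R <= 1 :> R.
    by rewrite ler_pdivrMr// mul1r ler_nat.
  rewrite /mr !measure_seg_max ?divr_ge0// ?ge_min ?iK//=.
  by congr (Num.max 0 _); rewrite !addr_minl; congr Num.min; rewrite -?natr1 ?mulrDl ?mulrBl; ring.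
rewrite (eq_bigr _ (fun i _ => E i)).
rewrite -(reindex_inj (@perm_inj _ s) (P := predT) (F := fun j : 'I_K => mr (ray a `&` cell K j))) /=.
rewrite -mr_partition//; last exact: measurable_ray.
by rewrite EFin_mr ?measure_ray ?a0//; exact: measurable_ray.
Qed.

Lemma iet_autom_sig s : {U : autom m | U = iet s %[ae m]}.
Proof.
apply: (@mk_autom _ _ _ _ (iet s^-1%g)).
- exact: measurable_iet.
- exact: measurable_iet.
- exact: iet_mp.
- exact: iet_mp.
- by apply/aeW => x _ /=; rewrite iet_comp mulgV iet_id.
- by apply/aeW => x _ /=; rewrite iet_comp mulVg iet_id.
Qed.

Definition iet_autom s : autom m := sval (iet_autom_sig s).

Lemma koopman_iet s (i : 'I_K) :
  koopman (iet_autom s) (ind (@cell R K i)) = ind (@cell R K ((s^-1)%g i)).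
Proof.
rewrite /iet_autom; case: iet_autom_sig => U UE /=.
rewrite (koopman_ind_ae (measurable_iet s) UE); last exact: measurable_cell.
by rewrite preimage_iet_cell.
Qed.

Lemma iter_koopman_iet s n (i : 'I_K) :
  iter n (koopman (iet_autom s)) (ind (@cell R K i)) =
  ind (@cell R K (iter n (s^-1)%g i)).
Proof. by elim: n => //= n ->; rewrite koopman_iet. Qed.

Lemma inner_cell (i j : 'I_K) : inner (ind (@cell R K i)) (ind (@cell R K j)) =
  ((i == j)%:R / K%:R)%:C%C.
Proof.
rewrite inner_ind; [|exact: measurable_cell..]; congr (_%:C%C).
have [->|ij] := eqVneq i j; first by rewrite setIid /mr measure_cell//= mul1r.
rewrite (_ : _ `&` _ = set0) ?/mr ?measure0 ?mul0r//.
apply/seteqP; split => x // [xi xj].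
by move/eqP: ij; apply; apply: val_inj; exact: cell_inj xi xj.
Qed.

End IntervalExchange.

Lemma dense_nbhs (T : topologicalType) (D A : set T) (x : T) :
  dense D -> nbhs x A -> exists2 y, D y & nbhs y A.
Proof.
move=> dD; rewrite nbhsE => -[U oU UA]; case: oU => oU Ux.
have [y [Uy Dy]] := dD U (ex_intro _ x Ux) oU.
by exists y => //; rewrite nbhsE; exists U.
Qed.

(** * Operators commuting with all transformations *)

Section ConstantProjection.
Variable R : realType.
Notation I := (unit_itv R).
Notation m := (lebI R).
Notation L2 := (L2 m).
Implicit Types (f g h : L2).

Definition one : L2 := ind setT.

Lemma inner_one : inner one one = 1.
Proof. by rewrite inner_ind// setIT mrT. Qed.

Lemma constant_functionsP h : constant_functions h <-> exists c : R[i], h = c *: one.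
Proof.
pose F c : L2fun m := c *: real_L2fun (mindic_Lfun2 (@measurableT _ I)).
have oneE c : c *: one = L2class (F c) by rewrite L2classZ -indE.
have cE c x : F c x = c.
  by rewrite -[LHS]/(c * (\1_setT x)%:C%C) indicT mulr1.
split=> [[c hc]|[c ->]]; exists c.
  rewrite oneE -[h]L2class_repr; apply/L2classP.
  by apply: filterS hc => x + _ => /(_ Logic.I) ->; rewrite cE.
rewrite oneE; apply: filterS (L2repr_ae (F c)) => x + _ => /(_ Logic.I) ->.
by rewrite cE.
Qed.

Lemma PconstE f : Pconst f = inner f one *: one.
Proof.
rewrite /Pconst /orth_proj; case: xgetP => [g _ /= [/constant_functionsP[c ->] H]|].
  have := H one; rewrite innerBl innerZl inner_one mulr1.
  have C1 : constant_functions one by apply/constant_functionsP; exists 1; rewrite scale1r.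
  by move=> /(_ C1) /eqP; rewrite subr_eq0 => /eqP ->.
move=> /(_ (inner f one *: one)) /= []; split.
  by apply/constant_functionsP; exists (inner f one).
move=> h /constant_functionsP[c ->].
by rewrite innerZr innerBl innerZl inner_one mulr1 subrr mulr0.
Qed.

Definition mixture (lambda : R) f : L2 :=
  lambda%:C%C *: f + (1 - lambda)%:C%C *: Pconst f.

Lemma mixture_linop lambda : linop (mixture lambda).
Proof.
rewrite /mixture; split=> [f g|a f].
  by rewrite !PconstE innerDl scalerDl !scalerDr addrACA.
rewrite !PconstE innerZl scalerDr !scalerA.
by congr (_ *: _ + _ *: _); ring.
Qed.

Lemma L2norm_one : L2norm one = 1.
Proof.
by apply/eqP; rewrite -(@eqrXn2 _ 2) ?L2norm_ge0// L2norm_ind// mrT expr1n.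
Qed.

(** The projection is estimated through [inner_bound], whose factor 2 gives
    [lambda + 2 (1 - lambda)], at most 3. *)
Lemma mixture_bounded lambda : 0 <= lambda <= 1 ->
  forall f, L2norm (mixture lambda f) <= 3 * L2norm f.
Proof.
move=> /andP[l0 l1] f; rewrite /mixture PconstE.
apply: le_trans (L2normD _ _) _; rewrite !L2normZ !normRC L2norm_one mulr1.
rewrite !ger0_norm// ?subr_ge0//.
have := inner_bound f one; rewrite L2norm_one mulr1.
by have := L2norm_ge0 f; nra.
Qed.

Lemma inner_mixture_cell lambda K (i j : 'I_K) : (0 < K)%N ->
  inner (mixture lambda (ind (@cell R K i))) (ind (@cell R K j)) =
  (lambda * (i == j)%:R / K%:R + (1 - lambda) / K%:R ^+ 2)%:C%C.
Proof.
move=> K0; rewrite /mixture PconstE innerDl !innerZl inner_cell//.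
have E (k : 'I_K) : inner (ind (@cell R K k)) one = (K%:R^-1)%:C%C.
  rewrite inner_ind ?setIT//; last exact: measurable_cell.
  by rewrite /mr measure_cell.
have -> : inner one (ind (@cell R K j)) = (K%:R^-1)%:C%C.
  by rewrite inner_sym E; exact: conjc_real.
by rewrite E -!rmorphM -rmorphD /=; congr (_%:C%C); rewrite expr2 invfM; ring.
Qed.

Lemma cvgC_uniq (u : nat -> R[i]) (y z : R[i]) : cvgC u y -> cvgC u z -> y = z.
Proof.
by move=> /cvgCP uy /cvgCP uz; exact: (cvg_unique _ uy uz).
Qed.

(** The constant sequence [V] has entry errors 0 against [W], so it converges weakly to [W]; weak
    limits are unique. *)
Lemma linop_eq_cells (V W : L2 -> L2) (C : R) : linop V -> linop W ->
  (forall f, L2norm (V f) <= C * L2norm f) -> (forall f, L2norm (W f) <= C * L2norm f) ->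
  (forall r (i j : 'I_(2 ^ r)), inner (V (ind (@cell R (2 ^ r) i))) (ind (@cell R (2 ^ r) j)) =
    inner (W (ind (@cell R (2 ^ r) i))) (ind (@cell R (2 ^ r) j))) ->
  forall f, V f = W f.
Proof.
move=> lV lW VC WC VW f.
have H : wot_cvg (fun=> V) W.
  apply: (@wot_cvg_cells _ _ _ C _ _ _ _ id) => // l c d cl dl.
  have := VW l (Ordinal cl) (Ordinal dl) => /= ->.
  by rewrite subrr normRC normr0 invr_ge0 exprn_ge0.
apply/eqP; rewrite -subr_eq0; apply/eqP/inner_inj => g.
have cst : cvgC (fun=> inner (V f) g) (inner (V f) g).
  by move=> e e0; exists 0%N => n _; rewrite subrr normRC normr0.
have /cvgCP HW := H f g.
by rewrite innerBl (cvgC_uniq cst HW) subrr.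
Qed.

(** Entries of powers on cells are thus measures of intersections, and their weak limits inherit
    being real and nonnegative. *)
Lemma iter_koopman_ind (T : autom m) n (A : set I) : measurable A ->
  exists2 B, measurable B & iter n (koopman T) (ind A) = ind B.
Proof.
move=> mA; elim: n => [|n [B mB /= ->]]; first by exists A.
exists (T @^-1` B); first exact: measurable_preim (autom_measurable T) mB.
by rewrite koopman_ind.
Qed.

Lemma iter_koopman_one (T : autom m) n : iter n (koopman T) one = one.
Proof. by elim: n => //= n ->; rewrite /one koopman_ind. Qed.

End ConstantProjection.

(** * Weak limits for a dense set of transformations are mixtures *)

Section Forward.
Variable R : realType.
Notation I := (unit_itv R).
Notation m := (lebI R).
Notation L2 := (L2 m).
Variable V : {linear L2 -> L2}.
Hypothesis V_bounded : bounded_operator V.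
Hypothesis V_dense : dense [set T : autom m | weak_limit_semigroup T V].

Let linV : linop V.
Proof. by split=> *; [exact: raddfD|exact: linearZ]. Qed.

Let V_norm : exists2 C : R, 0 <= C & forall f, L2norm (V f) <= C * L2norm f.
Proof.
have [M HM] := V_bounded; exists `|M| => // f.
have := HM f; rewrite !L2_normE -rmorphM lecR => /le_trans; apply.
by rewrite ler_wpM2r ?L2norm_ge0// ler_norm.
Qed.

Let V_limit : exists T : autom m, exists n : nat -> nat,
  forall f g, cvgC (fun k => inner (iter (n k) (koopman T) f) g) (inner (V f) g).
Proof.
have [|T [_ [n _ H]]] := V_dense _ (@openT (autom m)).
  by exists (iet_autom R (ltn0Sn 0) 1%g).
by exists T, n => f g; apply/cvgCP; exact: H.
Qed.

(** A power of [T] commutes with [T]; moving one factor across the inner product shows that both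
    sides are limits of the same sequence. *)
Let commute_dense (T : autom m) : weak_limit_semigroup T V ->
  forall f, V (koopman T f) = koopman T (V f).
Proof.
move=> [n _ H] f; apply/eqP; rewrite -subr_eq0; apply/eqP/inner_inj => g.
rewrite innerBl; apply/eqP; rewrite subr_eq0; apply/eqP.
have /cvgCP H1 := H (koopman T f) g.
have /cvgCP H2 := H f (koopman (autom_inv T) g).
rewrite inner_koopmanV; apply: cvgC_uniq H1 _.
rewrite (_ : (fun _ => _) =
  fun k => inner (iter (n k) (koopman T) f) (koopman (autom_inv T) g))//.
by apply/funext => k; rewrite -inner_koopmanV -iterS iterSr.
Qed.

(** Choose [S] in the dense set close to [T] on the two vectors [f] and [V f]. [V] multiplies the
    first error by at most [C], which explains the tolerance [e / (C + 1)]. *)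
Let commute (T : autom m) f : V (koopman T f) = koopman T (V f).
Proof.
have [C C0 VC] := V_norm.
apply/eqP; rewrite -subr_eq0; apply/eqP/L2norm_eq0/eqP.
rewrite eq_le L2norm_ge0 andbT; apply/ler_addgt0Pr => e e0; rewrite add0r.
have d0 : 0 < e / (C + 1) by rewrite divr_gt0// ltr_wpDl.
have d0C : 0 < (e / (C + 1))%:C%C :> R[i] by rewrite ltcR.
have FT : Filter (nbhs T) := nbhs_filter T.
have /cvgrPdist_lt /(_ _ d0C) H1 := @continuous_koopman R f T.
have /cvgrPdist_lt /(_ _ d0C) H2 := @continuous_koopman R (V f) T.
have [S VS /nbhs_singleton []] := dense_nbhs V_dense (filterI H1 H2).
rewrite /= !L2_normE !ltcR => h1 h2.
have -> : V (koopman T f) - koopman T (V f) =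
    V (koopman T f - koopman S f) - (koopman T (V f) - koopman S (V f)).
  by rewrite (linopB _ _ linV) (commute_dense VS) opprB addrA subrK.
apply: le_trans (L2normD _ _) _; rewrite L2normN.
apply: le_trans (lerD (VC _) (ltW h2)) _.
have h3 := ler_wpM2l C0 (ltW h1); apply: le_trans (lerD h3 (lexx _)) _.
by rewrite -[X in _ + X]mul1r -mulrDl mulrCA divff ?mulr1// gt_eqF// ltr_wpDl.
Qed.

Let v r i j := inner (V (ind (@cell R (2 ^ r) i))) (ind (@cell R (2 ^ r) j)).

Let v_perm r (s : {perm 'I_(2 ^ r)}) (i j : 'I_(2 ^ r)) : v r (s i) (s j) = v r i j.
Proof.
have r0 : (0 < 2 ^ r)%N by rewrite expn_gt0.
rewrite /v -(inner_koopman (iet_autom R r0 s) (V (ind (cell (2 ^ r) (s i))))) -commute.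
by rewrite !koopman_iet !permK.
Qed.

Let v_diag r (i j : 'I_(2 ^ r)) : v r i i = v r j j.
Proof. by have := v_perm (tperm i j) i i; rewrite tpermL. Qed.

(** Double transitivity of the symmetric group: the first transposition sends [i] to [k], and the
    second corrects the image of [j] without moving [k]. *)
Let v_offdiag r (i j k l : 'I_(2 ^ r)) : i != j -> k != l -> v r i j = v r k l.
Proof.
move=> ij kl; pose j' := tperm i k j.
have j'k : j' != k by rewrite /j' -[X in _ != X](tpermL i k) (inj_eq perm_inj) eq_sym.
have := v_perm (tperm i k * tperm j' l)%g i j.
rewrite !permM tpermL -/j' tpermL tpermD ?[l == k]eq_sym//.
Qed.

Let v_real r i j : exists2 w : R, 0 <= w & v r i j = w%:C%C.
Proof.
have [T [n /(_ (ind (@cell R (2 ^ r) i)) (ind (@cell R (2 ^ r) j)))]] := V_limit.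
set u := (X in cvgC X _); have uE k : 0 <= complex.Re (u k) /\ u k = (complex.Re (u k))%:C%C.
  have [B mB E] := iter_koopman_ind T (n k) (@measurable_cell R (2 ^ r) i).
  by rewrite /u E inner_ind//; [split => //; exact: mr_ge0|exact: measurable_cell].
move=> H; have HR := cvgC_Re H.
have HC := cvgC_real HR; exists (complex.Re (v r i j)).
  by apply: cvgr_to_ge HR _; apply: nearW => k; case: (uE k).
by apply: cvgC_uniq H _; rewrite (_ : u = fun k => (complex.Re (u k))%:C%C)//; apply/funext => k; case: (uE k).
Qed.

Let one_cell : one R = ind (@cell R (2 ^ 0) 0).
Proof.
apply: ind_ae => //; first exact: measurable_cell.
apply: filterS (@ae_lt1 R) => x x1; split => // _.
by rewrite /cell /= mul1r unit_itv_val_ge0.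
Qed.

Let v0 : v 0 0 0 = 1.
Proof.
rewrite /v -one_cell; have [T [n /(_ (one R) (one R))]] := V_limit.
move=> /cvgC_uniq; apply => e e0; exists 0%N => k _.
by rewrite iter_koopman_one inner_one subrr normRC normr0.
Qed.

Let v_refine r i j : v r i j = \sum_(a < 2) \sum_(b < 2) v r.+1 (i * 2 + a) (j * 2 + b).
Proof.
rewrite /v !(@ind_cell_refine R (2 ^ r) 2) ?expn_gt0// -expnSr linop_sum// inner_suml.
by apply: eq_bigr => a _; rewrite inner_sumr.
Qed.

Let v_refine4 r i j : v r i j =
  v r.+1 (i * 2) (j * 2) + v r.+1 (i * 2) (j * 2).+1 +
  (v r.+1 (i * 2).+1 (j * 2) + v r.+1 (i * 2).+1 (j * 2).+1).
Proof.
have sum22 (G : nat -> nat -> R[i]) :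
    \sum_(a < 2) \sum_(b < 2) G a b = G 0 0 + G 0 1%N + (G 1%N 0 + G 1%N 1%N).
  by rewrite !big_ord_recl !big_ord0 !addr0.
rewrite v_refine (sum22 (fun a b => v r.+1 (i * 2 + a) (j * 2 + b))).
by rewrite !addn0 !addn1.
Qed.

Let v2 r : exists x y : R, [/\ 0 <= x, 0 <= y &
  forall i j : 'I_(2 ^ r.+1), v r.+1 i j = (if i == j then x else y)%:C%C].
Proof.
have h0 : (0 < 2 ^ r.+1)%N by rewrite expn_gt0.
have h1 : (1 < 2 ^ r.+1)%N by rewrite -[1%N](expn0 2) ltn_exp2l.
have [x x0 xE] := v_real r.+1 0 0; have [y y0 yE] := v_real r.+1 0 1.
exists x, y; split => // i j; have [->|ij] := eqVneq i j.
  by rewrite -xE; exact: (@v_diag r.+1 j (Ordinal h0)).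
by rewrite -yE; exact: (@v_offdiag r.+1 i j (Ordinal h0) (Ordinal h1)).
Qed.

Lemma weak_limit_mixture : exists lambda : R, 0 <= lambda <= 1 /\
  forall f, V f = mixture lambda f.
Proof.
have [x1 [y1 [x10 y10 xy1]]] := v2 0.
have S1 : 2 * x1 + 2 * y1 = 1.
  have := v0; rewrite v_refine4.
  have := xy1 ord0 ord0; have := xy1 ord0 ord_max; have := xy1 ord_max ord0.
  have := xy1 ord_max ord_max.
  rewrite /= => -> -> -> ->; rewrite -!rmorphD /= => -[]; lra.
(* At rank 1 a mixture has diagonal entry [lambda / 2 + (1 - lambda) / 4] and other entries
   [(1 - lambda) / 4]; this solves for [lambda]. *)
pose lambda := 2 * (x1 - y1).
(* Splitting cells in two gives x_r = 2 x_(r+1) + 2 y_(r+1) and y_r = 4 y_(r+1). *)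
have mE r (x y : R) : (forall i j : 'I_(2 ^ r.+1), v r.+1 i j = (if i == j then x else y)%:C%C) ->
    x = lambda / 2 ^+ r.+1 + (1 - lambda) / (2 ^+ r.+1) ^+ 2 /\
    y = (1 - lambda) / (2 ^+ r.+1) ^+ 2.
  elim: r x y => [|r IH] x y xyE.
    have h0 : (0 < 2 ^ 1)%N by []. have h1 : (1 < 2 ^ 1)%N by [].
    have := xy1 (Ordinal h0) (Ordinal h0); have := xy1 (Ordinal h0) (Ordinal h1).
    rewrite !xyE /= => -[->] [->]; rewrite /lambda expr1; split; lra.
  have [x' [y' [_ _ xyE']]] := v2 r; have [x'E y'E] := IH _ _ xyE'.
  have h0 : (0 < 2 ^ r.+1)%N by rewrite expn_gt0.
  have h1 : (1 < 2 ^ r.+1)%N by rewrite -[1%N](expn0 2) ltn_exp2l.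
  have E1 := xyE' (Ordinal h0) (Ordinal h0); have E2 := xyE' (Ordinal h0) (Ordinal h1).
  move: E1 E2; rewrite [v _ _ _]v_refine4 [X in _ -> X = _ -> _]v_refine4.
  have k0 : (0 < 2 ^ r.+2)%N by rewrite expn_gt0.
  have k4 : (3 < 2 ^ r.+2)%N by rewrite 2!expnS; have := expn_gt0 2 r; lia.
  have k1 : (1 < 2 ^ r.+2)%N by lia.
  have k2 : (2 < 2 ^ r.+2)%N by lia.
  have := xyE (Ordinal k0) (Ordinal k0); have := xyE (Ordinal k0) (Ordinal k1).
  have := xyE (Ordinal k1) (Ordinal k0); have := xyE (Ordinal k1) (Ordinal k1).
  have := xyE (Ordinal k0) (Ordinal k2); have := xyE (Ordinal k0) (Ordinal k4).
  have := xyE (Ordinal k1) (Ordinal k2); have := xyE (Ordinal k1) (Ordinal k4).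
  rewrite /= => -> -> -> -> -> -> -> ->; rewrite -!rmorphD /= => -[] E1 -[] E2.
  have yy : y = y' / 4 by lra.
  have xx : x = x' / 2 - y' / 4 by lra.
  rewrite yy xx x'E y'E [2 ^+ r.+2]exprS.
  by split; field; rewrite expf_neq0.
have l1 : lambda <= 1 by rewrite /lambda; lra.
(* Multiplied by the squared number of cells, the diagonal entry is [lambda * 2^(N+1) + 1 - lambda],
   which for negative [lambda] becomes negative at a large rank. *)
have l0 : 0 <= lambda.
  rewrite leNgt; apply/negP => ln.
  have [N HN] : exists N : nat, (1 - lambda) / - lambda < N%:R.
    by exists (Num.truncn ((1 - lambda) / - lambda)).+1; exact: truncnS_gt.
  have [x [y [x0 _ xyE]]] := v2 N; have [xE _] := mE _ _ _ xyE.
  have p0 : 0 < 2 ^+ N.+1 :> R by rewrite exprn_gt0.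
  have : 0 <= lambda * 2 ^+ N.+1 + (1 - lambda).
    have -> : lambda * 2 ^+ N.+1 + (1 - lambda) = x * (2 ^+ N.+1) ^+ 2.
      by rewrite xE; field; rewrite expf_neq0.
    by rewrite mulr_ge0// sqr_ge0.
  have : N%:R < 2 ^+ N.+1 :> R by rewrite -natrX ltr_nat (ltn_trans (ltnSn N))// ltn_expl.
  move: HN; rewrite ltr_pdivrMr ?oppr_gt0//; nra.
exists lambda; rewrite l0 l1; split => //.
have [C C0 VC] := V_norm.
apply: (@linop_eq_cells _ _ _ (Num.max C 3)) => //.
- exact: mixture_linop.
- move=> f; apply: le_trans (VC f) _; rewrite ler_wpM2r ?L2norm_ge0// le_max lexx//.
- move=> f; apply: le_trans (mixture_bounded _ f) _; first by rewrite l0.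
  by rewrite ler_wpM2r ?L2norm_ge0// le_max lexx orbT.
move=> r i j; rewrite inner_mixture_cell ?expn_gt0// -/(v r i j).
case: r i j => [|r] i j.
  by rewrite !ord1 v0 eqxx expn0 (_ : _ + _ = 1 :> R)//;
    rewrite -[LHS]/(lambda * 1 / 1 + (1 - lambda) / 1 ^+ 2); field.
have [x [y [_ _ xyE]]] := v2 r; have [xE yE] := mE _ _ _ xyE.
rewrite xyE !natrX; congr (_%:C%C).
have -> : (i == j)%:R = (if i == j then 1 else 0) :> R by case: (i == j).
by case: (i == j); rewrite ?xE ?yE; field; rewrite expf_neq0.
Qed.

End Forward.

(** * The Baire property of the group of transformations *)

Section AlmostSureLimits.
Variable R : realType.
Notation I := (unit_itv R).
Notation m := (lebI R).
Notation L2 := (L2 m).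
Notation val := (@unit_itv_val R).

Lemma mr_eventually (A_ : nat -> set I) (A : set I) :
  (forall n, measurable (A_ n)) -> measurable A ->
  {ae m, forall x, \forall n \near \oo, A_ n x <-> A x} ->
  mr (A_ n) @[n --> \oo] --> mr A.
Proof.
move=> mA_ mA H; apply: fine_cvg; rewrite EFin_mr//.
have E B : measurable B -> m B = (\int[m]_x (\1_B x)%:E)%E.
  by move=> mB; rewrite integral_indic// setIT.
rewrite E//; under eq_fun do rewrite E//.
have mi B : measurable B -> measurable_fun setT (EFin \o (\1_B : I -> R)).
  by move=> mB; apply/measurable_EFinP; exact: measurable_indic.
have cv : {ae m, forall x, setT x ->
    (fun n => (\1_(A_ n) x : R)%:E) @ \oo --> (\1_A x : R)%:E}.
  apply: filterS H => x [N _ HN] _; apply/fine_cvgP; split => /=.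
    exact: nearW.
  apply: cvg_near_cst; exists N => // n Nn; rewrite /= !indicE; congr (_%:R).
  by congr nat_of_bool; apply/idP/idP => /set_mem /(HN n Nn) /mem_set.
have i1 : m.-integrable setT (cst 1%E).
  apply/integrableP; split => //; under eq_integral do rewrite /= normr1.
  by rewrite integral_cst// mul1e unit_itv_measureT ltry.
have le1 : {ae m, forall x n, setT x -> (`|(\1_(A_ n) x : R)%:E| <= cst 1 x)%E}.
  by apply/aeW => x n _; rewrite /= lee_fin indicE ger0_norm//; case: (_ \in _).
have [_ _] := @dominated_convergence _ _ _ m setT measurableT
  (fun n x => (\1_(A_ n) x)%:E) (fun x => (\1_A x)%:E) (cst 1%E)
  (fun n => mi _ (mA_ n)) (mi _ mA) cv i1 le1.
by [].
Qed.

(** Fatou for sets: the sets [A_ n] cut with [A] converge almost everywhere to [A], so dominated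
    convergence applies. *)
Lemma le_mr_eventually (A_ : nat -> set I) (A : set I) (c : R) :
  (forall n, measurable (A_ n)) -> measurable A -> (forall n, mr (A_ n) <= c) ->
  {ae m, forall x, A x -> \forall n \near \oo, A_ n x} -> mr A <= c.
Proof.
move=> mA_ mA Ac H.
have mAA n : measurable (A_ n `&` A) by exact: measurableI.
have C : mr (A_ n `&` A) @[n --> \oo] --> mr A.
  apply: mr_eventually => //; apply: filterS H => x HA.
  have [Ax|nAx] := pselect (A x); last by apply: nearW => n; split=> [[]|].
  by apply: filterS (HA Ax) => n Anx; split=> [[]|].
apply: (cvgr_to_le C); apply: nearW => n; apply: le_trans (Ac n).
by apply: le_mr => // x [].
Qed.

Lemma mr_setC (A : set I) : measurable A -> mr (~` A) = 1 - mr A.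
Proof.
move=> mA; apply: EFin_inj; rewrite EFinB !EFin_mr//; last exact: measurableC.
exact: measureC_unit_itv.
Qed.

Lemma mp_mr (T : I -> I) (A : set I) : measure_preserving m T -> measurable A ->
  mr (T @^-1` A) = mr A.
Proof. by move=> pT mA; rewrite /mr pT. Qed.

Lemma mr_ray a : 0 <= a <= 1 -> mr (@ray R a) = a.
Proof. by move=> a01; rewrite /mr measure_ray. Qed.

Definition ae_cvg (T_ : nat -> I -> I) (T : I -> I) :=
  {ae m, forall x, val (T_ n x) @[n --> \oo] --> val (T x)}.

(** A strict inequality for the limit holds eventually along the sequence. Applied to [T x < a] this
    bounds the measure of the preimage from above, and applied to complements from below. *)
Lemma ae_cvg_mp (T_ : nat -> I -> I) (T : I -> I) :
  (forall n, measurable_fun setT (T_ n)) -> measurable_fun setT T ->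
  (forall n, measure_preserving m (T_ n)) -> ae_cvg T_ T -> measure_preserving m T.
Proof.
move=> mT_ mT pT_ H; apply: mp_ray => // a /andP[a0 a1].
have mTr b := measurable_preim mT (measurable_ray b).
have mTr_ n b := measurable_preim (mT_ n) (measurable_ray b).
rewrite -EFin_mr//; congr EFin; apply/eqP; rewrite eq_le; apply/andP; split.
  apply: (@le_mr_eventually (fun n => T_ n @^-1` ray a)) => //.
    by move=> n; rewrite mp_mr ?mr_ray ?a0//; exact: measurable_ray.
  by apply: filterS H => x Hx; rewrite /ray /= => Txa; exact: cvgr_lt Hx _ Txa.
apply/ler_addgt0Pr => e e0.
have [ae|ea] := ltP a e; first by rewrite (le_trans (ltW ae))// lerDr mr_ge0.
(* The complement is the closed condition [a <= T x], which need not hold for [T_ n x]; the strict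
   [b < T x] gives room. *)
pose b := a - e / 2; have e2 : 0 < e / 2 by rewrite divr_gt0.
have b01 : 0 <= b <= 1 by rewrite /b; apply/andP; split; lra.
suff : mr (~` (T @^-1` ray a)) <= 1 - b.
  rewrite mr_setC//; rewrite /b; lra.
apply: (@le_mr_eventually (fun n => ~` (T_ n @^-1` ray b))).
- by move=> n; exact: measurableC.
- exact: measurableC.
- by move=> n; rewrite mr_setC// mp_mr ?mr_ray//; exact: measurable_ray.
apply: filterS H => x Hx; rewrite /ray /= => /negP; rewrite -leNgt => aTx.
have bT : b < val (T x) by rewrite /b; lra.
by apply: filterS (cvgr_gt _ Hx _ bT) => n bn; apply/negP; rewrite -leNgt ltW.
Qed.

Lemma mr_point (a : R) : 0 <= a -> mr [set x : I | val x = a] = 0.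
Proof.
move=> a0.
have E : [set x | val x = a] = val @^-1` [set a] by [].
have ma : measurable [set x : I | val x = a].
  by rewrite E -[_ @^-1` _]setTI; exact: measurable_unit_itv_val.
apply/eqP; rewrite eq_le mr_ge0 andbT; apply/ler_addgt0Pr => e e0; rewrite add0r.
pose b := Num.max 0 (a - e / 2).
have e2 : 0 < e / 2 by rewrite divr_gt0.
have [a1|a1] := ltP 1 a.
  rewrite (_ : [set _ | _] = set0) ?/mr ?measure0 ?ltW//.
  by apply/seteqP; split => x //= xa; have /andP[_] := unit_itv_val_itv x; rewrite xa leNgt a1.
have mb : measurable (seg b (a + e / 2) : set I) by exact: measurable_seg.
apply: le_trans (_ : mr (seg b (a + e / 2) : set I) <= _).
  apply: le_mr => // x /= xa; rewrite /seg /= xa /b ge_max a0 /=.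
  by apply/andP; split; lra.
have [ae|ae] := leP (a + e / 2) 1.
  rewrite /mr measure_seg//=; rewrite /b; first by case: (leP 0 (a - e / 2)); lra.
    by rewrite le_max lexx.
  by rewrite ge_max; apply/andP; split; lra.
apply: le_trans (_ : mr (~` ray b : set I) <= _).
  apply: le_mr => //; first exact/measurableC/measurable_ray.
  by move=> x /andP[bx _] /=; rewrite /ray /=; apply/negP; rewrite -leNgt.
have b01 : 0 <= b <= 1 by rewrite /b le_max lexx ge_max ler01 /=; lra.
rewrite mr_setC ?mr_ray//; last exact: measurable_ray.
by rewrite /b; case: (leP 0 (a - e / 2)); lra.
Qed.

(** Membership can fail to stabilise only where [T x] is an end point, and preservation of measure
    makes this a null set. *)
Lemma ae_cvg_seg (T_ : nat -> I -> I) (T : I -> I) (a b : R) :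
  measurable_fun setT T -> measure_preserving m T -> ae_cvg T_ T ->
  0 <= a -> 0 <= b ->
  {ae m, forall x, \forall n \near \oo, seg a b (T_ n x) <-> seg a b (T x)}.
Proof.
move=> mT pT H a0 b0.
have nul c : 0 <= c -> {ae m, forall x, val (T x) <> c}.
  move=> c0; apply: (ae_comp (P := [set x | val x <> c]) mT pT).
  have mc : measurable [set x : I | val x = c].
    rewrite (_ : [set _ | _] = val @^-1` [set c])// -[_ @^-1` _]setTI.
    exact: measurable_unit_itv_val.
  exists [set x | val x = c]; split => //.
    by rewrite -EFin_mr// mr_point.
  by move=> x /= /contrapT.
apply: filterS3 (nul a a0) (nul b b0) H => x xa xb Hx.
have lt_eq c : val (T x) <> c -> \forall n \near \oo, (val (T_ n x) < c) = (val (T x) < c).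
  move=> /eqP; rewrite neq_lt => /orP[xc|xc].
    by apply: filterS (cvgr_lt _ Hx _ xc) => n ->; rewrite xc.
  by apply: filterS (cvgr_gt _ Hx _ xc) => n nc; rewrite !ltNge ltW//= ltW.
apply: filterS2 (lt_eq a xa) (lt_eq b xb) => n ha hb.
by rewrite /seg /= !leNgt ha hb.
Qed.

Lemma mr_cvg_seg (T_ : nat -> I -> I) (T : I -> I) (a b : R) (B : set I) :
  (forall n, measurable_fun setT (T_ n)) ->
  measurable_fun setT T -> measure_preserving m T -> ae_cvg T_ T ->
  0 <= a -> 0 <= b -> measurable B ->
  mr (T_ n @^-1` seg a b `&` B) @[n --> \oo] --> mr (T @^-1` seg a b `&` B).
Proof.
move=> mT_ mT pT H a0 b0 mB; apply: mr_eventually.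
- by move=> n; apply: measurableI => //; exact/(measurable_preim (mT_ n))/measurable_seg.
- by apply: measurableI => //; exact/(measurable_preim mT)/measurable_seg.
apply: filterS (ae_cvg_seg mT pT H a0 b0) => x; apply: filterS => n E.
by split=> -[/E ? ?].
Qed.

(** Chebyshev bounds the measure of the set where the n-th increment is at least [2^-n] by
    [4^n * 16^-(n+1)], hence by [2^-(n+1)]. By Borel-Cantelli the increments are almost everywhere
    eventually dominated by a geometric series. *)
Lemma ae_limit (T_ : nat -> I -> I) :
  (forall n, measurable_fun setT (T_ n)) ->
  (forall n, \int[m]_x ((val (T_ n.+1 x) - val (T_ n x)) ^+ 2) <= (16^-1) ^+ n.+1) ->
  exists2 T : I -> I, measurable_fun setT T & ae_cvg T_ T.
Proof.
move=> mT_ H.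
have mv n : measurable_fun setT (fun x => val (T_ n x)).
  exact: measurableT_comp (@measurable_unit_itv_val R) (mT_ n).
pose D n x := val (T_ n.+1 x) - val (T_ n x).
have mD n : measurable_fun setT (D n) by exact: measurable_funB.
pose F n : set I := [set x | (2^-1) ^+ n <= `|D n x|].
have mF n : measurable (F n).
  have mN : measurable_fun setT (fun x => `|D n x|) by exact: measurableT_comp.
  rewrite (_ : F n = (fun x => `|D n x|) @^-1` `[(2^-1) ^+ n, +oo[).
    by rewrite -[_ @^-1` _]setTI; exact: mN.
  by apply/seteqP; split => x /=; rewrite in_itv /= andbT.
have FE n : (m (F n) <= (1 / 2 ^+ n.+1)%:E)%E.
  have mD2 : measurable_fun setT (fun x => D n x ^+ 2) by exact: measurable_funX.
  have i2 : m.-integrable setT (EFin \o (fun x => D n x ^+ 2)).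
    have LD : D n \in Lfun m 2%:E.
      apply: (@bounded_Lfun2 _ _ 1) => // x.
      have /andP[? ?] := unit_itv_val_itv (T_ n.+1 x).
      have /andP[? ?] := unit_itv_val_itv (T_ n x).
      by rewrite /D ler_norml; apply/andP; split; lra.
    exact: Lfun2_integrable_sqr LD.
  have e0 : 0 < (4^-1) ^+ n :> R by rewrite exprn_gt0.
  have := @le_integral_abse _ _ _ m setT measurableT (EFin \o (fun x => D n x ^+ 2))
    ((4^-1) ^+ n) (measurable_int _ i2) e0.
  have key x : ((4^-1) ^+ n <= D n x ^+ 2) = ((2^-1) ^+ n <= `|D n x|).
    have -> : 4^-1 = 2^-1 ^+ 2 :> R by rewrite expr2; lra.
    rewrite -(real_normK (num_real (D n x))) exprAC ler_pXn2r ?nnegrE ?exprn_ge0//.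
  have -> : (setT `&` [set x | (((4^-1) ^+ n)%:E <= `|(EFin \o (fun x => (D n x ^+ 2)%R)) x|)%E])
      = F n.
    rewrite setTI; apply/seteqP.
    by split => x; rewrite /F /= lee_fin (ger0_norm (sqr_ge0 (D n x))) key.
  have -> : (\int[m]_x `|(EFin \o (fun x => (D n x ^+ 2)%R)) x|)%E =
      (\int[m]_x (D n x ^+ 2))%:E.
    rewrite /Rintegral fineK; last exact: integrable_fin_num i2.
    by apply: eq_integral => x _; rewrite /= ger0_norm// sqr_ge0.
  rewrite -(EFin_mr (mF n)) -EFinM !lee_fin => h.
  have {}h := le_trans h (H n).
  rewrite -(ler_pM2l e0) (le_trans h)//.
  have -> : (4^-1) ^+ n * (1 / 2 ^+ n.+1) = (4^-1 * 2^-1) ^+ n * 2^-1 :> R.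
    by rewrite exprMn exprS div1r invfM -exprVn; ring.
  have -> : (16^-1) ^+ n.+1 = (16^-1) ^+ n * 16^-1 :> R by rewrite exprSr.
  rewrite ler_pM ?exprn_ge0// ?invr_ge0//; last by rewrite lef_pV2 ?posrE// ler_nat.
  by rewrite lerXn2r ?nnegrE ?mulr_ge0 ?invr_ge0//; lra.
have F0 : m (lim_sup_set F) = 0%E.
  apply: lim_sup_set_cvg0 => //.
  have h : (\sum_(0 <= n < k) (1 / 2 ^+ n.+1)%:E)%E @[k --> \oo] --> (1%E : \bar R).
    apply/fine_cvgP; split.
      apply: nearW => /= n; rewrite sum_fin_num//.
      by apply/allP => /= r /mapP[/= k _] ->.
    have := @cvg_geometric_series_half R 1 0; rewrite {1}/series/= expr0 divr1.
    under [in X in _ -> X]eq_fun do rewrite sumEFin.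
    under eq_fun do under eq_bigr do rewrite addn1 natrX.
    exact.
  apply: (@le_lt_trans _ _ (\sum_(0 <= n <oo) (1 / 2 ^+ n.+1)%:E)%E).
    apply: lee_lim.
    - exact: is_cvg_ereal_nneg_natsum_cond.
    - by apply/cvg_ex; exists 1%E.
    - by apply: nearW => /= n; apply: lee_sum => i _; exact: FE.
  by move/cvg_lim : h => ->//; rewrite ltry.
(* The upper limit is measurable on the whole interval and agrees with the limit wherever that
   exists. *)
exists (fun x => clip (limn_sup (fun n => val (T_ n x)))).
  apply: measurable_clip; apply: measurable_fun_limn_sup => //.
    by move=> x _; exists 1 => _ [n _ <-]; have /andP[] := unit_itv_val_itv (T_ n x).
  by move=> x _; exists 0 => _ [n _ <-]; have /andP[] := unit_itv_val_itv (T_ n x).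
exists (lim_sup_set F); split => //.
  by apply: bigcap_measurable => // k _; exact: bigcup_measurable.
move=> x /= nx; apply: contrapT => nF; apply: nx.
have [N HN] : exists N, forall n, (N <= n)%N -> `|D n x| < (2^-1) ^+ n.
  apply: contrapT => /forallNP h; apply: nF => N _.
  apply: contrapT => h'; apply: (h N) => n Nn; rewrite ltNge; apply/negP => Dn.
  by apply: h'; exists n.
have : cvgn (fun n => val (T_ n x)).
  (* The subtracted term drops by exactly [2^-(n+N)] at each step, more than the sequence can
     decrease; so [u] is nondecreasing and bounded by 1. *)
  pose u n := val (T_ (n + N) x) - 2 * (2^-1) ^+ (n + N).
  have cu : cvgn u.
    apply: nondecreasing_is_cvgn.
      apply/nondecreasing_seqP => n; rewrite /u addSn.
      have := HN (n + N)%N (leq_addl _ _); rewrite /D ltr_norml exprS => /andP[? _].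
      lra.
    exists 1 => _ [n _ <-]; rewrite /u; have /andP[_ ?] := unit_itv_val_itv (T_ (n + N) x).
    have : 0 <= (2^-1) ^+ (n + N) :> R by rewrite exprn_ge0.
    lra.
  have g0 : (fun n => 2 * (2^-1) ^+ n : R) @ \oo --> 0.
    by have := @cvg_geometric R 2 (2^-1); apply; rewrite ger0_norm// invf_lt1// ltr1n.
  have g0' : (fun n => 2 * (2^-1) ^+ (n + N)%N : R) @ \oo --> 0.
    by move: g0; rewrite -(cvg_shiftn N).
  apply/cvg_ex; exists (limn u + 0); rewrite -(cvg_shiftn N).
  rewrite (_ : [sequence _]_n = u \+ (fun n => 2 * (2^-1) ^+ (n + N)%N)).
    exact: cvgD.
  by apply/funext => n; rewrite /u /= subrK.
move=> cv; have := cv; rewrite val_clip ?cvg_limn_supE//.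
rewrite limr_ge//=; last by apply: nearW => n; exact: unit_itv_val_ge0.
by rewrite limr_le//; apply: nearW => n; have /andP[] := unit_itv_val_itv (T_ n x).
Qed.

End AlmostSureLimits.

(** Regularity of a uniform topology: the hypothesis on [g] says that it lies in the closure of
    [B]. *)
Lemma ptws_regular (U : Type) (V : uniformType) (f : {ptws U -> V})
    (A : set {ptws U -> V}) : nbhs f A ->
  exists2 B : set {ptws U -> V}, nbhs f B &
    forall g : {ptws U -> V}, (forall C, nbhs g C -> B `&` C !=set0) -> A g.
Proof. by move=> /uniform_regular[B nB BA]; exists B. Qed.

(** * Completeness and the Baire argument *)

Section Completeness.
Variable R : realType.
Notation I := (unit_itv R).
Notation m := (lebI R).
Notation L2 := (L2 m).
Notation val := (@unit_itv_val R).

Lemma val_Lfun2 : val \in Lfun m 2%:E.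
Proof.
apply: (@bounded_Lfun2 _ _ 1); first exact: measurable_unit_itv_val.
by move=> x; have /andP[x0 x1] := unit_itv_val_itv x; rewrite ger0_norm.
Qed.

(** The identity map of [0, 1] viewed as a vector: its Koopman images are the transformations
    themselves, so norms of differences are distances between maps. *)
Definition valL2 : L2 := L2class (real_L2fun val_Lfun2).

Lemma comp_val_Lfun2 (T : I -> I) : measurable_fun setT T ->
  (fun x => val (T x)) \in Lfun m 2%:E.
Proof.
move=> mT; apply: (@bounded_Lfun2 _ _ 1).
  exact: measurableT_comp (@measurable_unit_itv_val R) mT.
by move=> x; have /andP[x0 x1] := unit_itv_val_itv (T x); rewrite ger0_norm.
Qed.

Lemma koopman_valL2 (T : autom m) :
  koopman T valL2 = L2class (real_L2fun (comp_val_Lfun2 (autom_measurable T))).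
Proof. by apply: koopman_class; apply/aeW. Qed.

Lemma L2norm_koopman_valL2 (S T : autom m) :
  L2norm (koopman S valL2 - koopman T valL2) ^+ 2 =
  \int[m]_x ((val (S x) - val (T x)) ^+ 2).
Proof.
rewrite !koopman_valL2 -scaleN1r -L2classZ -L2classD.
set G : L2fun m := _ + _.
have GE x : G x = (val (S x) - val (T x))%:C%C.
  by rewrite -[LHS]/((val (S x))%:C%C + (-1) * (val (T x))%:C%C) mulN1r -rmorphB.
clearbody G; rewrite L2normsq_Re inner_class.
by apply: eq_Rintegral => x _; rewrite GE ReM_conj /= mul0r addr0.
Qed.

(** Limits cannot be taken inside [S_ n (T_ n x)], as [S] may be discontinuous. Instead the identity
    m(T_n^-1 A & B) = m(A & S_n^-1 B), which does pass to the limit, encodes that the maps are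
    inverse to each other. *)
Lemma mp_limit_inverse (S_ T_ : nat -> I -> I) (S T : I -> I) :
  (forall n, measurable_fun setT (S_ n)) -> (forall n, measurable_fun setT (T_ n)) ->
  measurable_fun setT S -> measurable_fun setT T ->
  (forall n, measure_preserving m (S_ n)) -> (forall n, measure_preserving m (T_ n)) ->
  ae_cvg S_ S -> ae_cvg T_ T ->
  (forall n, S_ n \o T_ n = id %[ae m]) -> T \o S = id %[ae m].
Proof.
move=> mS_ mT_ mS mT pS_ pT_ SS TT ST.
have pS := ae_cvg_mp mS_ mS pS_ SS; have pT := ae_cvg_mp mT_ mT pT_ TT.
have mray b : measurable (ray b : set I) by exact: measurable_ray.
have mSr b := measurable_preim mS (mray b).
have mTr b := measurable_preim mT (mray b).
have E a b : 0 <= a -> 0 <= b ->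
    mr (T @^-1` ray a `&` ray b) = mr (ray a `&` S @^-1` ray b).
  move=> a0 b0.
  have H1 : mr (T_ n @^-1` ray a `&` ray b) @[n --> \oo] --> mr (T @^-1` ray a `&` ray b).
    by rewrite (rayE a); exact: mr_cvg_seg.
  have H2 : mr (S_ n @^-1` ray b `&` ray a) @[n --> \oo] --> mr (S @^-1` ray b `&` ray a).
    by rewrite (rayE b); exact: mr_cvg_seg.
  rewrite [RHS](_ : _ = mr (S @^-1` ray b `&` ray a)); last by rewrite setIC.
  apply: cvg_unique H1 _ => //; rewrite (_ : (fun _ => _) = (fun n => mr (S_ n @^-1` ray b `&` ray a)))//.
  apply/funext => n; have mTb := measurable_preim (mT_ n) (mray a).
  have mSb := measurable_preim (mS_ n) (mray b).
  rewrite -(mp_mr (pT_ n) (measurableI _ _ mSb (mray a))) /mr; congr fine.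
  apply: ae_eq_measure.
  - exact: measurableI.
  - by apply: measurable_preim => //; exact: measurableI.
  - by apply: filterS (ST n) => x /(_ Logic.I) /= STx; rewrite STx; split=> -[].
(* Both sides are finite measures in [B] that agree on rays. Borel sets are required because [B]
   will be the preimage of a ray. *)
have E' a B : 0 <= a -> measurable B ->
    m (T @^-1` ray a `&` B) = m (ray a `&` S @^-1` B).
  move=> a0 mB.
  pose m1 := mrestr m (mTr a); pose m2 := mrestr m (mray a).
  pose m3 := measure_function_pushforward__canonical__measure_function_Measure m2 mS.
  have m1E C : m1 C = m (C `&` T @^-1` ray a) by [].
  have m3E C : m3 C = m (S @^-1` C `&` ray a) by [].
  rewrite setIC [in RHS]setIC -[LHS]/(m1 B) -[RHS]/(m3 B).
  apply: eq_measure_ray => //.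
    move=> b; change (m (ray b `&` T @^-1` ray a) = m (S @^-1` ray b `&` ray a)).
    have [b0|b0] := ltP b 0.
      by rewrite ray_clip b0 preimage_set0 !set0I.
    rewrite setIC [in RHS]setIC.
    rewrite -(EFin_mr (measurableI _ _ (mTr a) (mray b))).
    by rewrite E// EFin_mr//; exact: measurableI.
  change (m (setT `&` T @^-1` ray a) < +oo)%E.
  by rewrite setTI -ge0_fin_numE//; exact: unit_itv_measure_fin.
have F a : 0 <= a <= 1 -> {ae m, forall x, ray a x <-> ray a (T (S x))}.
  move=> /andP[a0 a1]; have mSTr := measurable_preim mS (mTr a).
  (* For this [B], the ray, its preimage under [T \o S] and their intersection have the same
     measure, so the first two differ by a null set. *)
  have h := E' a _ a0 (mTr a); rewrite setIid in h.
  have hd A B : measurable A -> measurable B -> m A = m B -> m (A `&` B) = m A ->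
      m (A `\` B) = 0%E /\ m (B `\` A) = 0%E.
    move=> mA mB AB AIB.
    have fin C : measurable C -> (m C < +oo)%E.
      by move=> mC; rewrite -ge0_fin_numE// unit_itv_measure_fin.
    have D1 := measureD mA mB (fin _ mA); have D2 := measureD mB mA (fin _ mB).
    split.
      transitivity (m A - m (A `&` B))%E; first exact: D1.
      by rewrite AIB subee// unit_itv_measure_fin.
    transitivity (m B - m (B `&` A))%E; first exact: D2.
    by rewrite (setIC B A) AIB AB subee// unit_itv_measure_fin.
  have [h1 h2] := hd _ _ (mray a) mSTr (esym (etrans (pS _ (mTr a)) (pT _ (mray a))))
     (etrans (esym h) (pT _ (mray a))).
  have nul A : measurable A -> m A = 0%E -> {ae m, forall x, ~ A x}.
    by move=> mA A0; exists A; split => // x /= /contrapT.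
  apply: filterS2 (nul _ (measurableD (mray a) mSTr) h1) (nul _ (measurableD mSTr (mray a)) h2).
  move=> x n1 n2; split=> xa; apply: contrapT => nxa; [apply: n1|apply: n2]; by split.
(* Rational thresholds separate points, and there are countably many, so one null set serves all of
   them. The default 0 merely repeats a rational. *)
pose q n : R := if unpickle n is Some r then ratr r else 0.
have G : {ae m, forall x, forall n, 0 <= q n <= 1 -> (ray (q n) x <-> ray (q n) (T (S x)))}.
  apply/ae_foralln => n; have [n01|n01] := boolP (0 <= q n <= 1).
    by apply: filterS (F _ n01) => x.
  by apply/aeW.
apply: filterS G => x Hx _; apply: val_inj => /=.
have [//|xy] := eqVneq (val (T (S x))) (val x).
have K (y z : I) : val y < val z -> exists n, [/\ 0 <= q n <= 1, ray (q n) y & ~ ray (q n) z].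
  move=> /rat_in_itvoo[r]; rewrite in_itv /= => /andP[yr rz]; exists (pickle r).
  rewrite /q pickleK; split => //; last by rewrite /ray /=; apply/negP; rewrite -leNgt ltW.
  have /andP[y0 _] := unit_itv_val_itv y; have /andP[_ z1] := unit_itv_val_itv z.
  by rewrite (le_trans y0 (ltW yr)) (le_trans (ltW rz) z1).
exfalso; move: xy; rewrite neq_lt => /orP[] /K[n [n01 h1 h2]]; apply: h2.
  exact/(Hx n n01).
exact/(Hx n n01).
Qed.

(** Squaring turns [4^-(n+1)] into the [16^-(n+1)] of [ae_limit]. The inverses must be Cauchy as
    well, since otherwise the limit map could fail to be invertible. *)
Lemma autom_complete (T_ : nat -> autom m) :
  (forall n, L2norm (koopman (T_ n.+1) valL2 - koopman (T_ n) valL2) <= 4^-1 ^+ n.+1) ->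
  (forall n, L2norm (koopman (autom_inv (T_ n.+1)) valL2 -
                     koopman (autom_inv (T_ n)) valL2) <= 4^-1 ^+ n.+1) ->
  exists T : autom m, T_ @ \oo --> T.
Proof.
move=> H1 H2.
have sq n (f : L2) : L2norm f <= 4^-1 ^+ n.+1 -> L2norm f ^+ 2 <= 16^-1 ^+ n.+1.
  move=> h; have -> : 16^-1 = 4^-1 ^+ 2 :> R by rewrite expr2; lra.
  by rewrite exprAC lerXn2r ?nnegrE ?L2norm_ge0 ?exprn_ge0 ?invr_ge0.
have mT_ n : measurable_fun setT (T_ n) by exact: autom_measurable.
have mS_ n : measurable_fun setT (autom_inv (T_ n)) by exact: autom_measurable.
have pT_ n : measure_preserving m (T_ n) by exact: autom_preserving.
have pS_ n : measure_preserving m (autom_inv (T_ n)) by exact: autom_preserving.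
have [T mT TT] : exists2 T, measurable_fun setT T & ae_cvg (fun n => T_ n) T.
  by apply: ae_limit => // n; rewrite -L2norm_koopman_valL2; exact: sq.
have [S mS SS] : exists2 S, measurable_fun setT S & ae_cvg (fun n => autom_inv (T_ n)) S.
  by apply: ae_limit => // n; rewrite -L2norm_koopman_valL2; exact: sq.
have pT := ae_cvg_mp mT_ mT pT_ TT; have pS := ae_cvg_mp mS_ mS pS_ SS.
have TS := mp_limit_inverse mS_ mT_ mS mT pS_ pT_ SS TT (fun n => autom_invK (T_ n)).
have ST := mp_limit_inverse mT_ mS_ mT mS pT_ pS_ TT SS (fun n => autom_Kinv (T_ n)).
have [U UT] := mk_autom mS mT pS pT ST TS.
exists U; apply: autom_cvg => r i r' j ir jr'.
have mc s k : measurable (@cell R s k) by exact: measurable_cell.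
rewrite (koopman_ind_ae mT UT)// inner_ind//; last exact: measurable_preim.
rewrite (_ : (fun _ => _) = fun n =>
    (mr (T_ n @^-1` cell (2 ^ r) i `&` cell (2 ^ r') j))%:C%C); last first.
  apply/funext => n; rewrite koopman_ind// inner_ind//.
  exact: measurable_preim.
apply: cvgC_real; rewrite (@cellE _ (2 ^ r)) ?expn_gt0//.
by apply: mr_cvg_seg => //; rewrite divr_ge0.
Qed.

(** Regularity in sequential form: [B] plays the part of a closed ball inside [A] that retains
    limits. *)
Lemma autom_shrink (T : autom m) (A : set (autom m)) : nbhs T A ->
  exists2 B, nbhs T B & forall (T_ : nat -> autom m) (S : autom m),
    (exists N, forall n, (N <= n)%N -> B (T_ n)) -> T_ @ \oo --> S -> A S.
Proof.
move=> [U [] [] O oO <- OT OA].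
have /ptws_regular [B' nB' B'O] : nbhs (strong_star T) O by exact: open_nbhs_nbhs.
exists (@strong_star _ _ _ m @^-1` B'); first exact: nbhs_strong_star nB'.
move=> T_ S [N BT] TS; apply: OA; apply: B'O => C nC.
have /TS [N' _ HN'] : nbhs S (@strong_star _ _ _ m @^-1` C) by exact: nbhs_strong_star nC.
exists (strong_star (T_ (maxn N N'))); split; first by apply: BT; exact: leq_maxl.
by apply: HN'; exact: leq_maxr.
Qed.

Lemma autom_baire (O : nat -> set (autom m)) :
  (forall k, open (O k)) -> (forall k, dense (O k)) -> dense (\bigcap_k O k).
Proof.
move=> oO dO W [T0 WT0] oW.
(* The property is conditional on [s.2] being a neighbourhood of [s.1], so that a successor exists
   for every pair and [choice] applies; the condition is recovered along the sequence by
   induction. *)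
pose good (k : nat) (s s' : autom m * set (autom m)) := nbhs s.1 s.2 ->
  [/\ nbhs s'.1 s'.2,
    s'.2 `<=` s.2,
    L2norm (koopman s'.1 valL2 - koopman s.1 valL2) <= 4^-1 ^+ k.+1,
    L2norm (koopman (autom_inv s'.1) valL2 - koopman (autom_inv s.1) valL2) <= 4^-1 ^+ k.+1 &
    forall (T_ : nat -> autom m) (S : autom m),
    (exists N, forall n, (N <= n)%N -> s'.2 (T_ n)) -> T_ @ \oo --> S ->
    (s.2 `&` O k) S].
have step k s : exists s', good k s s'.
  have [ns|] := pselect (nbhs s.1 s.2); last by exists s.
  have e0 : 0 < (4^-1 ^+ k.+1)%:C%C :> R[i] by rewrite ltcR exprn_gt0// invr_gt0.
  have FT : Filter (nbhs s.1) := nbhs_filter s.1.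
  have /cvgrPdist_lt /(_ _ e0) H1 := @continuous_koopman R valL2 s.1.
  have /cvgrPdist_lt /(_ _ e0) H2 := @continuous_koopmanV R valL2 s.1.
  have [S OS nS] := dense_nbhs (dO k) (filterI ns (filterI H1 H2)).
  have nOS : nbhs S (O k) by apply: open_nbhs_nbhs; split.
  have FS : Filter (nbhs S) := nbhs_filter S.
  have [B nB HB] := autom_shrink (filterI nS nOS).
  have [sS [S1 S2]] := nbhs_singleton nS.
  exists (S, B `&` s.2) => _; split => /=.
  - by apply: filterI => //; apply: (@filterS _ _ FS _ _ _ nS) => ? [].
  - by move=> ? [].
  - by move: S1; rewrite /= L2_normE ltcR L2normBC => /ltW.
  - by move: S2; rewrite /= L2_normE ltcR L2normBC => /ltW.
  move=> T_ U [N BT] TU; have BT' n : (N <= n)%N -> B (T_ n) by move=> /BT[].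
  by have [[sU _] OU] := HB T_ U (ex_intro _ N BT') TU.
have step' ks : exists s', good ks.1 ks.2 s' := step ks.1 ks.2.
have [F HF] := choice step'.
pose s := fix s n := if n is k.+1 then F (k, s k) else (T0, W).
have ns n : nbhs (s n).1 (s n).2.
  elim: n => [|n IH] /=; first by apply: open_nbhs_nbhs; split.
  by case: (HF (n, s n) IH).
have sub n k : (n <= k)%N -> (s k).2 `<=` (s n).2.
  move=> /subnK <-; elim: (k - n)%N => // l IH; rewrite addSn.
  by apply: subset_trans IH; case: (HF (l + n, s (l + n)%N)%N (ns _)).
have [T Tcvg] := @autom_complete (fun n => (s n).1)
  (fun n => let: And5 _ _ h _ _ := HF (n, s n) (ns n) in h)
  (fun n => let: And5 _ _ _ h _ := HF (n, s n) (ns n) in h).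
have inO k : ((s k).2 `&` O k) T.
  case: (HF (k, s k) (ns k)) => _ _ _ _; apply; last exact: Tcvg.
  exists k.+1 => n kn; apply: (sub _ _ kn); exact: nbhs_singleton (ns n).
exists T; split; first by have [] := inO 0%N.
by move=> k _; have [] := inO k.
Qed.

End Completeness.

(** * Mixing permutations with prescribed transition counts *)

Local Open Scope nat_scope.

Section PeriodicSums.
Variables (F : nat -> nat) (Q : nat).
Hypothesis F_per : forall t, F (t + Q) = F t.

Lemma sum_periodic n : \sum_(0 <= t < n * Q) F t = n * \sum_(0 <= t < Q) F t.
Proof.
have F_perM k t : F (t + k * Q) = F t.
  by elim: k => [|k IH]; rewrite ?addn0// mulSn addnA addnAC F_per IH.
elim: n => [|n IH]; first by rewrite !mul0n big_geq.
rewrite mulSnr (@big_cat_nat _ _ _ (n * Q)) ?leq_addr//= IH mulSnr; congr addn.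
rewrite -{1}[n * Q]add0n big_addn addKn.
by apply: eq_bigr => t _; rewrite F_perM.
Qed.

Lemma sum_periodic_shift a : \sum_(0 <= t < Q) F (t + a) = \sum_(0 <= t < Q) F t.
Proof.
elim: a => [|a IH]; first by apply: eq_bigr => t _; rewrite addn0.
rewrite -IH; case: (Q) F_per => [|Q'] FP; first by rewrite !big_geq.
rewrite big_nat_recr//= big_nat_recl//= add0n.
rewrite addnC; congr addn; last by apply: eq_bigr => t _; rewrite addnS addSn.
by rewrite addnS -addSn addnC FP.
Qed.

End PeriodicSums.

Section Rotation.

(* Cyclic rotation of the first l cells; the other cells are fixed. *)
Definition rot_cell (l t : nat) := if (t < l)%N then (t.+1 %% l)%N else t.

Lemma rot_cell_lt l m t : (0 < l)%N -> (l <= m)%N -> (t < m)%N -> (rot_cell l t < m)%N.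
Proof.
by move=> l0 lm tm; rewrite /rot_cell; case: ifP => // _; rewrite (leq_trans _ lm)// ltn_mod.
Qed.

Lemma iter_rot_cell l n t : (t < l)%N -> iter n (rot_cell l) t = ((t + n) %% l)%N.
Proof.
move=> tl; have l0 := leq_ltn_trans (leq0n t) tl.
elim: n => [|n IH] /=; first by rewrite addn0 modn_small.
by rewrite IH /rot_cell ltn_mod l0 -addn1 modnDml addn1 addnS.
Qed.

Lemma rot_cell_inj l : injective (rot_cell l).
Proof.
move=> s t; rewrite /rot_cell; case: ltnP => sl; case: ltnP => tl //.
- move=> /eqP; rewrite -(addn1 s) -(addn1 t) eqn_modDr => /eqP.
  by rewrite !modn_small.
- by move=> E; move: tl; rewrite -E leqNgt ltn_mod (leq_ltn_trans _ sl).
- by move=> E; move: sl; rewrite E leqNgt ltn_mod (leq_ltn_trans _ tl).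
Qed.

End Rotation.

Section EqualFibres.
Variables (S S' : finType) (L : eqType) (lab : S -> L) (lab' : S' -> L).
Hypothesis eq_fibres : forall l, #|[pred x | lab x == l]| = #|[pred x | lab' x == l]|.

(** Enumerate each pair of corresponding fibres and match elements with the same position. *)
Lemma equal_fibres_bij : S -> S' ->
  exists f : S -> S', exists g : S' -> S,
  [/\ cancel f g, cancel g f & forall x, lab' (f x) = lab x].
Proof.
move=> x0 y0.
pose fib x := enum [pred z | lab z == lab x]; pose fib' y := enum [pred z | lab' z == lab' y].
pose f x := nth y0 (enum [pred y | lab' y == lab x]) (index x (fib x)).
pose g y := nth x0 (enum [pred x | lab x == lab' y]) (index y (fib' y)).
have fib_x x : x \in fib x by rewrite mem_enum inE.
have fib_y y : y \in fib' y by rewrite mem_enum inE.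
have fP x : f x \in enum [pred y | lab' y == lab x].
  by rewrite mem_nth// -cardE -eq_fibres cardE index_mem.
have gP y : g y \in enum [pred x | lab x == lab' y].
  by rewrite mem_nth// -cardE eq_fibres cardE index_mem.
have labf x : lab' (f x) = lab x by have := fP x; rewrite mem_enum inE => /eqP.
have labg y : lab (g y) = lab' y by have := gP y; rewrite mem_enum inE => /eqP.
exists f, g; split => // [x|y].
  rewrite /g /fib' labf index_uniq ?enum_uniq ?nth_index//.
  by rewrite -cardE -eq_fibres cardE index_mem.
rewrite /f /fib labg index_uniq ?enum_uniq ?nth_index//.
by rewrite -cardE eq_fibres cardE index_mem.
Qed.

End EqualFibres.

Section Counting.
Variable N : nat.

Definition cnt (S : finType) (lab : S -> 'I_N) (f : S -> S) (i j : 'I_N) : nat :=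
  \sum_(x : S) ((lab x == i) && (lab (f x) == j)).

Lemma sum_cnt (S : finType) (lab : S -> 'I_N) (f : S -> S) :
  \sum_i \sum_j cnt lab f i j = #|S|.
Proof.
rewrite /cnt; under eq_bigr => i _ do rewrite exchange_big.
rewrite exchange_big -sum1_card; apply: eq_bigr => x _ /=.
rewrite (bigD1 (lab x))//= (bigD1 (lab (f x)))//= !eqxx /=.
rewrite big1 => [|j /negbTE jx]; last by rewrite eq_sym jx.
rewrite big1 // => i /negbTE ix.
by apply: big1 => j _; rewrite eq_sym ix.
Qed.

Lemma iter_perm (T : finType) (s : {perm T}) n x : iter n s x = (s ^+ n)%g x.
Proof. by rewrite permX. Qed.

(** The coarse cell containing the fine cell [c] when each of [N] cells is cut into [M]. *)
Definition block (M : nat) (c : 'I_(N * M)) : 'I_N.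
Proof.
exists (c %/ M)%N; case: M c => [|M] c; last by rewrite ltn_divLR.
by case: c => c /=; rewrite muln0.
Defined.

Lemma card_block M (i : 'I_N) : #|[pred c | @block M c == i]| = M.
Proof.
have bnd (u : 'I_M) : (i * M + u < N * M)%N.
  by rewrite (leq_trans (_ : _ < i.+1 * M)%N) ?leq_mul2r ?ltn_ord ?orbT// mulSn addnC ltn_add2r.
rewrite -[RHS]card_ord -(card_imset _ (f := fun u : 'I_M => Ordinal (bnd u))); last first.
  by move=> u v [] /eqP; rewrite eqn_add2l => /eqP /val_inj.
apply: eq_card => c; rewrite !inE; apply/eqP/imsetP => [ci|[u _ ->]]; last first.
  apply: val_inj => /=; have M0 : (0 < M)%N by case: (M) u => [[]|].
  by rewrite divnMDl// divn_small ?addn0.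
have M0 : (0 < M)%N by case: (M) c {bnd ci} => [[c]|]//=; rewrite muln0.
have uM : (c %% M < M)%N by rewrite ltn_mod.
exists (Ordinal uM) => //; apply: val_inj => /=.
by rewrite -ci /= -divn_eq.
Qed.

(** A label-preserving bijection conjugates [f] to a permutation of cells. Conjugation respects
    iterates, so one permutation serves all [n]. *)
Lemma cnt_transport (S : finType) (lab : S -> 'I_N) (f : S -> S) M :
  S -> (0 < M)%N -> injective f -> (forall i, #|[pred x | lab x == i]| = M) ->
  exists s : {perm 'I_(N * M)}, forall n i j,
    cnt (@block M) (iter n s) i j = cnt lab (iter n f) i j.
Proof.
move=> x0 M0 fI fib.
have NM : (0 < N * M)%N by rewrite muln_gt0 M0 andbT; case: (N) (lab x0) => [[]|].
have [|phi [psi [phiK psiK labphi]]] :=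
  equal_fibres_bij (lab := lab) (lab' := @block M) _ x0 (Ordinal NM).
  by move=> i; rewrite fib card_block.
have sI : injective (fun c => phi (f (psi c))).
  by apply: inj_comp (can_inj phiK) (inj_comp fI (can_inj psiK)).
exists (perm sI) => n i j; rewrite /cnt (reindex phi) /=; last first.
  by exists psi => x _; [exact: phiK|exact: psiK].
apply: eq_bigr => x _; rewrite labphi.
have -> : iter n (perm sI) (phi x) = phi (iter n f x).
  by elim: n => //= n ->; rewrite permE phiK.
by rewrite labphi.
Qed.

End Counting.

(** * Realizing an integer matrix by a permutation *)

Section RealizeCounts.
Variables (N M : nat) (k : 'I_N -> 'I_N -> nat).
Hypothesis k_row : forall i, \sum_j k i j <= M.
Hypothesis k_col : forall j, \sum_i k i j <= M.

(** Row [i] contains [q i j] copies of the tag [e i j]; [tag] reads it on [M] slots and pads with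
    [None]. *)
Let word (q : 'I_N -> 'I_N -> nat) (e : 'I_N -> 'I_N -> option ('I_N * 'I_N)) (i : 'I_N) :=
  flatten [seq nseq (q i j) (e i j) | j <- enum 'I_N].

Let size_word q e i : size (word q e i) = \sum_j q i j.
Proof.
rewrite /word size_flatten /shape -map_comp sumnE big_map big_enum.
by apply: eq_bigr => j _ /=; rewrite size_nseq.
Qed.

Let word_count q e i (l : option ('I_N * 'I_N)) : count_mem l (word q e i) =
  \sum_j (e i j == l) * q i j.
Proof.
rewrite /word count_flatten -map_comp sumnE big_map big_enum.
by apply: eq_bigr => j _ /=; rewrite count_nseq.
Qed.

Let tag q e (c : 'I_N * 'I_M) := nth None (word q e c.1) c.2.

Let count_nth (T : eqType) (x0 x : T) (s : seq T) : x != x0 -> size s <= M ->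
  \sum_(u < M) (nth x0 s u == x) = count_mem x s.
Proof.
move=> xx0 sM; rewrite -sum1_count (big_nth x0).
rewrite -(big_mkord xpredT (fun u => (nth x0 s u == x) : nat)).
rewrite (@big_cat_nat _ _ _ (size s))//= [X in _ + X]big1_seq ?addn0.
  by rewrite [RHS]big_mkcond; apply: eq_bigr => u _; case: eqP.
move=> u /andP[_]; rewrite mem_index_iota => /andP[su _].
by rewrite nth_default// eq_sym (negbTE xx0).
Qed.

Let tag_count q e i j : (forall i, \sum_j q i j <= M) ->
  #|[pred c | tag q e c == Some (i, j)]| =
  \sum_i' \sum_j' (e i' j' == Some (i, j)) * q i' j'.
Proof.
move=> qM; rewrite -sum1_card big_mkcond /=.
transitivity (\sum_(i' < N) \sum_(u < M) ((tag q e (i', u) == Some (i, j)) : nat)).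
  rewrite pair_bigA; apply: eq_bigr => -[i' u] _ /=; rewrite inE.
  by case: eqP.
apply: eq_bigr => i' _; by rewrite -word_count -(count_nth (x0 := None)) ?size_word.
Qed.

Let tag_mem q e (c : 'I_N * 'I_M) ij : tag q e c = Some ij -> exists j, e c.1 j = Some ij.
Proof.
rewrite /tag => E; have : Some ij \in word q e c.1.
  rewrite -E mem_nth// ltnNge; apply/negP => sc.
  by move: E; rewrite nth_default.
by move=> /flattenP[_ /mapP[j _ ->]]; rewrite mem_nseq => /andP[_ /eqP ->]; exists j.
Qed.

(** Every slot is tagged once as a departure ([f1]) and once as an arrival ([f2]), each pair
    [(i, j)] being used [k i j] times in both roles. A bijection matching departure tags with
    arrival tags makes at least the required transitions. *)
Lemma realize_counts : 0 < N -> 0 < M -> exists2 s : 'I_N * 'I_M -> 'I_N * 'I_M,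
  bijective s & forall i j, k i j <= cnt (fun c : 'I_N * 'I_M => c.1) s i j.
Proof.
move=> N0 M0; pose c0 := (Ordinal N0, Ordinal M0).
pose f1 := tag k (fun i j => Some (i, j)).
pose f2 := tag (fun j i => k i j) (fun j i => Some (i, j)).
have f12 ij : #|[pred c | f1 c == Some ij]| = #|[pred c | f2 c == Some ij]|.
  by case: ij => i j; rewrite !tag_count// exchange_big.
have total (f : 'I_N * 'I_M -> option ('I_N * 'I_N)) :
    #|[pred c | f c == None]| + \sum_ij #|[pred c | f c == Some ij]| = #|{: 'I_N * 'I_M}|.
  rewrite -[RHS]sum1_card (partition_big f predT)//= (bigD1 None)//= sum1_card; congr addn.
  rewrite (reindex_omap Some id)/=; last by case.
  apply: eq_big => [ij|ij _]; first by rewrite eqxx.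
  by rewrite sum1_card.
have fib l : #|[pred c | f1 c == l]| = #|[pred c | f2 c == l]|.
  case: l => [ij|]; first exact: f12.
  (* The untagged slots are equally many on both sides, as complements of equally many tagged
     ones. *)
  by apply: (@addIn (\sum_ij #|[pred c | f1 c == Some ij]|)); rewrite total -(total f2); congr addn; apply: eq_bigr => ij _; rewrite f12.
have [s [s' [sK s'K sf]]] := equal_fibres_bij fib c0 c0.
exists s; first by exists s'.
move=> i j; have -> : k i j = #|[pred c | f1 c == Some (i, j)]|.
  rewrite tag_count// (bigD1 i)//= (bigD1 j)//= eqxx mul1n.
  rewrite [X in _ + X + _]big1 ?addn0 => [|j' /negbTE jj]; last first.
    by rewrite (_ : _ == _ = false) ?mul0n//; apply/eqP => -[E]; move: jj; rewrite E eqxx.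
  rewrite big1 ?addn0 // => i' /negbTE ii; apply: big1 => j' _.
  by rewrite (_ : _ == _ = false) ?mul0n//; apply/eqP => -[E]; move: ii; rewrite E eqxx.
rewrite -sum1_card big_mkcond /cnt leq_sum// => c _; rewrite inE.
case: eqP => // fc; have [j' [-> _]] := tag_mem fc.
by have [i' [_ ->]] := tag_mem (etrans (sf c) fc); rewrite !eqxx.
Qed.

End RealizeCounts.

Lemma sum_nat_mul (F : nat -> nat) P L :
  \sum_(0 <= t < P * L) F t = \sum_(0 <= x < P) \sum_(0 <= u < L) F (x * L + u).
Proof.
elim: P => [|P IH]; first by rewrite !big_geq.
rewrite mulSnr (@big_cat_nat _ _ _ (P * L)) ?leq_addr//= IH big_nat_recr//=; congr addn.
rewrite -{1}[P * L]add0n big_addn addKn.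
by apply: eq_bigr => u _; rewrite addnC.
Qed.

Section Words.
Variables (N M L : nat) (s : 'I_N * 'I_M -> 'I_N * 'I_M) (c0 : 'I_N * 'I_M).
Hypothesis s_bij : bijective s.
Hypothesis L0 : 0 < L.

Let P := N * M.

Let xx u := nth c0 (enum {: 'I_N * 'I_M}) (u %% P).

Let sum_xx (G : 'I_N * 'I_M -> nat) : \sum_(0 <= u < P) G (xx u) = \sum_x G x.
Proof.
have sz : size (enum {: 'I_N * 'I_M}) = P by rewrite -cardE card_prod !card_ord.
rewrite -big_enum [RHS](big_nth c0) sz; rewrite [LHS]big_nat [RHS]big_nat.
by apply: eq_bigr => u /andP[_ uP]; rewrite /xx modn_small.
Qed.

(* Concatenation of the length-L orbit segments of all the points. *)
Definition orbit_word t := (iter (t %% L) s (xx (t %/ L))).1.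

Lemma orbit_word_periodic t : orbit_word (t + P * L) = orbit_word t.
Proof.
by rewrite /orbit_word addnC modnMDl divnMDl// /xx modnDl.
Qed.

Let word_at x u : u < L -> orbit_word (x * L + u) = (iter u s (xx x)).1.
Proof.
by move=> uL; rewrite /orbit_word modnMDl modn_small// divnMDl// divn_small// addn0.
Qed.

Let iter_bij u : bijective (iter u s).
Proof. by elim: u => [|u IH]; [exists id|exact: bij_comp s_bij IH]. Qed.

(** At each offset [u] the word reads all points through the bijection [iter u s], so every letter
    occurs [M] times there. *)
Lemma orbit_word_letters i : \sum_(0 <= t < P * L) (orbit_word t == i) = L * M.
Proof.
rewrite sum_nat_mul exchange_big /= -[RHS]/(L * M) -[L in RHS]subn0 -sum_nat_const_nat.
rewrite !big_nat; apply: eq_bigr => u /andP[_ uL].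
under eq_bigr => x _ do rewrite word_at//.
rewrite (sum_xx (fun x => ((iter u s x).1 == i) : nat)).
rewrite -(reindex (iter u s) (P := predT) (F := fun x => (x.1 == i) : nat)) /=; last first.
  by have [g K1 K2] := iter_bij u; exists g => x _.
rewrite -(pair_bigA _ (fun a (b : 'I_M) => (a == i) : nat)) /=.
rewrite (bigD1 i)//= [X in _ + X]big1 ?addn0 => [|j /negbTE ji]; last by rewrite big1// ji.
by rewrite eqxx sum1_card card_ord.
Qed.

(** Only steps inside an orbit segment are counted: a segment of length [L] has [L.-1] of them, and
    nothing is known at the seams. *)
Lemma orbit_word_transitions i j :
  L.-1 * cnt (fun c : 'I_N * 'I_M => c.1) s i j <=
  \sum_(0 <= t < P * L) ((orbit_word t == i) && (orbit_word t.+1 == j)).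
Proof.
rewrite sum_nat_mul exchange_big /=.
rewrite -[L in \sum_(0 <= _ < L) _](prednK L0) big_nat_recr//= (leq_trans _ (leq_addr _ _))//.
rewrite -[L.-1 in X in X <= _]subn0 -sum_nat_const_nat !big_nat leq_sum// => u /andP[_ uL].
have uL' : u.+1 < L by rewrite -(prednK L0).
rewrite /cnt.
have E x : orbit_word (x * L + u).+1 = (iter u.+1 s (xx x)).1 by rewrite -addnS word_at.
under [X in _ <= X]eq_bigr => x _ do rewrite E word_at ?(ltnW uL')//.
rewrite (sum_xx (fun x => (((iter u s x).1 == i) && ((iter u.+1 s x).1 == j)) : nat)) /=.
rewrite -(reindex (iter u s) (P := predT)
  (F := fun x => ((x.1 == i) && ((s x).1 == j)) : nat)) //=.
by have [g K1 K2] := iter_bij u; exists g => x _.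
Qed.

End Words.

(** * Towers over a periodic word *)

Section Towers.
Variables (N Q H q : nat) (w : nat -> 'I_N) (A : finType) (sh : A -> nat).
Hypothesis w_per : forall t, w (t + Q) = w t.
Hypothesis w_letters : forall i, \sum_(0 <= t < Q) (w t == i) = H.
Hypothesis q2 : 1 < q.
Hypothesis shQ : forall a, sh a < Q.

(* Column [a] is a tower of [height a] levels on which the map cyclically goes up
   one level; since Q * q = height a + sh a, after Q * q steps a point that has not
   come near the top has moved up by exactly [sh a] levels. *)
Let height a := Q * q - sh a.

Let height_gt0 a : 0 < height a.
Proof. by rewrite subn_gt0 (leq_trans (shQ a))// leq_pmulr// ltnW. Qed.

Let move a (t : 'I_(Q * q)) : 'I_(Q * q) :=
  Ordinal (rot_cell_lt (height_gt0 a) (leq_subr _ _) (ltn_ord t)).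

Definition tower_map (x : A * 'I_(Q * q)) := (x.1, move x.1 x.2).
Definition tower_label (x : A * 'I_(Q * q)) := w x.2.

Lemma tower_map_inj : injective tower_map.
Proof.
by move=> [a t] [b u] [-> ]; move=> /rot_cell_inj /val_inj ->.
Qed.

Lemma iter_tower_map n a t : iter n tower_map (a, t) = (a, iter n (move a) t).
Proof. by elim: n => //= n ->. Qed.

Lemma val_iter_move n a t : iter n (move a) t = iter n (rot_cell (height a)) t :> nat.
Proof. by elim: n => //= n ->. Qed.

(** Every column keeps [Q * q] levels, the top [sh a] of them fixed by the map; it thus reads [q]
    full periods and favours no letter, which gives the equal fibres for [cnt_transport]. *)
Lemma tower_label_card i : #|[pred x | tower_label x == i]| = #|A| * q * H.
Proof.
rewrite -sum1_card big_mkcond /=.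
rewrite (eq_bigr (fun x : A * 'I_(Q * q) => (w x.2 == i) : nat)); last first.
  by move=> x _; rewrite inE; case: eqP.
rewrite -(pair_bigA _ (fun (a : A) (t : 'I_(Q * q)) => (w t == i) : nat)) /=.
rewrite sum_nat_const -(big_mkord xpredT (fun t => (w t == i) : nat)) mulnC.
rewrite mulnC -mulnA; congr (_ * _).
rewrite mulnC -(w_letters i) sum_periodic// => t.
by rewrite w_per.
Qed.

(** The levels on which [n] steps act as the shift by [r a] include the lowest [q - d] full periods;
    the upper [d] periods are discarded. One step needs [d = 1], and [Q * q] steps need [d = 2]. *)
Lemma tower_cnt_ge n d (r : A -> nat) i j :
  (forall a t, t < Q * (q - d) -> iter n (rot_cell (height a)) t = t + r a) ->
  (q - d) * (\sum_a \sum_(0 <= t < Q) ((w t == i) && (w (t + r a) == j))) <=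
  cnt tower_label (iter n tower_map) i j.
Proof.
move=> nr; rewrite /cnt.
rewrite [X in _ <= X](eq_bigr (fun x : A * 'I_(Q * q) =>
    ((w x.2 == i) && (w (iter n (rot_cell (height x.1)) x.2) == j)) : nat)); last first.
  by move=> [a t] _; rewrite iter_tower_map /tower_label /= val_iter_move.
rewrite -(pair_bigA _ (fun (a : A) (t : 'I_(Q * q)) =>
    ((w t == i) && (w (iter n (rot_cell (height a)) t) == j)) : nat)) /=.
rewrite big_distrr /= leq_sum// => a _.
rewrite -(big_mkord xpredT (fun t => ((w t == i) && (w (iter n (rot_cell (height a)) t) == j)) : nat)).
have dq : Q * (q - d) <= Q * q by rewrite leq_mul2l leq_subr orbT.
rewrite [X in _ <= X](@big_cat_nat _ _ _ (Q * (q - d)))//=.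
rewrite (leq_trans _ (leq_addr _ _))// leq_eqVlt; apply/orP; left; apply/eqP.
rewrite -sum_periodic => [|t]; last by rewrite addnAC !w_per.
rewrite mulnC !big_nat; apply: eq_bigr => t /andP[_ tQ].
by rewrite nr.
Qed.

Lemma tower_cnt1_ge i j :
  (q - 1) * (#|A| * \sum_(0 <= t < Q) ((w t == i) && (w t.+1 == j))) <=
  cnt tower_label (iter 1 tower_map) i j.
Proof.
rewrite -sum_nat_const.
under eq_bigr => a _ do under eq_bigr => t _ do rewrite -addn1.
apply: (tower_cnt_ge (r := fun=> 1)) => a t tQ.
have tl : t.+1 < height a.
  rewrite /height ltn_subRL; rewrite mulnBr muln1 in tQ.
  by have := shQ a; have := leq_pmulr Q (ltnW q2); lia.
by rewrite iter_rot_cell ?(ltnW tl)// addn1 modn_small.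
Qed.

Lemma tower_cntQ_ge i j :
  (q - 2) * (\sum_a \sum_(0 <= t < Q) ((w t == i) && (w (t + sh a) == j))) <=
  cnt tower_label (iter (Q * q) tower_map) i j.
Proof.
apply: tower_cnt_ge => a t tQ.
have Q2 : Q * 2 <= Q * q by rewrite leq_mul2l q2 orbT.
have tl : t + sh a < height a.
  rewrite /height ltn_subRL; rewrite mulnBr in tQ.
  by have := shQ a; lia.
have tl' := leq_ltn_trans (leq_addr _ _) tl.
rewrite iter_rot_cell//.
have -> : t + Q * q = (t + sh a) + height a.
  by rewrite /height -addnA subnKC//; have := shQ a; lia.
by rewrite modnDr modn_small.
Qed.

End Towers.

(** In the first [B1] groups [a] runs over a full period, so for each [t] the letter at [t + a] is
    equidistributed and the pair count factors as [H * H]. The other groups do not shift and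
    contribute to the diagonal only. *)
Lemma sum_shift_average N Q H (w : nat -> 'I_N) B B1 i j :
  (forall t, w (t + Q) = w t) -> (forall i, \sum_(0 <= t < Q) (w t == i) = H) ->
  B1 <= B ->
  \sum_(ba : 'I_B * 'I_Q) \sum_(0 <= t < Q)
    ((w t == i) && (w (t + (if ba.1 < B1 then nat_of_ord ba.2 else 0)) == j)) =
  B1 * (H * H) + (B - B1) * (Q * ((i == j) * H)).
Proof.
move=> w_per w_let B1B.
rewrite -(pair_bigA _ (fun (b : 'I_B) (a : 'I_Q) => \sum_(0 <= t < Q)
    ((w t == i) && (w (t + (if b < B1 then nat_of_ord a else 0)) == j)))) /=.
rewrite -(big_mkord xpredT (fun b => \sum_(a < Q) \sum_(0 <= t < Q)
    ((w t == i) && (w (t + (if b < B1 then nat_of_ord a else 0)) == j)))) /=.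
rewrite (@big_cat_nat _ _ _ B1)//=; congr (_ + _).
  rewrite -[B1 in RHS]subn0 -sum_nat_const_nat !big_nat.
  apply: eq_bigr => b /andP[_ ->].
  rewrite exchange_big /= -[X in X * H](w_let i) big_distrl /=.
  apply: eq_bigr => t _; rewrite -(big_mkord xpredT (fun a => ((w t == i) && (w (t + a) == j)) : nat)).
  rewrite -(w_let j) -(sum_periodic_shift (F := fun a => (w a == j) : nat) _ t).
    rewrite big_distrr /=; apply: eq_bigr => a _.
    by rewrite mulnb addnC.
  by move=> u; rewrite w_per.
rewrite -sum_nat_const_nat !big_nat.
apply: eq_bigr => b /andP[bB _]; rewrite ltnNge bB /=.
rewrite sum_nat_const card_ord; congr (_ * _).
rewrite -(w_let i) big_distrr /=; apply: eq_bigr => t _.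
rewrite addn0 mulnb; case: eqP => [->|]; last by rewrite andbF.
by rewrite andbT andTb.
Qed.

(** The columns are pairs in ['I_B * 'I_Q]: the first [B1] groups realize all shifts below [Q], the
    others none. The time is [Q * q], a full turn of an unshifted column. *)
Lemma mixing_permutation N M L B B1 q (k : 'I_N -> 'I_N -> nat) :
  0 < N -> 0 < M -> 0 < L -> 0 < B -> B1 <= B -> 1 < q ->
  (forall i, \sum_j k i j <= M) -> (forall j, \sum_i k i j <= M) ->
  exists M', exists s : {perm 'I_(N * M')}, exists n,
  [/\ N * M' = B * (N * M * L) * (N * M * L * q), q <= n,
    forall i j, (q - 1) * (B * (N * M * L) * (L.-1 * k i j)) <= cnt (@block N M') s i j &
    forall i j, (q - 2) * (B1 * (L * M * (L * M)) +
        (B - B1) * (N * M * L * ((i == j) * (L * M)))) <=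
      cnt (@block N M') (iter n s) i j].
Proof.
move=> N0 M0 L0 B0 B1B q2 krow kcol; pose Q := N * M * L.
have Q0 : 0 < Q by rewrite !muln_gt0 N0 M0.
have [s s_bij sk] := realize_counts krow kcol N0 M0.
pose c0 := (Ordinal N0, Ordinal M0).
pose w := orbit_word L s c0.
have w_per t : w (t + Q) = w t by exact: orbit_word_periodic.
have w_let i : \sum_(0 <= t < Q) (w t == i) = L * M by exact: orbit_word_letters.
pose sh (ba : 'I_B * 'I_Q) := if ba.1 < B1 then nat_of_ord ba.2 else 0.
have shQ ba : sh ba < Q by rewrite /sh; case: ifP.
have x0 : ('I_B * 'I_Q) * 'I_(Q * q).
  have Qq : 0 < Q * q by rewrite muln_gt0 Q0 ltnW.
  exact: ((Ordinal B0, Ordinal Q0), Ordinal Qq).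
have M'0 : 0 < #|{: 'I_B * 'I_Q}| * q * (L * M).
  by rewrite card_prod !card_ord !muln_gt0 B0 N0 L0 M0 ltnW.
have lab_card i : #|[pred x : ('I_B * 'I_Q) * 'I_(Q * q) | tower_label w x == i]| =
    #|{: 'I_B * 'I_Q}| * q * (L * M) by exact: tower_label_card.
have [s' cs'] := cnt_transport x0 M'0 (@tower_map_inj _ _ _ _ q2 shQ) lab_card.
exists (#|{: 'I_B * 'I_Q}| * q * (L * M)), s', (Q * q); split.
- by rewrite card_prod !card_ord /Q; lia.
- by rewrite leq_pmull.
- move=> i j; have := cs' 1 i j => /= ->.
  apply: leq_trans (tower_cnt1_ge w_per q2 shQ i j).
  rewrite card_prod !card_ord leq_mul2l; apply/orP; right.
  rewrite leq_mul2l; apply/orP; right.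
  by apply: leq_trans (orbit_word_transitions c0 s_bij L0 i j); rewrite leq_mul2l sk orbT.
- move=> i j; rewrite cs'; apply: leq_trans (tower_cntQ_ge w_per q2 shQ i j).
  by rewrite leq_mul2l /sh (sum_shift_average i j w_per w_let B1B) leqnn orbT.
Qed.

Local Open Scope ring_scope.

(** * From integer counts to real frequencies *)

Section RealFrequencies.
Variable R : realType.

(** The [N^2] numbers [f - g + e] are nonnegative and add up to [e * N^2], so each of them is at
    most that total. *)
Lemma lower_bound_abs N (f g : 'I_N -> 'I_N -> R) (e : R) : 0 <= e ->
  \sum_i \sum_j f i j = \sum_i \sum_j g i j ->
  (forall i j, g i j - e <= f i j) -> forall i j, `|f i j - g i j| <= e * N%:R ^+ 2.
Proof.
move=> e0 fg lb i j.
have N1 : 1 <= N%:R :> R by rewrite ler1n; case: (N) i => [[]|].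
have E0 : \sum_i \sum_j (f i j - g i j + e) = e * N%:R ^+ 2.
  transitivity (\sum_(i < N) (\sum_(j < N) f i j - \sum_(j < N) g i j + e *+ N)).
    apply: eq_bigr => a _; rewrite big_split /= sumr_const card_ord; congr (_ + _).
    by rewrite sumrB.
  rewrite big_split /= sumrB fg subrr add0r sumr_const card_ord.
  by rewrite -mulrnA -[e *+ _]mulr_natr natrM expr2.
have ge0 a b : 0 <= f a b - g a b + e by have := lb a b; lra.
have le : f i j - g i j + e <= e * N%:R ^+ 2.
  rewrite -E0 (bigD1 i)//= (bigD1 j)//= -addrA lerDl addr_ge0// ?sumr_ge0// => a _.
  by rewrite sumr_ge0.
have N2 : 1 <= N%:R ^+ 2 :> R by rewrite exprn_ege1.
rewrite ler_norml; apply/andP; split; last by lra.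
by have := lb i j; nra.
Qed.

Definition mixture_density (N : nat) (lambda : R) (i j : 'I_N) : R :=
  lambda * (i == j)%:R / N%:R + (1 - lambda) / N%:R ^+ 2.

Lemma mixing_permutation_freq N (p : 'I_N -> 'I_N -> R) (lambda e : R) (k0 : nat) :
  (0 < N)%N -> (forall i j, 0 <= p i j) ->
  (forall i, \sum_j p i j = N%:R^-1) -> (forall j, \sum_i p i j = N%:R^-1) ->
  0 <= lambda <= 1 -> 0 < e ->
  exists M', exists2 s : {perm 'I_(N * M')}, (0 < M')%N & exists2 n, (k0 <= n)%N &
  forall i j,
    `|(cnt (@block N M') s i j)%:R / (N * M')%:R - p i j| <= e /\
    `|(cnt (@block N M') (iter n s) i j)%:R / (N * M')%:R - mixture_density lambda i j| <= e.
Proof.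
move=> N0 p0 prow pcol /andP[l0 l1] e0.
have N0' : 0 < N%:R :> R by rewrite ltr0n.
have [K0 HK0] : exists K0 : nat, 3 * N%:R ^+ 2 / e < K0%:R.
  by exists (Num.truncn (3 * N%:R ^+ 2 / e)).+1; exact: truncnS_gt.
(* A single parameter serves as slot number, segment length, group number and tower multiplicity. It
   must beat [3 N^2 / e] and [k0], and be at least 2 for the truncated [q - 2] to be a true
   difference. *)
pose K := (maxn K0 k0).+2.
have K2 : (1 < K)%N by [].
have k0K : (k0 <= K)%N by rewrite /K; have := leq_maxr K0 k0; lia.
have eK : 3 / K%:R * N%:R ^+ 2 <= e.
  rewrite mulrAC ler_pdivrMr ?ltr0n// [leRHS]mulrC -ler_pdivrMr// ltW// (lt_le_trans HK0)//.
  by rewrite ler_nat /K; have := leq_maxl K0 k0; lia.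
move: K K2 k0K eK => K K2 k0K eK.
have K0' : 0 < K%:R :> R by rewrite ltr0n ltnW.
(* The factor [N * K] turns the sums [1 / N] into [K]; rounding down keeps them at most [K]. *)
pose k i j := Num.truncn ((N * K)%:R * p i j).
have kE i j : (k i j)%:R <= (N * K)%:R * p i j < (k i j).+1%:R.
  by apply: truncn_itv; rewrite mulr_ge0.
have NK : (N * K)%:R * N%:R^-1 = K%:R :> R by rewrite natrM mulrAC mulfV ?gt_eqF// mul1r.
have krow i : (\sum_j k i j <= K)%N.
  rewrite -(ler_nat R) natr_sum -NK -(prow i) mulr_sumr ler_sum// => j _.
  by case/andP: (kE i j).
have kcol j : (\sum_i k i j <= K)%N.
  rewrite -(ler_nat R) natr_sum -NK -(pcol j) mulr_sumr ler_sum// => i _.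
  by case/andP: (kE i j).
(* The number of groups with averaged shift, a proportion [1 - lambda] up to [1 / K]. *)
pose B1 := Num.truncn ((1 - lambda) * K%:R).
have /andP[B1l B1u] : B1%:R <= (1 - lambda) * K%:R < B1.+1%:R.
  by apply: truncn_itv; rewrite mulr_ge0// subr_ge0.
have B1K : (B1 <= K)%N by rewrite -(ler_nat R); nra.
have Kgt0 := ltnW K2.
have [M' [s [n [TE qn c1 c2]]]] := mixing_permutation N0 Kgt0 Kgt0 Kgt0 B1K K2 krow kcol.
have T0 : (0 < N * M')%N by rewrite TE !muln_gt0 Kgt0 N0.
have M'0 : (0 < M')%N by move: T0; rewrite muln_gt0 => /andP[].
have T0' : 0 < (N * M')%:R :> R by rewrite ltr0n.
exists M', s => //; exists n; first exact: leq_trans qn.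
pose x : R := K%:R^-1.
have x0 : 0 < x by rewrite invr_gt0.
have x1 : x <= 2^-1 by rewrite lef_pV2 ?posrE// ler_nat.
have xK : x * K%:R = 1 by rewrite mulVf// gt_eqF.
have eE : 3 / K%:R * N%:R ^+ 2 = (3 * x) * N%:R ^+ 2 by [].
have TR : (N * M')%:R = N%:R ^+ 2 * K%:R ^+ 6 :> R.
  by rewrite TE -!natrX -natrM; congr (_%:R); ring.
have sumf (f : 'I_(N * M') -> 'I_(N * M')) :
    \sum_i \sum_j (cnt (@block N M') f i j)%:R / (N * M')%:R = 1 :> R.
  transitivity ((\sum_i \sum_j cnt (@block N M') f i j)%N%:R / (N * M')%:R : R).
    rewrite natr_sum mulr_suml; apply: eq_bigr => i _.
    by rewrite natr_sum mulr_suml.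
  by rewrite sum_cnt card_ord mulfV// gt_eqF.
have p1 i j : p i j <= 1.
  apply: (@le_trans _ _ (\sum_j p i j)); first by rewrite (bigD1 j)//= lerDl sumr_ge0.
  by rewrite prow invf_le1// ler1n.
have NN : \sum_(i < N) N%:R^-1 = 1 :> R.
  by rewrite sumr_const card_ord -[_ *+ N]mulr_natr mulVf// gt_eqF.
(* The losses are a factor [1 - x] for the tops of the towers, another for the seams of the word,
   and the rounding of [k]; as [p i j <= 1], they total at most [3 * x]. *)
have lb1 i j : p i j - 3 * x <= (cnt (@block N M') s i j)%:R / (N * M')%:R.
  have := c1 i j; rewrite -(ler_nat R) => h.
  rewrite ler_pdivlMr//; apply: le_trans h.
  rewrite TR !natrM natrB ?(ltnW K2)// -subn1 natrB ?(ltnW K2)//.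
  have [_ ku] := andP (kE i j).
  have ku' : N%:R * K%:R * p i j - 1 <= (k i j)%:R by rewrite lerBlDr natr1 -natrM ltW.
  have N1 : 1 <= N%:R :> R by rewrite ler1n.
  have -> : (K%:R - 1) * (K%:R * (N%:R * K%:R * K%:R) * ((K%:R - 1) * (k i j)%:R)) =
     N%:R * K%:R ^+ 5 * ((1 - x) ^+ 2 * (k i j)%:R) :> R.
    have -> : 1 - x = (K%:R - 1) / K%:R by rewrite mulrBl mulfV ?gt_eqF// mul1r.
    by field; exact: lt0r_neq0.
  have -> : (p i j - 3 * x) * (N%:R ^+ 2 * K%:R ^+ 6) =
      N%:R * K%:R ^+ 5 * ((p i j - 3 * x) * (N%:R * K%:R)) by ring.
  rewrite ler_pM2l ?mulr_gt0 ?exprn_gt0//.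
  apply: le_trans (_ : (1 - x) ^+ 2 * (N%:R * K%:R * p i j - 1) <= _); last first.
    by rewrite ler_wpM2l ?sqr_ge0.
  have -> : N%:R * K%:R * p i j - 1 = (N%:R * K%:R) * (p i j - x / N%:R).
    by rewrite mulrBr /x; congr (_ - _); field; rewrite !lt0r_neq0.
  rewrite [X in _ <= X]mulrCA [X in X <= _]mulrC ler_pM2l ?mulr_gt0//.
  have xN : x / N%:R <= x by rewrite ler_pdivrMr// ler_peMr// ltW.
  have xN0 : 0 <= x / N%:R by rewrite divr_ge0// ltW.
  by have := p0 i j; have := p1 i j; nra.
(* The discarded two periods cost [2 * x] and the rounding of [B1] costs [x]. *)
have lb2 i j : mixture_density lambda i j - 3 * x <=
    (cnt (@block N M') (iter n s) i j)%:R / (N * M')%:R.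
  have := c2 i j; rewrite -(ler_nat R) => h.
  rewrite ler_pdivlMr//; apply: le_trans h.
  rewrite TR natrM natrD !natrM (natrB _ B1K) natrB//.
  rewrite /mixture_density.
  have d01 : 0 <= ((i == j)%:R : R) <= 1 by case: (i == j); rewrite ?lexx ?ler01.
  move: ((i == j)%:R : R) d01 => d /andP[d0 d1].
  pose b : R := B1%:R / K%:R.
  have bl : b <= 1 - lambda by rewrite ler_pdivrMr.
  have bu : 1 - lambda - x <= b.
    rewrite lerBlDr (_ : b + x = B1.+1%:R / K%:R) ?ler_pdivlMr ?ltW//.
    by rewrite /b /x -natr1 mulrDl mul1r.
  have b0 : 0 <= b by rewrite divr_ge0.
  have -> : B1%:R = b * K%:R by rewrite divfK// gt_eqF.
  have -> : (K%:R - 2) * (b * K%:R * (K%:R * K%:R * (K%:R * K%:R)) +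
      (K%:R - b * K%:R) * (N%:R * K%:R * K%:R * (d * (K%:R * K%:R)))) =
      N%:R ^+ 2 * K%:R ^+ 6 * ((1 - 2 * x) * (b * N%:R^-1 ^+ 2 + (1 - b) * (d * N%:R^-1))).
    have -> : 1 - 2 * x = (K%:R - 2) / K%:R by rewrite mulrBl mulfV ?gt_eqF.
    by field; rewrite !lt0r_neq0.
  rewrite [X in X <= _]mulrC ler_pM2l ?mulr_gt0 ?exprn_gt0//.
  have N1 : N%:R^-1 <= 1 :> R by rewrite invf_le1// ler1n.
  have N00 : 0 <= N%:R^-1 :> R by rewrite invr_ge0.
  rewrite -exprVn.
  move: (N%:R^-1) N1 N00 => y y1 y0.
  have y2 : y ^+ 2 <= 1 by rewrite expr_le1.
  have y20 := sqr_ge0 y; move: (y ^+ 2) y2 y20 => z z1 z0.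
  have dy0 : 0 <= d * y by rewrite mulr_ge0.
  have dy1 : d * y <= 1 by rewrite mulr_ile1.
  rewrite -mulrA; move: (d * y) dy0 dy1 => g g0 g1.
  have t1 : lambda * g + (1 - lambda) * z - x <= b * z + (1 - b) * g by nra.
  have t2 : b * z + (1 - b) * g <= 1 by nra.
  have t3 : 0 <= b * z + (1 - b) * g by nra.
  by move: (b * z + (1 - b) * g) t1 t2 t3 => u t1 t2 t3; nra.
move=> i j; split.
  apply: le_trans (lower_bound_abs (e := 3 * x)
    (f := fun i j => (cnt (@block N M') s i j)%:R / (N * M')%:R) _ _ lb1 i j) _ => //.
  - by rewrite mulr_ge0// ltW.
  - by rewrite sumf -NN; apply: eq_bigr => a _; rewrite prow.
apply: le_trans (lower_bound_abs (e := 3 * x)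
  (f := fun i j => (cnt (@block N M') (iter n s) i j)%:R / (N * M')%:R) _ _ lb2 i j) _ => //.
- by rewrite mulr_ge0// ltW.
rewrite sumf -NN; apply: eq_bigr => a _; rewrite /mixture_density big_split /=.
rewrite sumr_const card_ord (bigD1 a)//= eqxx mulr1 big1 => [|b /negbTE ba]; last first.
  by rewrite eq_sym ba mulr0 mul0r.
by rewrite addr0 -[_ *+ N]mulr_natr; field; exact: lt0r_neq0.
Qed.

End RealFrequencies.

(** * Genericity *)

Section GenericMixtures.
Variable R : realType.
Notation I := (unit_itv R).
Notation m := (lebI R).
Notation L2 := (L2 m).

Lemma ind_cell_block N M (i : 'I_N) : (0 < M)%N ->
  ind (@cell R N i) = \sum_(c < N * M | block c == i) ind (@cell R (N * M) c).
Proof.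
move=> M0; have N0 : (0 < N)%N by case: (N) i => [[]|].
rewrite (ind_cell_refine R i N0 M0).
have bnd (u : 'I_M) : (i * M + u < N * M)%N.
  by rewrite (leq_trans (_ : _ < i.+1 * M)%N) ?leq_mul2r ?ltn_ord ?orbT// mulSn addnC ltn_add2r.
rewrite (reindex_onto (fun u => Ordinal (bnd u)) (fun c => Ordinal (ltn_pmod c M0))) /=.
  apply: eq_big => [u|u _]; last by [].
  rewrite -!val_eqE /= divnMDl// divn_small// addn0 eqxx /=.
  by rewrite modnMDl modn_small// eqxx.
move=> c /eqP ci; apply: val_inj => /=.
by rewrite -ci /= -divn_eq.
Qed.

(** The indices are exchanged because Koopman operators pull back: the indicator of cell [i] becomes
    that of the points which reach cell [i], counted inside cell [j]. *)
Lemma inner_iter_iet N M (s : {perm 'I_(N * M)}) (T0 : (0 < N * M)%N) n (i j : 'I_N) :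
  inner (iter n (koopman (iet_autom R T0 s)) (ind (@cell R N i))) (ind (@cell R N j)) =
  ((cnt (@block N M) (iter n s) j i)%:R / (N * M)%:R)%:C%C.
Proof.
have M0 : (0 < M)%N by move: T0; rewrite muln_gt0 => /andP[].
have lin := iter_linop n (koopman_linop (iet_autom R T0 s)).
rewrite !(ind_cell_block _ M0).
rewrite linop_sum// inner_suml.
rewrite (eq_bigr (fun c => \sum_(d < N * M | block d == j)
    ((c == iter n s d)%:R / (N * M)%:R : R)%:C%C)); last first.
  move=> c _; rewrite inner_sumr; apply: eq_bigr => d _.
  rewrite iter_koopman_iet inner_cell//; congr ((_%:R / _)%:C%C); congr nat_of_bool.
  have K : cancel (iter n s) (iter n (s^-1)%g).
    by move=> y; rewrite !iter_perm expgVn permK.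
  have K' : cancel (iter n (s^-1)%g) (iter n s).
    by move=> y; rewrite !iter_perm expgVn permKV.
  by apply/eqP/eqP => [<-|->]; rewrite ?K'.
rewrite exchange_big /= /cnt natr_sum mulr_suml rmorph_sum.
rewrite big_mkcond; apply: eq_bigr => d _.
case: (block d == j); last by rewrite mul0r.
rewrite big_mkcond (bigD1 (iter n s d))//= eqxx big1 ?addr0.
  by case: (block _ == i); rewrite ?mul0r.
by move=> c /negbTE cd; rewrite cd mul0r; case: ifP.
Qed.

Lemma inner_koopman_cell (T : autom m) K i j :
  inner (koopman T (ind (@cell R K i))) (ind (@cell R K j)) =
  (mr (T @^-1` cell K i `&` cell K j))%:C%C.
Proof.
rewrite koopman_ind ?inner_ind//; try exact: measurable_cell.
exact/(measurable_preim (autom_measurable T))/measurable_cell.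
Qed.

(** Column sums split the preimage of a cell along the cells; row sums do the same for the inverse,
    the entries being exchanged by passing to the adjoint. *)
Lemma autom_density (T : autom m) K : (0 < K)%N ->
  let p (i j : 'I_K) := mr (T @^-1` @cell R K j `&` cell K i) in
  [/\ forall i j, 0 <= p i j, forall i, \sum_j p i j = K%:R^-1 &
      forall j, \sum_i p i j = K%:R^-1].
Proof.
move=> K0 p; have mT := autom_measurable T; have pT := autom_preserving T.
have mc i : measurable (@cell R K i) by exact: measurable_cell.
have mrc (i : 'I_K) : mr (@cell R K i) = K%:R^-1 by rewrite /mr measure_cell.
split=> [i j|i|j]; first exact: mr_ge0.
  pose S := autom_inv T.
  transitivity (\sum_(j < K) mr (S @^-1` @cell R K i `&` @cell R K j)).
    apply: eq_bigr => j _; have E : (p i j)%:C%C =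
        (mr (S @^-1` @cell R K i `&` @cell R K j))%:C%C :> R[i].
      rewrite -!inner_koopman_cell inner_koopmanV inner_sym -/S inner_koopman_cell.
      exact: conjc_real.
    by case: E.
  rewrite -mr_partition//.
    by rewrite (mp_mr (autom_preserving S))// mrc.
  exact: measurable_preim (autom_measurable S) _.
rewrite -(mrc j) -(mp_mr pT (mc j)) (mr_partition K0)//.
exact: measurable_preim.
Qed.

Variable lambda : R.
Hypothesis lambda01 : 0 <= lambda <= 1.

(** Strict inequalities on finitely many entries make the set open; the lower bounds on [n] and [l]
    let both tend to infinity along [k]. *)
Definition near_mixture (k : nat) : set (autom m) :=
  [set T | exists n l, [/\ (k <= n)%N, (k <= l)%N & forall i j : 'I_(2 ^ l),
    Normc.normc (inner (iter n (koopman T) (ind (@cell R (2 ^ l) i))) (ind (@cell R (2 ^ l) j)) -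
      (mixture_density lambda i j)%:C%C) < (8 ^+ l)^-1]].

Lemma open_near_mixture k : open (near_mixture k).
Proof.
rewrite openE => T [n [l [kn kl H]]]; rewrite /interior.
have FT : Filter (nbhs T) := nbhs_filter T.
pose P (ij : 'I_(2 ^ l) * 'I_(2 ^ l)) : set (autom m) := [set S |
    Normc.normc (inner (iter n (koopman S) (ind (@cell R (2 ^ l) ij.1)))
      (ind (@cell R (2 ^ l) ij.2)) - (mixture_density lambda ij.1 ij.2)%:C%C) < (8 ^+ l)^-1].
have : nbhs T [set S | forall ij, P ij S].
  apply: (@filter_forall _ _ P _ FT) => -[i j]; rewrite /P /=.
  set z := (mixture_density lambda i j)%:C%C.
  set d := (8 ^+ l)^-1 - Normc.normc (inner (iter n (koopman T) (ind (@cell R (2 ^ l) i)))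
    (ind (@cell R (2 ^ l) j)) - z).
  have d0 : 0 < d by rewrite subr_gt0.
  have d0C : 0 < d%:C%C :> R[i] by rewrite ltcR.
  have /cvgrPdist_lt /(_ _ d0C) := @continuous_inner_iter R n (ind (@cell R (2 ^ l) i))
    (ind (@cell R (2 ^ l) j)) T.
  apply: filterS => S; rewrite distrC ltCR ltrBrDr; apply: le_lt_trans.
  by apply: le_trans (le_normcD _ _); rewrite addrA subrK.
by apply: filterS => S HS; exists n, l; split => // i j; exact: (HS (i, j)).
Qed.

(** At rank [l] a permutation imitates [T] after one step and the mixture after [n] steps. Its
    distance from [T] vanishes as [l] grows, while membership holds for every [l >= k]. *)
Lemma dense_near_mixture k : dense (near_mixture k).
Proof.
move=> W [T WT] oW.
have approx l : exists S : autom m, ((k <= l)%N -> near_mixture k S) /\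
    forall i j : 'I_(2 ^ l),
    Normc.normc (inner (koopman S (ind (@cell R (2 ^ l) i))) (ind (@cell R (2 ^ l) j)) -
      inner (koopman T (ind (@cell R (2 ^ l) i))) (ind (@cell R (2 ^ l) j))) <= (8 ^+ l)^-1.
  have K0 : (0 < 2 ^ l)%N by rewrite expn_gt0.
  have [p0 prow pcol] := autom_density T K0.
  have e0 : 0 < (8 ^+ l)^-1 / 2 :> R by rewrite divr_gt0// invr_gt0 exprn_gt0.
  have [M' [s M0 [n kn H]]] := mixing_permutation_freq k K0 p0 prow pcol lambda01 e0.
  have T0 : (0 < 2 ^ l * M')%N by rewrite muln_gt0 K0.
  have el : (8 ^+ l)^-1 / 2 < (8 ^+ l)^-1 :> R.
    by rewrite ltr_pdivrMr// ltr_pMr ?invr_gt0 ?exprn_gt0// ltr1n.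
  exists (iet_autom R T0 s); split=> [kl|i j].
    exists n, l; split => // i j; rewrite inner_iter_iet -rmorphB normRC.
    have [_] := H j i; rewrite /mixture_density eq_sym => h.
    exact: le_lt_trans h el.
  rewrite (inner_iter_iet s T0 1) inner_koopman_cell -rmorphB normRC.
  by have [h _] := H j i; exact: le_trans h (ltW el).
have [F HF] := choice approx.
have FT : F @ \oo --> T.
  have W' : wot_cvg (fun l => koopman (F l)) (koopman T).
    apply: (@wot_cvg_cells _ _ _ 1 _ _ _ _ id) => //.
    - by move=> n; exact: koopman_linop.
    - exact: koopman_linop.
    - by move=> n f; rewrite L2norm_koopman mul1r.
    - by move=> f; rewrite L2norm_koopman mul1r.
    - move=> l c d cl dl; have [_ h] := HF l.
      exact: (h (Ordinal cl) (Ordinal dl)).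
  by apply: autom_cvg => r i r' j _ _; apply/cvgCP; exact: W'.
have /FT[N _ HN] : nbhs T W by exact: open_nbhs_nbhs.
exists (F (maxn N k)); split; first by apply: HN; exact: leq_maxl.
by have [h _] := HF (maxn N k); apply: h; exact: leq_maxr.
Qed.

Lemma near_mixture_weak_limit (V : {linear L2 -> L2}) (T : autom m) :
  (forall f, V f = mixture lambda f) -> (forall k, near_mixture k T) ->
  weak_limit_semigroup T V.
Proof.
move=> VE H.
have [f Hf] := choice H; have [g Hg] := choice Hf.
(* Requesting the next power beyond [(f (ks k)).+1] makes the exponents strictly increase;
   [ks k >= k] sends the ranks to infinity. *)
pose ks := fix ks k := if k is k'.+1 then maxn k (f (ks k')).+1 else 0%N.
have ks_ge k : (k <= ks k)%N by case: k => //= k; exact: leq_maxl.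
exists (fun k => f (ks k)).
  apply: (homo_ltn ltn_trans) => k /=.
  have [h _ _] := Hg (maxn k.+1 (f (ks k)).+1).
  by apply: leq_trans h; exact: leq_maxr.
have linV : linop V by split=> *; [exact: raddfD|exact: linearZ].
apply: (@wot_cvg_cells _ _ _ 3 _ _ _ _ (fun k => g (ks k))) => //.
- by move=> n; apply: iter_linop; exact: koopman_linop.
- by move=> n h; rewrite L2norm_iter_koopman ler_peMl ?L2norm_ge0// ler1n.
- by move=> h; rewrite VE; exact: mixture_bounded.
- by move=> k; have [_ h _] := Hg (ks k); exact: leq_trans (ks_ge k) h.
move=> k c d cl dl; have [_ _ h] := Hg (ks k).
have := h (Ordinal cl) (Ordinal dl).
rewrite VE (inner_mixture_cell lambda (Ordinal cl) (Ordinal dl)) ?expn_gt0//.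
exact: ltW.
Qed.

End GenericMixtures.

Theorem theorem3p6 (R : realType)
    (V : {linear L2 (@unit_itv_measure R) -> L2 (@unit_itv_measure R)})
    (V_bounded : bounded_operator V) :
  comeager [set T : autom (@unit_itv_measure R) | weak_limit_semigroup T V] <->
  exists lambda : R, 0 <= lambda <= 1 /\
    forall f : L2 (@unit_itv_measure R),
      V f = lambda%:C%C *: f + (1 - lambda)%:C%C *: Pconst f.
Proof.
split=> [[G [_ dG GV]]|[lambda [lambda01 VE]]].
  apply: (weak_limit_mixture V_bounded) => W W0 oW.
  by have [T [WT GT]] := dG W W0 oW; exists T; split => //; exact: GV.
exists (\bigcap_k near_mixture lambda k); split.
- by exists (near_mixture lambda) => // k; exact: open_near_mixture.
- by apply: autom_baire => k; [exact: open_near_mixture|exact: dense_near_mixture].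
- move=> T HT; apply: (near_mixture_weak_limit lambda01 VE) => k.
  exact: HT.
Qed.
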